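(* Let $T:I\to I$ and $r:I\to\mathbb{R}_+$ satisfy all the assumptions listed in the context, including UNI with constants $D>0$ and $n_0\ge 1$. Then there exist $A\ge n_0$, $\gamma<1$ and $\epsilon>0$ such that for every real $\sigma$ with $|\sigma|<\epsilon$, every real $t$ with $|t|\ge\max(2\pi/D,4)$, and every integer $n\ge A\log|t|$, the transfer operator $L_s$ with $s=\sigma+it$ satisfies $$\|L_s^n\|_{1,t}\le\gamma^n .$$
   Context: Let $0<c_1<\dots<c_m<c_{m+1}<\dots<1$ be points defining a finite or countable partition of $I=[0,1]$ into subintervals; every subinterval of the partition (including those with endpoint $0$ or $1$) is denoted generically $(c_m,c_{m+1})$. Let $T:I\to I$ be such that each $T|_{(c_m,c_{m+1})}$ is $C^2$ and extends to a homeomorphism from $[c_m,c_{m+1}]$ onto $I$. Let $\mathcal{H}_n$ be the set of inverse branches $h:I\to h(I)$ of $T^n$ and $\mathcal{H}=\mathcal{H}_1$ the set of inverse branches $h:I\to[c_m,c_{m+1}]$ of $T$ (inverses of these homeomorphisms; $\mathcal{H}_n$ consists of the $n$-fold compositions of elements of $\mathcal{H}$). Assumptions on $T$: (expansion) there are $C\ge1$ and $\hat\rho<1$ with $|h(x)-h(y)|\le C\hat\rho^n|x-y|$ for all $n\ge 1$, all $h\in\mathcal{H}_n$ and all $x,y\in I$; (Renyi's condition) there is $K>0$ such that $|h''|\le K|h'|$ for every $h\in\mathcal{H}$. Assumptions on $r:I\to\mathbb{R}_+$: each $r|_{(c_m,c_{m+1})}$ is $C^1$; $\inf r>0$; there is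 $\sigma_0<0$ such that $\sum_{h\in\mathcal{H}}\sup\big(\exp(-\sigma(r\circ h))\,|h'|\big)<\infty$ for all $\sigma>\sigma_0$; and $|r'\circ h|\cdot|h'|\le K$ for all $h\in\mathcal{H}$. Functions such as $h'$ and $r\circ h$ are understood as extended to the whole of $I$, with $r\circ h\in C^1(I)$. For $n\ge1$, $r^{(n)}(x)=\sum_{k=0}^{n-1}r(T^k(x))$, with the same convention for $r^{(n)}\circ h$, $h\in\mathcal{H}_n$. UNI (for the pair $(T,r)$, with constants $D$, $n_0$): there exist $D>0$ and $n_0\ge1$ such that for every integer $n\ge n_0$ there are two elements $h,k\in\mathcal{H}_n$ for which the function $\psi_{h,k}(x)=r^{(n)}(h(x))-r^{(n)}(k(x))$ on $I$ satisfies $\inf_I|\psi_{h,k}'|\ge D$. Transfer operators: for $s=\sigma+it$ with $\sigma>\sigma_0$, $t\in\mathbb{R}$, $$L_sf(x)=\sum_{h\in\mathcal{H}}e^{-s\,r(h(x))}\,|h'(x)|\,f(h(x)),$$ acting on the space $C^1(I)$ of complex-valued $C^1$ functions. For $t\neq0$, $\|f\|_{1,t}=\sup|f|+\frac{\sup|f'|}{|t|}$ on $C^1(I)$, and $\|\cdot\|_{1,t}$ also denotes the associated operator norm. *)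

(* Defs.v *)
From Stdlib Require Import Reals List.
From Coquelicot Require Import Coquelicot.
Open Scope R_scope.

Definition I (x : R) : Prop := 0 <= x <= 1.
Definition Iopen (x : R) : Prop := 0 < x < 1.

(* Derivative at x of a function on I: one-sided at the end points. *)
Definition is_derive_I {V : NormedModule R_AbsRing} (f : R -> V) (x : R) (l : V)
  : Prop :=
  filterdiff f (within I (locally x)) (fun y : R => scal y l).

Definition is_C1_I {V : NormedModule R_AbsRing} (f df : R -> V) : Prop :=
  continuous_on I df /\ forall x, I x -> is_derive_I f x (df x).

Definition C1_I {V : NormedModule R_AbsRing} (f : R -> V) : Prop :=
  exists df : R -> V, is_C1_I f df.

(* [idx] selects the natural numbers that index the subintervals
   (lft j, rgt j) of the partition; it may be finite or infinite.
   For j with idx j = true: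
   [br j]  is the inverse branch h : I -> [lft j, rgt j];
   [dbr j] is h' on I;
   [rbr j] is the continuous extension to I of (r o h).
   Only the values of these functions on I matter, and the assumptions below
   determine them there. *)
Record system := System {
  idx  : nat -> bool;
  lft  : nat -> R;
  rgt  : nat -> R;
  T    : R -> R;
  roof : R -> R;
  br   : nat -> R -> R;
  dbr  : nat -> R -> R;
  rbr  : nat -> R -> R
}.

(* A countable set (the range of c) contains every point of I outside the open
   subintervals: the division points, 0, 1 and any accumulation points. *)
Definition is_partition (S : system) : Prop :=
  (forall j, idx S j = true -> 0 <= lft S j < rgt S j /\ rgt S j <= 1) /\
  (forall i j, idx S i = true -> idx S j = true -> i <> j ->
     forall x, ~ (lft S i < x < rgt S i /\ lft S j < x < rgt S j)) /\
  (exists c : nat -> R, forall x, I x ->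
     (forall j, idx S j = true -> ~ (lft S j < x < rgt S j)) ->
     exists n, c n = x).

Definition C2_at (f : R -> R) (x : R) : Prop :=
  ex_derive_n f 1 x /\ ex_derive_n f 2 x /\ continuous (Derive_n f 2) x.

Definition homeo_ext_with_inverse (f : R -> R) (a b : R) (h : R -> R) : Prop :=
  exists F : R -> R,
    (forall x, a < x < b -> F x = f x) /\
    continuous_on (fun x => a <= x <= b) F /\
    continuous_on I h /\
    (forall x, a <= x <= b -> I (F x)) /\
    (forall y, I y -> a <= h y <= b) /\
    (forall x, a <= x <= b -> h (F x) = x) /\
    (forall y, I y -> F (h y) = y).

Definition piecewise_C2_full_branches (S : system) : Prop :=
  (forall x, I x -> I (T S x)) /\
  (forall j, idx S j = true ->
     (forall x, lft S j < x < rgt S j -> C2_at (T S) x) /\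
     homeo_ext_with_inverse (T S) (lft S j) (rgt S j) (br S j) /\
     is_C1_I (br S j) (dbr S j)).

(* An inverse branch of T^n is encoded by the word of its n factors. *)
Definition is_word (S : system) (n : nat) (w : list nat) : Prop :=
  length w = n /\ List.Forall (fun j => idx S j = true) w.

Fixpoint brw (S : system) (w : list nat) (x : R) : R :=
  match w with
  | nil => x
  | cons j w' => br S j (brw S w' x)
  end.

Definition expanding (S : system) (C0 rho : R) : Prop :=
  1 <= C0 /\ rho < 1 /\
  forall n w, (1 <= n)%nat -> is_word S n w ->
    forall x y, I x -> I y ->
      Rabs (brw S w x - brw S w y) <= C0 * rho ^ n * Rabs (x - y).

(* On (0,1) the branches are C^2 because T is C^2 and expanding on each open
   subinterval; by continuity nothing is lost at the end points. *)
Definition renyi (S : system) (K : R) : Prop :=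
  0 < K /\
  forall j, idx S j = true -> forall x, Iopen x ->
    Rabs (Derive_n (br S j) 2 x) <= K * Rabs (dbr S j x).

(* In the series, each supremum is that of a function continuous on I, hence
   finite. *)
Definition roof_assumptions (S : system) (K sigma0 : R) : Prop :=
  (forall j, idx S j = true -> forall x, lft S j < x < rgt S j ->
     ex_derive (roof S) x /\ continuous (Derive (roof S)) x) /\
  (exists r0, 0 < r0 /\ forall x, I x -> r0 <= roof S x) /\
  (forall j, idx S j = true ->
     C1_I (rbr S j) /\
     forall x, Iopen x -> rbr S j x = roof S (br S j x)) /\
  sigma0 < 0 /\
  (forall sigma, sigma0 < sigma ->
     ex_series (fun j =>
       if idx S j then
         real (Lub_Rbar (fun v => exists x, I x /\
                 v = exp (- sigma * rbr S j x) * Rabs (dbr S j x)))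
       else 0)) /\
  (forall j, idx S j = true -> forall x, Iopen x ->
     Rabs (Derive (roof S) (br S j x)) * Rabs (dbr S j x) <= K).

(* r^(n) *)
Fixpoint birkhoff (S : system) (n : nat) (x : R) : R :=
  match n with
  | O => 0
  | Datatypes.S m => birkhoff S m x + roof S (Nat.iter m (T S) x)
  end.

Definition psi (S : system) (n : nat) (h k : list nat) (x : R) : R :=
  birkhoff S n (brw S h x) - birkhoff S n (brw S k x).

(* For x in (0,1) the orbits of h x and k x up to time n - 1 stay inside the
   open subintervals, so psi is given there by the values of r and T
   themselves, with no extension. The infimum of |psi'| over (0,1) is the
   infimum over I of its continuous extension. *)
Definition UNI (S : system) (D : R) (n0 : nat) : Prop :=
  0 < D /\ (1 <= n0)%nat /\
  forall n, (n0 <= n)%nat ->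
    exists h k, is_word S n h /\ is_word S n k /\
      forall x, Iopen x -> D <= Rabs (Derive (psi S n h k) x).

Definition Cexp (z : C) : C :=
  (exp (Re z) * cos (Im z), exp (Re z) * sin (Im z)).

Definition CSeries (u : nat -> C) : C :=
  (Series (fun j => Re (u j)), Series (fun j => Im (u j))).

Definition transfer (S : system) (s : C) (f : R -> C) (x : R) : C :=
  CSeries (fun j =>
    if idx S j then
      (Cexp (- s * RtoC (rbr S j x)) * RtoC (Rabs (dbr S j x))
       * f (br S j x))%C
    else RtoC 0).

Definition sup_mod (f : R -> C) : Rbar :=
  Rbar_lub (fun v => exists x, I x /\ v = Finite (Cmod (f x))).

(* sup |f'|, computed on (0,1), which for f in C^1(I) gives the supremum over
   I; it is +infinity if f is not differentiable on (0,1). *)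
Definition sup_mod_derive (f : R -> C_R_NormedModule) : Rbar :=
  Rbar_lub (fun v => exists x, Iopen x /\
    ((exists l : C, is_derive f x l /\ v = Finite (Cmod l)) \/
     (~ ex_derive f x /\ v = p_infty))).

Definition norm1 (t : R) (f : R -> C) : Rbar :=
  Rbar_plus (sup_mod f) (Rbar_div (sup_mod_derive f) (Finite (Rabs t))).

Definition opnorm1 (t : R) (L : (R -> C) -> R -> C) : Rbar :=
  Rbar_lub (fun v => exists f : R -> C_R_NormedModule,
    C1_I f /\ Rbar_le (norm1 t f) (Finite 1) /\ v = norm1 t (L f)).

(* Main.v *)
(** The operator L_s^n is a sum over the words w of n inverse branches, and all
estimates are made for finite sets of branches, uniformly in the set; only at the
end does the set exhaust the partition.

For a pair (u, v) with |v| <= u, where u and v vary at rate O(|t|) relative to u,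
and for a well-contracting n, the UNI condition gives two words h, k such that the
quotient of the two terms of L_s^n v at h and k has the form z e^{-it psi} with z
nearly constant at scale 1/|t| and |psi'| >= D.  If a, c are the two terms and
A, B their majorants, then with tau = 1 - Re ((a/A) conj (c/B))
  |a + c| <= A + B - (A B / (A + B)) tau.
The right-hand side defines a new majorant u', again varying at rate O(|t|); and
tau is bounded below on a fixed proportion of every interval of length O(1/|t|).

Let phi be a function with L_0 phi <= kappa phi, kappa > 1 close to 1.  By the
Cauchy-Schwarz inequality
  (L_sigma^n u)^2 <= (L_{2 sigma}^n phi) (L_0^n (u^2 / phi)),
the gain tau enters the first factor, and since L_0 does not increase Lebesgue
integrals, the integral of u^2 / phi is multiplied by some beta < 1 in each step.
Finally, O(log |t|) further iterations turn this integral into a bound for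
sup |L_s^n f|, because bounded distortion gives L_0^m g <= C (integral of g) once
the branches of T^m are shorter than the scale 1/|t| on which g varies; and the
rate O(|t|) of the majorant bounds the derivative. *)

Require Import Defs.
From Stdlib Require Import Reals List Permutation Lra Lia.
From Coquelicot Require Import Coquelicot.
Open Scope R_scope.

(** * Finite sums over lists *)

(** With a finite list of branches every sum is finite, so continuity, integration and reordering
    need no convergence argument; dropping branches keeps L_0 from increasing integrals. The price
    is that no constant may depend on the list, which only has to contain the letters of the two UNI
    words. Regularity is measured by a multiplicative Lipschitz condition instead of derivatives: it
    survives products, sums and pointwise limits, and the derivative is recovered only at the very
    end. The loss tau is used as it is, without cut-off functions, since it inherits its regularity
    at scale 1/|t| from the two terms. The order of the choices matters: the block length n and the
    gain of one block depend only on the geometry and on D; kappa is then taken so close to 1 that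
    kappa^n does not spoil the gain, and only then is the range of sigma restricted so that one phi
    serves for this kappa. *)

Definition lsum {X : Type} (F : X -> R) (l : list X) : R :=
  fold_right (fun a s => F a + s) 0 l.

Definition csum {X : Type} (F : X -> C) (l : list X) : C :=
  fold_right (fun a s => (F a + s)%C) (RtoC 0) l.

Lemma lsum_ext {X} (F G : X -> R) l :
  (forall a, In a l -> F a = G a) -> lsum F l = lsum G l.
Proof.
  induction l as [|a l IH]; simpl; intros H; auto.
  rewrite H, IH; auto.
Qed.

Lemma lsum_le {X} (F G : X -> R) l :
  (forall a, In a l -> F a <= G a) -> lsum F l <= lsum G l.
Proof.
  induction l as [|a l IH]; simpl; intros H; [lra|].
  apply Rplus_le_compat; auto.
Qed.

Lemma lsum_nonneg {X} (F : X -> R) l :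
  (forall a, In a l -> 0 <= F a) -> 0 <= lsum F l.
Proof.
  induction l as [|a l IH]; simpl; intros H; [lra|].
  apply Rplus_le_le_0_compat; auto.
Qed.

Lemma lsum_scal {X} (c : R) (F : X -> R) l :
  lsum (fun a => c * F a) l = c * lsum F l.
Proof. induction l as [|a l IH]; simpl; [ring|rewrite IH; ring]. Qed.

Lemma lsum_plus {X} (F G : X -> R) l :
  lsum (fun a => F a + G a) l = lsum F l + lsum G l.
Proof. induction l as [|a l IH]; simpl; [ring|rewrite IH; ring]. Qed.

Lemma lsum_map {X Y} (f : X -> Y) (F : Y -> R) l :
  lsum F (map f l) = lsum (fun a => F (f a)) l.
Proof. induction l as [|a l IH]; simpl; [auto|rewrite IH; auto]. Qed.

Lemma lsum_app {X} (F : X -> R) l l' : lsum F (l ++ l') = lsum F l + lsum F l'.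
Proof. induction l as [|a l IH]; simpl; [ring|rewrite IH; ring]. Qed.

Lemma lsum_flat_map {X Y} (f : X -> list Y) (F : Y -> R) l :
  lsum F (flat_map f l) = lsum (fun a => lsum F (f a)) l.
Proof. induction l as [|a l IH]; simpl; [auto|rewrite lsum_app, IH; auto]. Qed.

Lemma lsum_exchange {X Y} (F : X -> Y -> R) l l' :
  lsum (fun a => lsum (F a) l') l = lsum (fun b => lsum (fun a => F a b) l) l'.
Proof.
  induction l as [|a l IH]; simpl.
  - induction l'; simpl; [|rewrite <- IHl']; ring.
  - rewrite IH, lsum_plus; reflexivity.
Qed.

Lemma lsum_perm {X} (F : X -> R) l l' :
  Permutation l l' -> lsum F l = lsum F l'.
Proof. induction 1; simpl; lra. Qed.

(* Sedrakyan's form of the Cauchy-Schwarz inequality, which needs no square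
   roots. *)
Lemma lsum_cauchy_schwarz {X} (p q : X -> R) l :
  (forall a, In a l -> 0 <= p a /\ 0 <= q a) ->
  forall F : X -> R, (forall a, In a l -> F a ^ 2 <= p a * q a) ->
  lsum F l ^ 2 <= lsum p l * lsum q l.
Proof.
  induction l as [|a l IH]; intros Hpq F HF; simpl; [lra|].
  assert (Hl : lsum F l ^ 2 <= lsum p l * lsum q l).
  { apply IH; intros b Hb; [apply Hpq|apply HF]; simpl; auto. }
  assert (0 <= lsum p l) by (apply lsum_nonneg; intros b Hb; apply Hpq; simpl; auto).
  assert (0 <= lsum q l) by (apply lsum_nonneg; intros b Hb; apply Hpq; simpl; auto).
  destruct (Hpq a (or_introl eq_refl)) as [Hp Hq].
  assert (Ha := HF a (or_introl eq_refl)).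
  set (P := lsum p l) in *; set (Q := lsum q l) in *; set (S := lsum F l) in *.
  assert (Hc : 2 * (F a * S) <= p a * Q + P * q a).
  { apply Rsqr_incr_0_var; [|nra]. unfold Rsqr.
    apply Rle_trans with (4 * ((p a * q a) * (P * Q))).
    - apply Rle_trans with (4 * (F a ^ 2 * S ^ 2)); [nra|].
      apply Rmult_le_compat_l; [lra|].
      apply Rmult_le_compat; auto; apply pow2_ge_0.
    - pose proof (pow2_ge_0 (p a * Q - P * q a)). nra. }
  nra.
Qed.

Lemma csum_ext {X} (F G : X -> C) l :
  (forall a, In a l -> F a = G a) -> csum F l = csum G l.
Proof.
  induction l as [|a l IH]; simpl; intros H; auto.
  rewrite H, IH; auto.
Qed.

Lemma csum_scal {X} (c : C) (F : X -> C) l :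
  csum (fun a => (c * F a)%C) l = (c * csum F l)%C.
Proof. induction l as [|a l IH]; simpl; [ring|rewrite IH; ring]. Qed.

Lemma csum_app {X} (F : X -> C) l l' : csum F (l ++ l') = (csum F l + csum F l')%C.
Proof. induction l as [|a l IH]; simpl; [ring|rewrite IH; ring]. Qed.

Lemma csum_map {X Y} (f : X -> Y) (F : Y -> C) l :
  csum F (map f l) = csum (fun a => F (f a)) l.
Proof. induction l as [|a l IH]; simpl; [auto|rewrite IH; auto]. Qed.

Lemma csum_flat_map {X Y} (f : X -> list Y) (F : Y -> C) l :
  csum F (flat_map f l) = csum (fun a => csum F (f a)) l.
Proof. induction l as [|a l IH]; simpl; [auto|rewrite csum_app, IH; auto]. Qed.

Lemma csum_plus {X} (F G : X -> C) l :
  csum (fun a => (F a + G a)%C) l = (csum F l + csum G l)%C.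
Proof. induction l as [|a l IH]; simpl; [ring|rewrite IH; ring]. Qed.

Lemma csum_exchange {X Y} (F : X -> Y -> C) l l' :
  csum (fun a => csum (F a) l') l = csum (fun b => csum (fun a => F a b) l) l'.
Proof.
  induction l as [|a l IH]; simpl.
  - induction l'; simpl; [|rewrite <- IHl']; ring.
  - rewrite IH, csum_plus; reflexivity.
Qed.

Lemma csum_perm {X} (F : X -> C) l l' :
  Permutation l l' -> csum F l = csum F l'.
Proof. induction 1; simpl; congruence || ring. Qed.

Lemma Cmod_csum_le {X} (F : X -> C) (G : X -> R) l :
  (forall a, In a l -> Cmod (F a) <= G a) -> Cmod (csum F l) <= lsum G l.
Proof.
  induction l as [|a l IH]; simpl; intros H.
  - rewrite Cmod_0; lra.
  - eapply Rle_trans; [apply Cmod_triangle|]. apply Rplus_le_compat; auto.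
Qed.

(** * Cones of dominated pairs *)

(** The condition that log u is b-Lipschitz, in a form that admits u = 0 (empty sums) and is stable
    under sums. It is imposed on the whole line; functions on I will be extended by constants. *)
Definition loglip (b : R) (u : R -> R) : Prop :=
  forall x y, 0 <= u x /\ u y <= exp (b * Rabs (x - y)) * u x.

(* A multiplicative Lipschitz condition: the exponent b is additive under
   products and unchanged by sums. *)
Definition cone (b : R) (u : R -> R) (v : R -> C) : Prop :=
  loglip b u /\
  forall x y, Cmod (v x) <= u x /\
    Cmod (v x - v y) <= (exp (b * Rabs (x - y)) - 1) * u x.

Lemma exp_ge_1 (x : R) : 0 <= x -> 1 <= exp x.
Proof. intros H. rewrite <- exp_0. destruct H as [H| <-]; [left; apply exp_increasing; auto|lra]. Qed.

Lemma exp_le (x y : R) : x <= y -> exp x <= exp y.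
Proof. intros [H| ->]; [left; apply exp_increasing; auto|lra]. Qed.

Lemma exp_mult_abs_le (b b' x : R) : b <= b' -> exp (b * Rabs x) <= exp (b' * Rabs x).
Proof. intros H. apply exp_le, Rmult_le_compat_r; [apply Rabs_pos|auto]. Qed.

Lemma exp_pow_INR (x : R) (n : nat) : exp (x * INR n) = exp x ^ n.
Proof.
  induction n as [|n IH]; [simpl; rewrite Rmult_0_r; apply exp_0|].
  rewrite S_INR, Rmult_plus_distr_l, exp_plus, IH, Rmult_1_r. simpl. ring.
Qed.

(** Convexity trades a constant in front of exp y - 1 for the same constant in the exponent; this is
    how constants are absorbed by the cones. *)
Lemma expm1_double (y : R) : 0 <= y -> 2 * (exp y - 1) <= exp (2 * y) - 1.
Proof.
  intros H. replace (2 * y) with (y + y) by ring. rewrite exp_plus.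
  pose proof (exp_ge_1 y H). nra.
Qed.

Lemma loglip_weaken b b' u : b <= b' -> loglip b u -> loglip b' u.
Proof.
  intros Hb H x y. destruct (H x y) as [H0 H1]. split; auto.
  eapply Rle_trans; [apply H1|]. apply Rmult_le_compat_r; auto.
  apply exp_mult_abs_le; auto.
Qed.

Lemma loglip_diff b u x y :
  0 <= b -> loglip b u -> Rabs (u x - u y) <= (exp (b * Rabs (x - y)) - 1) * u x.
Proof.
  intros Hb H. destruct (H x y) as [H0 H1], (H y x) as [H2 H3].
  rewrite Rabs_minus_sym in H3.
  set (e := exp (b * Rabs (x - y))) in *.
  assert (He : 1 <= e) by (apply exp_ge_1, Rmult_le_pos; auto; apply Rabs_pos).
  assert (u x <= e * u y) by auto.
  apply Rabs_le; split; [lra|]. nra.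
Qed.

Lemma loglip_const b c : 0 <= b -> 0 <= c -> loglip b (fun _ => c).
Proof.
  intros Hb Hc x y. split; auto.
  assert (1 <= exp (b * Rabs (x - y))) by (apply exp_ge_1, Rmult_le_pos; auto; apply Rabs_pos).
  nra.
Qed.

Lemma loglip_mult b1 b2 u1 u2 :
  loglip b1 u1 -> loglip b2 u2 -> loglip (b1 + b2) (fun x => u1 x * u2 x).
Proof.
  intros H1 H2 x y. destruct (H1 x y), (H2 x y), (H1 y x), (H2 y x).
  split; [apply Rmult_le_pos; auto|].
  rewrite Rmult_plus_distr_r, exp_plus.
  replace (exp (b1 * Rabs (x - y)) * exp (b2 * Rabs (x - y)) * (u1 x * u2 x))
    with ((exp (b1 * Rabs (x - y)) * u1 x) * (exp (b2 * Rabs (x - y)) * u2 x)) by ring.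
  apply Rmult_le_compat; auto.
Qed.

Lemma loglip_plus b u1 u2 :
  loglip b u1 -> loglip b u2 -> loglip b (fun x => u1 x + u2 x).
Proof. intros H1 H2 x y. destruct (H1 x y), (H2 x y). split; nra. Qed.

Lemma loglip_comp b q u g :
  0 <= b -> (forall x y, Rabs (g x - g y) <= q * Rabs (x - y)) ->
  loglip b u -> loglip (b * q) (fun x => u (g x)).
Proof.
  intros Hb Hg H x y. destruct (H (g x) (g y)). split; auto.
  eapply Rle_trans; [eassumption|]. apply Rmult_le_compat_r; auto.
  apply exp_le. rewrite Rmult_assoc. apply Rmult_le_compat_l; auto.
Qed.

Lemma loglip_inv b u :
  loglip b u -> (forall x, 0 < u x) -> loglip b (fun x => / u x).
Proof.
  intros H Hp x y. split; [left; apply Rinv_0_lt_compat; auto|].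
  destruct (H y x) as [_ H1]. rewrite Rabs_minus_sym in H1.
  pose proof (Hp x); pose proof (Hp y).
  apply Rmult_le_reg_r with (u y); auto. rewrite Rinv_l by lra.
  apply Rmult_le_reg_r with (u x); auto.
  replace (exp (b * Rabs (x - y)) * / u x * u y * u x)
    with (exp (b * Rabs (x - y)) * u y) by (field; lra). lra.
Qed.

Lemma loglip_exp q r :
  (forall x y, Rabs (r x - r y) <= q * Rabs (x - y)) -> loglip q (fun x => exp (r x)).
Proof.
  intros H x y. split; [left; apply exp_pos|].
  rewrite <- exp_plus. apply exp_le. specialize (H x y).
  rewrite Rabs_minus_sym in H. apply Rabs_le_between in H. lra.
Qed.

Lemma loglip_ext b u u' : (forall x, u x = u' x) -> loglip b u -> loglip b u'.
Proof. intros E H x y. rewrite <- !E. apply H. Qed.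

Lemma cone_weaken b b' u v : b <= b' -> cone b u v -> cone b' u v.
Proof.
  intros Hb [H1 H2]. split; [eapply loglip_weaken; eauto|].
  intros x y. destruct (H2 x y). split; auto.
  eapply Rle_trans; [eassumption|]. apply Rmult_le_compat_r; [apply (H1 x y)|].
  pose proof (exp_mult_abs_le b b' (x - y) Hb). lra.
Qed.

Lemma cone_ext b u u' v v' :
  (forall x, u x = u' x) -> (forall x, v x = v' x) -> cone b u v -> cone b u' v'.
Proof.
  intros E E' [H1 H2]. split; [eapply loglip_ext; eauto|].
  intros x y. rewrite <- E, <- !E'. apply H2.
Qed.

Lemma cone_loglip b u : 0 <= b -> loglip b u -> cone b u (fun x => RtoC (u x)).
Proof.
  intros Hb H. split; auto. intros x y. rewrite Cmod_R. split.
  - rewrite Rabs_pos_eq; [lra|apply (H x y)].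
  - rewrite <- RtoC_minus, Cmod_R. apply loglip_diff; auto.
Qed.

Lemma cone_mult b1 b2 u1 u2 v1 v2 :
  cone b1 u1 v1 -> cone b2 u2 v2 ->
  cone (b1 + b2) (fun x => u1 x * u2 x) (fun x => (v1 x * v2 x)%C).
Proof.
  intros [H1 H1'] [H2 H2']. split; [apply loglip_mult; auto|].
  intros x y.
  destruct (H1' x y) as [A1 D1], (H2' x y) as [A2 D2], (H1 x y) as [P1 L1], (H2 x y) as [P2 L2].
  destruct (H1' y x) as [B1 _].
  pose proof (Cmod_ge_0 (v1 x)); pose proof (Cmod_ge_0 (v2 x)).
  split; [rewrite Cmod_mult; apply Rmult_le_compat; auto|].
  replace (v1 x * v2 x - v1 y * v2 y)%C
    with ((v1 x - v1 y) * v2 x + v1 y * (v2 x - v2 y))%C by ring.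
  eapply Rle_trans; [apply Cmod_triangle|]. rewrite !Cmod_mult.
  rewrite Rmult_plus_distr_r, exp_plus.
  set (e1 := exp (b1 * Rabs (x - y))) in *. set (e2 := exp (b2 * Rabs (x - y))) in *.
  (* The identity (e1 - 1) + e1 (e2 - 1) = e1 e2 - 1 makes exponents add exactly; a linear modulus
     in place of exp - 1 would leave a remainder. *)
  apply Rle_trans with ((e1 - 1) * u1 x * u2 x + (e1 * u1 x) * ((e2 - 1) * u2 x)).
  - apply Rplus_le_compat; apply Rmult_le_compat; auto using Cmod_ge_0. lra.
  - right; ring.
Qed.

Lemma cone_plus b u1 u2 v1 v2 :
  cone b u1 v1 -> cone b u2 v2 ->
  cone b (fun x => u1 x + u2 x) (fun x => (v1 x + v2 x)%C).
Proof.
  intros [H1 H1'] [H2 H2']. split; [apply loglip_plus; auto|].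
  intros x y. destruct (H1' x y), (H2' x y). split.
  - eapply Rle_trans; [apply Cmod_triangle|]. lra.
  - replace (v1 x + v2 x - (v1 y + v2 y))%C
      with ((v1 x - v1 y) + (v2 x - v2 y))%C by ring.
    eapply Rle_trans; [apply Cmod_triangle|]. lra.
Qed.

Lemma cone_csum {X} b (F : X -> R -> R) (G : X -> R -> C) l :
  0 <= b -> (forall a, In a l -> cone b (F a) (G a)) ->
  cone b (fun x => lsum (fun a => F a x) l) (fun x => csum (fun a => G a x) l).
Proof.
  intros Hb. induction l as [|a l IH]; simpl; intros H.
  - apply (cone_loglip b (fun _ => 0)), loglip_const; lra.
  - apply (cone_plus b (F a)); auto.
Qed.

Lemma cone_comp b q u v g :
  0 <= b -> (forall x y, Rabs (g x - g y) <= q * Rabs (x - y)) ->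
  cone b u v -> cone (b * q) (fun x => u (g x)) (fun x => v (g x)).
Proof.
  intros Hb Hg [H1 H2]. split; [apply loglip_comp; auto|].
  intros x y. destruct (H2 (g x) (g y)). split; auto.
  eapply Rle_trans; [eassumption|]. apply Rmult_le_compat_r; [apply (H1 (g x) (g y))|].
  apply Rplus_le_compat_r, exp_le. rewrite Rmult_assoc. apply Rmult_le_compat_l; auto.
Qed.

Lemma cone_conj b u v : cone b u v -> cone b u (fun x => Cconj (v x)).
Proof.
  intros [H1 H2]. split; auto. intros x y.
  rewrite <- Cminus_conj, !Cmod_conj. apply H2.
Qed.

Lemma Rabs_sin_le (x : R) : Rabs (sin x) <= Rabs x.
Proof.
  assert (P : forall y, 0 <= y -> Rabs (sin y) <= y).
  { intros y Hy. destruct (Rle_lt_dec y 1) as [H|H].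
    - rewrite Rabs_pos_eq.
      + destruct Hy as [Hy| <-]; [left; apply sin_lt_x; auto|rewrite sin_0; lra].
      + apply sin_ge_0; auto. pose proof PI_4. pose proof PI2_1. lra.
    - pose proof (SIN_bound y). apply Rabs_le. lra. }
  unfold Rabs at 2. destruct (Rcase_abs x) as [H|H].
  - rewrite <- Rabs_Ropp, <- sin_neg. apply P. lra.
  - apply P. lra.
Qed.

Lemma Cmod_le_of_sqr (z : C) (m : R) : 0 <= m -> fst z ^ 2 + snd z ^ 2 <= m ^ 2 -> Cmod z <= m.
Proof.
  intros Hm H. unfold Cmod. rewrite <- (sqrt_pow2 m) by auto. apply sqrt_le_1_alt; auto.
Qed.

Lemma Cmod_cis (x : R) : Cmod (cos x, sin x) = 1.
Proof.
  unfold Cmod; simpl. replace (_ + _) with 1; [apply sqrt_1|].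
  pose proof (sin2_cos2 x) as H. unfold Rsqr in H. lra.
Qed.

Lemma Cmod_cis_diff (x y : R) :
  Cmod ((cos x, sin x) - (cos y, sin y))%C <= Rabs (x - y).
Proof.
  apply Cmod_le_of_sqr; [apply Rabs_pos|]. rewrite pow2_abs. simpl fst; simpl snd.
  replace (cos x + - cos y) with (cos x - cos y) by ring.
  replace (sin x + - sin y) with (sin x - sin y) by ring.
  rewrite form2, form4.
  pose proof (sin2_cos2 ((x + y) / 2)) as E. unfold Rsqr in E.
  pose proof (Rabs_sin_le ((x - y) / 2)) as H.
  apply Rsqr_le_abs_1 in H. unfold Rsqr in H.
  set (s := sin ((x - y) / 2)) in *.
  replace ((-2 * s * sin ((x + y) / 2)) ^ 2 + (2 * cos ((x + y) / 2) * s) ^ 2)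
    with (4 * (s * s) * (sin ((x + y) / 2) * sin ((x + y) / 2) + cos ((x + y) / 2) * cos ((x + y) / 2))) by ring.
  rewrite E. nra.
Qed.

Lemma cone_cis q (r : R -> R) :
  0 <= q -> (forall x y, Rabs (r x - r y) <= q * Rabs (x - y)) ->
  cone q (fun _ => 1) (fun x => (cos (r x), sin (r x))).
Proof.
  intros Hq H. split; [apply loglip_const; lra|].
  intros x y. rewrite Cmod_cis. split; [lra|].
  eapply Rle_trans; [apply Cmod_cis_diff|]. eapply Rle_trans; [apply H|].
  pose proof (exp_ineq1_le (q * Rabs (x - y))). lra.
Qed.

Lemma loglip_continuous b u x : 0 <= b -> loglip b u -> continuous u x.
Proof.
  intros Hb H. apply continuity_pt_filterlim. intros e He.
  assert (C1 : continuity_pt (fun d => (exp (b * d) - 1) * u x) 0).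
  { apply derivable_continuous_pt. reg. }
  destruct (C1 e He) as [d [Hd H1]]. exists d. split; auto.
  intros y [[_ Hy] Hd']. simpl in *. unfold R_dist in *.
  rewrite Rabs_minus_sym.
  eapply Rle_lt_trans; [apply (loglip_diff b); auto|].
  rewrite Rabs_minus_sym in Hd'.
  specialize (H1 (Rabs (x - y))).
  assert (0 < Rabs (x - y)) by (apply Rabs_pos_lt; lra).
  eapply Rle_lt_trans; [|apply H1].
  - rewrite Rmult_0_r, exp_0. eapply Rle_trans; [|apply Rle_abs]. lra.
  - split; [split; [constructor|lra]|]. rewrite Rminus_0_r, Rabs_Rabsolu; auto.
Qed.

(** * Cancellation between two branches *)

Lemma quotient_cone b u v : 0 <= b -> cone b u v -> (forall x, 0 < u x) ->
  cone (2 * b) (fun _ => 1) (fun x => (RtoC (/ u x) * v x)%C).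
Proof.
  intros Hb Huv Hu. replace (2 * b) with (b + b) by ring.
  refine (cone_ext _ _ _ _ _ _ (fun _ => eq_refl)
    (cone_mult _ _ _ _ _ _ (cone_loglip b _ Hb (loglip_inv b u (proj1 Huv) Hu)) Huv)).
  intros x. field. specialize (Hu x). lra.
Qed.

Section TwoBranches.

Variables (b : R) (A B : R -> R) (a c : R -> C).
Hypothesis Hb : 0 <= b.
Hypothesis HA : cone b A a.
Hypothesis HB : cone b B c.
Hypothesis HA_pos : forall x, 0 < A x.
Hypothesis HB_pos : forall x, 0 < B x.

(** Half the harmonic mean, A B / (A + B). Written with inverses and a sum, it visibly inherits the
    exponent b of A and B. *)
Definition harm (x : R) : R := / (/ A x + / B x).

Definition corr (x : R) : C := ((RtoC (/ A x) * a x) * Cconj (RtoC (/ B x) * c x))%C.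

(* The relative loss of modulus in a + c, up to the weight harm. *)
Definition gap (x : R) : R := 1 - Re (corr x).

Lemma harm_loglip : loglip b harm.
Proof.
  apply (loglip_inv b (fun x => / A x + / B x)).
  - apply loglip_plus; apply loglip_inv; auto; [apply HA|apply HB].
  - intros x. apply Rplus_lt_0_compat; apply Rinv_0_lt_compat; auto.
Qed.

Lemma harm_eq x : harm x = A x * B x / (A x + B x).
Proof. unfold harm. pose proof (HA_pos x). pose proof (HB_pos x). field. lra. Qed.

Lemma harm_pos x : 0 < harm x.
Proof.
  apply Rinv_0_lt_compat, Rplus_lt_0_compat; apply Rinv_0_lt_compat; auto.
Qed.

Lemma harm_le_quarter x : 4 * harm x <= A x + B x.
Proof.
  pose proof (HA_pos x). pose proof (HB_pos x).
  apply Rmult_le_reg_r with (A x + B x); [lra|]. rewrite harm_eq.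
  replace (4 * (A x * B x / (A x + B x)) * (A x + B x)) with (4 * A x * B x) by (field; lra).
  pose proof (pow2_ge_0 (A x - B x)). nra.
Qed.

Lemma corr_cone : cone (4 * b) (fun _ => 1) corr.
Proof.
  replace (4 * b) with (2 * b + 2 * b) by ring.
  refine (cone_ext _ _ _ _ _ _ (fun _ => eq_refl)
    (cone_mult _ _ _ _ _ _ (quotient_cone b A a Hb HA HA_pos)
      (cone_conj _ _ _ (quotient_cone b B c Hb HB HB_pos)))).
  intros x; ring.
Qed.

Lemma gap_bounds x : 0 <= gap x <= 2.
Proof.
  unfold gap. destruct corr_cone as [_ H]. destruct (H x x) as [H1 _].
  pose proof (re_le_Cmod (corr x)) as H2.
  assert (H3 : Rabs (Re (corr x)) <= 1) by lra. apply Rabs_le_between in H3. lra.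
Qed.

Lemma gap_lip x y : Rabs (gap x - gap y) <= exp (4 * b * Rabs (x - y)) - 1.
Proof.
  unfold gap. destruct corr_cone as [_ H]. destruct (H x y) as [_ H1].
  rewrite Rmult_1_r in H1. eapply Rle_trans; [|apply H1].
  eapply Rle_trans; [|apply re_le_Cmod]. right. rewrite <- Rabs_Ropp. f_equal.
  simpl. ring.
Qed.

(** The squared modulus is at most A^2 + B^2 + 2 Re (a conj c) = (A + B)^2 - 2 A B tau. As harm (A +
    B) = A B, the square of the right-hand side exceeds this by (harm tau)^2. *)
Lemma Cmod_plus_le_gap x : Cmod (a x + c x)%C <= A x + B x - harm x * gap x.
Proof.
  pose proof (gap_bounds x) as Ht. pose proof (harm_pos x) as Hh.
  pose proof (HA_pos x) as Ap. pose proof (HB_pos x) as Bp.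
  destruct HA as [_ HA']. destruct (HA' x x) as [Ha _].
  destruct HB as [_ HB']. destruct (HB' x x) as [Hc _].
  assert (Hm : forall z (m : R), 0 < m -> Cmod z <= m -> fst z ^ 2 + snd z ^ 2 <= m ^ 2).
  { intros z m Hm H. assert (E := Cmod2_alt z). unfold Re, Im in E. rewrite <- E.
    apply pow_incr. split; auto using Cmod_ge_0. }
  apply Hm in Ha; auto. apply Hm in Hc; auto.
  assert (Eg : A x * B x * gap x = A x * B x - (fst (a x) * fst (c x) + snd (a x) * snd (c x))).
  { unfold gap, corr, Re. simpl. field. lra. }
  assert (Eh : harm x * (A x + B x) = A x * B x).
  { rewrite harm_eq. field. lra. }
  pose proof (harm_le_quarter x) as Hh2.
  apply Cmod_le_of_sqr.
  - nra.
  - simpl fst; simpl snd.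
    apply Rle_trans with ((A x + B x) ^ 2 - 2 * (harm x * (A x + B x)) * gap x).
    + rewrite Eh. nra.
    + pose proof (pow2_ge_0 (harm x * gap x)). nra.
Qed.

(** The smaller of A and B is at most 2 [harm]. So the loss is at least what a factor 1 - tau/2 on
    the smaller term alone would give, and a single word can carry the gain in the Cauchy-Schwarz
    inequality. *)
Lemma harm_gap_le_l x : A x <= B x -> A x * gap x <= 2 * (harm x * gap x).
Proof.
  intros H. pose proof (gap_bounds x). pose proof (HA_pos x). pose proof (HB_pos x).
  assert (A x <= 2 * harm x); [|nra].
  rewrite harm_eq. apply Rmult_le_reg_r with (A x + B x); [lra|].
  replace (2 * (A x * B x / (A x + B x)) * (A x + B x)) with (2 * A x * B x) by (field; lra).
  nra.
Qed.

Lemma harm_gap_le_r x : B x <= A x -> B x * gap x <= 2 * (harm x * gap x).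
Proof.
  intros H. pose proof (gap_bounds x). pose proof (HA_pos x). pose proof (HB_pos x).
  assert (B x <= 2 * harm x); [|nra].
  rewrite harm_eq. apply Rmult_le_reg_r with (A x + B x); [lra|].
  replace (2 * (A x * B x / (A x + B x)) * (A x + B x)) with (2 * A x * B x) by (field; lra).
  nra.
Qed.

Lemma harm_gap_le_half x : harm x * gap x <= (A x + B x) / 2.
Proof.
  pose proof (gap_bounds x). pose proof (harm_pos x). pose proof (harm_le_quarter x). nra.
Qed.

(** The product is [harm] minus [harm] times Re [corr], with exponents b and b + 4 b; both are
    bounded with 5 b, whence the factor 2. *)
Lemma harm_gap_lip x y :
  Rabs (harm x * gap x - harm y * gap y) <= 2 * (exp (5 * b * Rabs (x - y)) - 1) * harm x.
Proof.
  unfold gap.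
  replace (harm x * (1 - Re (corr x)) - harm y * (1 - Re (corr y)))
    with ((harm x - harm y) - (harm x * Re (corr x) - harm y * Re (corr y))) by ring.
  eapply Rle_trans; [apply Rabs_triang|]. rewrite Rabs_Ropp.
  pose proof (harm_pos x) as Hh.
  assert (H1 := loglip_diff b harm x y Hb harm_loglip).
  assert (H2 : exp (b * Rabs (x - y)) <= exp (5 * b * Rabs (x - y)))
    by (apply exp_mult_abs_le; lra).
  assert (H3 : Rabs (harm x * Re (corr x) - harm y * Re (corr y)) <=
    (exp (5 * b * Rabs (x - y)) - 1) * harm x).
  { destruct (cone_mult _ _ _ _ _ _ (cone_loglip b _ Hb harm_loglip) corr_cone) as [_ H].
    destruct (H x y) as [_ H'].
    replace (b + 4 * b) with (5 * b) in H' by ring. rewrite Rmult_1_r in H'.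
    eapply Rle_trans; [|apply H']. eapply Rle_trans; [|apply re_le_Cmod].
    right; f_equal. simpl. ring. }
  nra.
Qed.

(** A subtraction may destroy the cone condition, but the subtracted term is at most half of F, so
    bounds relative to F become bounds relative to the difference at the cost of a factor 2. The
    resulting factor 3 is covered by doubling the exponent 5 b twice. *)
Lemma reduced_cone F V : cone b F V -> (forall x, A x + B x <= F x) ->
  (forall x, Cmod (V x) <= F x - harm x * gap x) ->
  cone (20 * b) (fun x => F x - harm x * gap x) V.
Proof.
  intros [HF HV] HAB HVF.
  assert (Hu : forall x, F x <= 2 * (F x - harm x * gap x)).
  { intros x. pose proof (harm_gap_le_half x). specialize (HAB x). lra. }
  assert (Hd : forall x y, 0 <= b * Rabs (x - y))
    by (intros; apply Rmult_le_pos; auto; apply Rabs_pos).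
  assert (HF0 : forall x, 0 <= F x) by (intros x; apply (HF x x)).
  split.
  - intros x y. split; [specialize (Hu x); specialize (HF0 x); lra|].
    pose proof (loglip_diff b F x y Hb HF) as H1. apply Rabs_le_between in H1.
    pose proof (harm_gap_lip x y) as H2. apply Rabs_le_between in H2.
    assert (H3 : exp (b * Rabs (x - y)) <= exp (5 * b * Rabs (x - y)))
      by (apply exp_mult_abs_le; lra).
    assert (H4 := expm1_double (5 * b * Rabs (x - y))).
    assert (H5 := expm1_double (2 * (5 * b * Rabs (x - y)))).
    replace (2 * (2 * (5 * b * Rabs (x - y)))) with (20 * b * Rabs (x - y)) in H5 by ring.
    specialize (Hd x y). specialize (Hu x). specialize (HAB x).
    assert (2 * harm x <= F x / 2) by (pose proof (harm_le_quarter x); lra).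
    set (E1 := exp (5 * b * Rabs (x - y))) in *. set (E := exp (20 * b * Rabs (x - y))) in *.
    set (h := harm x * gap x) in *.
    assert (1 <= E1) by (apply exp_ge_1; lra).
    assert (4 * (E1 - 1) <= E - 1) by lra.
    specialize (HF0 x).
    assert (F y - harm y * gap y - (F x - h) <= 3 / 2 * (E1 - 1) * F x) by nra.
    assert (3 / 2 * (E1 - 1) * F x <= 3 * (E1 - 1) * (F x - h)) by nra.
    assert (0 <= F x - h) by lra.
    nra.
  - intros x y. split; auto.
    destruct (HV x y) as [_ H1]. eapply Rle_trans; [apply H1|].
    assert (H4 := expm1_double (b * Rabs (x - y)) (Hd x y)).
    assert (H3 : exp (2 * (b * Rabs (x - y))) <= exp (20 * b * Rabs (x - y))).
    { apply exp_le. specialize (Hd x y). lra. }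
    assert (1 <= exp (b * Rabs (x - y))) by (apply exp_ge_1; auto).
    specialize (Hu x). specialize (HF0 x).
    apply Rle_trans with ((exp (b * Rabs (x - y)) - 1) * (2 * (F x - harm x * gap x))).
    + apply Rmult_le_compat_l; lra.
    + rewrite <- Rmult_assoc. apply Rmult_le_compat_r; lra.
Qed.

End TwoBranches.

(* Re (z e^{i y}) changes sign between y and y + PI, so that a phase moving by
   PI makes it nonpositive somewhere, up to the variation of z. *)
Lemma phase_opposes (theta : R -> R) (z : R -> C) alpha beta :
  alpha <= beta -> (forall x, continuous theta x) ->
  PI <= Rabs (theta beta - theta alpha) ->
  (forall x, alpha <= x <= beta -> Cmod (z x - z alpha)%C <= / 4) ->
  exists x, alpha <= x <= beta /\ Re (z x * (cos (theta x), sin (theta x)))%C <= / 4.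
Proof.
  intros Hab Hth HPI Hz.
  assert (E : exists x, alpha <= x <= beta /\
    Re (z alpha * (cos (theta x), sin (theta x)))%C <= 0).
  { destruct (Rle_lt_dec (Re (z alpha * (cos (theta alpha), sin (theta alpha)))%C) 0) as [H|H].
    - exists alpha. split; [lra|auto].
    - assert (K : exists x, alpha <= x <= beta /\
        (theta x = theta alpha + PI \/ theta x = theta alpha - PI)).
      { assert (Hc : continuity theta)
          by (intros x; apply continuity_pt_filterlim, Hth).
        pose proof PI_RGT_0.
        destruct (Rle_lt_dec (theta alpha) (theta beta)) as [Hle|Hlt].
        - rewrite Rabs_pos_eq in HPI by lra.
          destruct (IVT_gen theta alpha beta (theta alpha + PI) Hc) as [x [Hx Ex]].
          + rewrite Rmin_left, Rmax_right by auto. lra.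
          + rewrite Rmin_left, Rmax_right in Hx by auto. exists x; auto.
        - rewrite Rabs_left in HPI by lra.
          destruct (IVT_gen theta alpha beta (theta alpha - PI) Hc) as [x [Hx Ex]].
          + rewrite Rmin_right, Rmax_left by lra. lra.
          + rewrite Rmin_left, Rmax_right in Hx by auto. exists x; auto. }
      destruct K as [x [Hx Ex]]. exists x. split; auto.
      assert (Ecs : cos (theta x) = - cos (theta alpha) /\ sin (theta x) = - sin (theta alpha)).
      { destruct Ex as [-> | ->].
        - rewrite neg_cos, neg_sin. auto.
        - replace (theta alpha - PI) with (- (PI - theta alpha)) by ring.
          rewrite cos_neg, sin_neg, sin_PI_x, Rtrigo_facts.cos_pi_minus. auto. }
      destruct Ecs as [-> ->]. unfold Re in *. simpl in *. lra. }
  destruct E as [x [Hx Hx']]. exists x. split; auto.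
  assert (H1 : Re ((z x - z alpha) * (cos (theta x), sin (theta x)))%C <= / 4).
  { eapply Rle_trans; [apply Rle_abs|]. eapply Rle_trans; [apply re_le_Cmod|].
    rewrite Cmod_mult, Cmod_cis, Rmult_1_r. auto. }
  unfold Re in *. simpl in *. lra.
Qed.

(** * Integrals on small cells *)

Lemma ex_RInt_cont (f : R -> R) x y : (forall z, continuous f z) -> ex_RInt f x y.
Proof.
  intros H. apply (@ex_RInt_continuous R_CompleteNormedModule). auto.
Qed.

Lemma RInt_scal_cont (f : R -> R) x y c : (forall z, continuous f z) ->
  RInt (fun z => c * f z) x y = c * RInt f x y.
Proof.
  intros H. apply (RInt_scal (V := R_CompleteNormedModule) f x y c), ex_RInt_cont; auto.
Qed.

Lemma RInt_const_R (c x y : R) : RInt (fun _ => c) x y = (y - x) * c.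
Proof. rewrite RInt_const. reflexivity. Qed.

Lemma RInt_Chasles_cont (f : R -> R) x y z : (forall z, continuous f z) ->
  RInt f x y + RInt f y z = RInt f x z.
Proof.
  intros H. apply (RInt_Chasles (V := R_CompleteNormedModule)); apply ex_RInt_cont; auto.
Qed.

(** On a cell of length L the function G stays within a factor exp (b L) of G x0, so both integrals
    compare with G x0. The right one is restricted to an interval of length delta with end point x0,
    on the left or on the right of it; one of the two fits because 2 delta <= L. *)
Lemma RInt_gap_cell (tau G : R -> R) b delta alpha beta x0 :
  0 <= b -> loglip b G -> (forall x, continuous tau x) -> (forall x, 0 <= tau x) ->
  alpha <= x0 <= beta -> 0 < delta -> 2 * delta <= beta - alpha ->
  (forall x, Rabs (x - x0) <= delta -> / 2 <= tau x) ->
  delta * exp (- (2 * b * (beta - alpha))) / (2 * (beta - alpha)) * RInt G alpha beta <=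
  RInt (fun x => tau x * G x) alpha beta.
Proof.
  intros Hb HG Ht Ht0 Hx0 Hd Hd2 Ht2.
  assert (HGc : forall x, continuous G x) by (intros; apply (loglip_continuous b); auto).
  assert (HG0 : forall x, 0 <= G x) by (intros x; apply (HG x x)).
  change (RInt (fun x => tau x * G x)) with (RInt (fun x : R => tau x * G x)).
  set (f := fun x : R => tau x * G x).
  assert (Hc : forall x, continuous f x).
  { intros x. apply (continuous_mult tau G); auto. }
  set (L := beta - alpha) in *.
  assert (Hup : RInt G alpha beta <= L * (exp (b * L) * G x0)).
  { unfold L at 1. rewrite <- RInt_const_R. apply RInt_le; [lra|apply ex_RInt_cont; auto|apply ex_RInt_const|].
    intros x Hx. destruct (HG x0 x) as [_ H]. eapply Rle_trans; [apply H|].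
    apply Rmult_le_compat_r; auto. apply exp_le, Rmult_le_compat_l; auto.
    apply Rabs_le. unfold L. lra. }
  assert (Hsub : exists gam, alpha <= gam /\ gam + delta <= beta /\
    forall x, gam < x < gam + delta -> Rabs (x - x0) <= delta).
  { destruct (Rle_lt_dec delta (x0 - alpha)) as [H|H].
    - exists (x0 - delta). repeat split; try lra. intros x Hx. apply Rabs_le; lra.
    - exists x0. unfold L in *. repeat split; try lra. intros x Hx. apply Rabs_le; lra. }
  destruct Hsub as [gam [G1 [G2 G3]]].
  assert (Hlow : delta * (/ 2 * (exp (- (b * L)) * G x0)) <= RInt f alpha beta).
  { rewrite <- (RInt_Chasles_cont f alpha gam beta Hc).
    rewrite <- (RInt_Chasles_cont f gam (gam + delta) beta Hc).
    assert (P : forall u v, u <= v -> 0 <= RInt f u v).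
    { intros u v Huv. apply RInt_ge_0; auto. apply ex_RInt_cont; auto.
      intros x _. apply Rmult_le_pos; auto. }
    assert (delta * (/ 2 * (exp (- (b * L)) * G x0)) <= RInt f gam (gam + delta)).
    { replace delta with (gam + delta - gam) at 1 by ring. rewrite <- RInt_const_R.
      apply RInt_le; [lra|apply ex_RInt_const|apply ex_RInt_cont; auto|].
      intros x Hx. apply Rmult_le_compat; [lra| |auto|].
      - apply Rmult_le_pos; auto. left; apply exp_pos.
      - destruct (HG x x0) as [_ H]. rewrite exp_Ropp.
        pose proof (exp_pos (b * L)).
        apply Rmult_le_reg_l with (exp (b * L)); auto.
        rewrite <- Rmult_assoc, Rinv_r, Rmult_1_l by lra.
        eapply Rle_trans; [apply H|]. apply Rmult_le_compat_r; auto.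
        apply exp_le, Rmult_le_compat_l; auto. apply Rabs_le. unfold L. lra. }
    pose proof (P alpha gam G1). pose proof (P (gam + delta) beta G2). lra. }
  assert (HL : 0 < L) by lra.
  eapply Rle_trans; [|apply Hlow].
  apply Rle_trans with (delta * exp (- (2 * b * L)) / (2 * L) * (L * (exp (b * L) * G x0))).
  - apply Rmult_le_compat_l; auto. unfold Rdiv. apply Rmult_le_pos.
    + apply Rmult_le_pos; [lra|left; apply exp_pos].
    + left; apply Rinv_0_lt_compat; lra.
  - right. replace (- (2 * b * L)) with (- (b * L) + - (b * L)) by ring.
    rewrite exp_plus, exp_Ropp. pose proof (exp_pos (b * L)). field. lra.
Qed.

Lemma RInt_cells_le (F G : R -> R) c N :
  (forall x, continuous F x) -> (forall x, continuous G x) -> (1 <= N)%nat ->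
  (forall i, (i < N)%nat ->
     c * RInt G (INR i / INR N) (INR (Datatypes.S i) / INR N) <=
     RInt F (INR i / INR N) (INR (Datatypes.S i) / INR N)) ->
  c * RInt G 0 1 <= RInt F 0 1.
Proof.
  intros HF HG HN H.
  assert (P : forall i, (i <= N)%nat -> c * RInt G 0 (INR i / INR N) <= RInt F 0 (INR i / INR N)).
  { induction i as [|i IH]; intros Hi.
    - simpl. unfold Rdiv. rewrite Rmult_0_l, !RInt_point. unfold zero; simpl. lra.
    - rewrite <- (RInt_Chasles_cont G 0 (INR i / INR N)), <- (RInt_Chasles_cont F 0 (INR i / INR N)) by auto.
      specialize (IH ltac:(lia)). specialize (H i ltac:(lia)). lra. }
  specialize (P N (Nat.le_refl N)).
  replace (INR N / INR N) with 1 in P; auto.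
  field. apply not_0_INR. lia.
Qed.

(** * Words of inverse branches *)

Fixpoint words (l : list nat) (n : nat) : list (list nat) :=
  match n with
  | O => nil :: nil
  | Datatypes.S m => flat_map (fun j => map (cons j) (words l m)) l
  end.

Lemma in_words l n w : In w (words l n) <-> length w = n /\ incl w l.
Proof.
  revert w; induction n as [|n IH]; intros w; simpl.
  - split.
    + intros [<-|[]]. split; auto. intros a [].
    + intros [H _]. left. destruct w; [auto|discriminate].
  - rewrite in_flat_map. split.
    + intros [j [Hj Hw]]. apply in_map_iff in Hw. destruct Hw as [w' [<- Hw']].
      apply IH in Hw'. destruct Hw' as [<- Hi]. split; auto.
      intros a [<-|Ha]; auto.
    + intros [Hl Hi]. destruct w as [|j w]; [discriminate|].
      exists j. split; [apply Hi; simpl; auto|]. apply in_map, IH.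
      split; [simpl in Hl; lia|]. intros a Ha; apply Hi; simpl; auto.
Qed.

Lemma lsum_words_app (l : list nat) n m (F : list nat -> R) :
  lsum F (words l (n + m)) =
  lsum (fun w => lsum (fun w' => F (w ++ w')) (words l m)) (words l n).
Proof.
  revert F; induction n as [|n IH]; intros F; simpl.
  - rewrite Rplus_0_r. reflexivity.
  - rewrite !lsum_flat_map. apply lsum_ext; intros j _.
    rewrite !lsum_map, IH. reflexivity.
Qed.

Lemma csum_words_app (l : list nat) n m (F : list nat -> C) :
  csum F (words l (n + m)) =
  csum (fun w => csum (fun w' => F (w ++ w')) (words l m)) (words l n).
Proof.
  revert F; induction n as [|n IH]; intros F; simpl.
  - rewrite Cplus_0_r. reflexivity.
  - rewrite !csum_flat_map. apply csum_ext; intros j _.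
    rewrite !csum_map, IH. reflexivity.
Qed.

Section Words.

Variables (g jac rf : nat -> R -> R).

Fixpoint wg (w : list nat) (x : R) : R :=
  match w with nil => x | j :: w' => g j (wg w' x) end.

Fixpoint wjac (w : list nat) (x : R) : R :=
  match w with nil => 1 | j :: w' => jac j (wg w' x) * wjac w' x end.

Fixpoint wrf (w : list nat) (x : R) : R :=
  match w with nil => 0 | j :: w' => rf j (wg w' x) + wrf w' x end.

Definition weight (a : R) (w : list nat) (x : R) : R := exp (- a * wrf w x) * wjac w x.

Definition phase (t : R) (w : list nat) (x : R) : C :=
  (cos (- t * wrf w x), sin (- t * wrf w x)).

(* Powers of the transfer operators, at the real parameter a and at the complex
   parameter s + i t, of the system reduced to the branches listed in l. *)
Definition RL (l : list nat) (n : nat) (a : R) (u : R -> R) (x : R) : R :=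
  lsum (fun w => weight a w x * u (wg w x)) (words l n).

Definition CL (l : list nat) (n : nat) (s t : R) (v : R -> C) (x : R) : C :=
  csum (fun w => (RtoC (weight s w x) * (phase t w x * v (wg w x)))%C) (words l n).

Lemma wg_app w w' x : wg (w ++ w') x = wg w (wg w' x).
Proof. induction w; simpl; congruence. Qed.

Lemma wjac_app w w' x : wjac (w ++ w') x = wjac w (wg w' x) * wjac w' x.
Proof. induction w as [|j w IH]; simpl; [ring|]. rewrite IH, wg_app. ring. Qed.

Lemma wrf_app w w' x : wrf (w ++ w') x = wrf w (wg w' x) + wrf w' x.
Proof. induction w as [|j w IH]; simpl; [ring|]. rewrite IH, wg_app. ring. Qed.

Lemma weight_app a w w' x : weight a (w ++ w') x = weight a w (wg w' x) * weight a w' x.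
Proof.
  unfold weight. rewrite wjac_app, wrf_app.
  replace (- a * (wrf w (wg w' x) + wrf w' x))
    with (- a * wrf w (wg w' x) + - a * wrf w' x) by ring.
  rewrite exp_plus. ring.
Qed.

Lemma cis_plus (a b : R) :
  (cos (a + b), sin (a + b)) = ((cos a, sin a) * (cos b, sin b))%C.
Proof. rewrite cos_plus, sin_plus. unfold Cmult; simpl. f_equal; ring. Qed.

Lemma phase_app t w w' x : phase t (w ++ w') x = (phase t w (wg w' x) * phase t w' x)%C.
Proof.
  unfold phase. rewrite wrf_app, Rmult_plus_distr_l. apply cis_plus.
Qed.

(** By the cocycle property of weights. In w ++ w' the suffix w' acts on x first, so it belongs to
    the outer operator. *)
Lemma RL_add l n m a u x : RL l (n + m) a u x = RL l m a (RL l n a u) x.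
Proof.
  unfold RL. rewrite lsum_words_app, lsum_exchange. apply lsum_ext; intros w' _.
  rewrite <- lsum_scal. apply lsum_ext; intros w _.
  rewrite weight_app, wg_app. ring.
Qed.

Lemma CL_add l n m s t v x : CL l (n + m) s t v x = CL l m s t (CL l n s t v) x.
Proof.
  unfold CL. rewrite csum_words_app, csum_exchange. apply csum_ext; intros w' _.
  rewrite Cmult_assoc, <- csum_scal. apply csum_ext; intros w _.
  rewrite weight_app, wg_app, phase_app, RtoC_mult. ring.
Qed.

Lemma RL_0 l a u x : RL l 0 a u x = u x.
Proof.
  unfold RL, weight; simpl. rewrite Rmult_0_r, exp_0. ring.
Qed.

Lemma CL_0 l s t v x : CL l 0 s t v x = v x.
Proof.
  unfold CL, weight, phase; simpl. rewrite !Rmult_0_r, exp_0, cos_0, sin_0.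
  apply injective_projections; simpl; ring.
Qed.

Lemma RL_1 l a u x :
  RL l 1 a u x = lsum (fun j => exp (- a * rf j x) * jac j x * u (g j x)) l.
Proof.
  unfold RL; simpl. rewrite lsum_flat_map. apply lsum_ext; intros j _.
  simpl. unfold weight; simpl. rewrite !Rplus_0_r. ring.
Qed.

Lemma CL_1 l s t v x :
  CL l 1 s t v x =
  csum (fun j => (RtoC (exp (- s * rf j x) * jac j x) *
     ((cos (- t * rf j x), sin (- t * rf j x)) * v (g j x)))%C) l.
Proof.
  unfold CL; simpl. rewrite csum_flat_map. apply csum_ext; intros j _.
  simpl. unfold weight, phase; simpl. rewrite !Rplus_0_r, Rmult_1_r. ring.
Qed.

Lemma RL_scal l n a c u x : RL l n a (fun y => c * u y) x = c * RL l n a u x.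
Proof. unfold RL. rewrite <- lsum_scal. apply lsum_ext; intros w _. ring. Qed.

(** * Distortion, and the action of the operators on cones *)

Variables (ok : nat -> Prop) (C0 rho K : R).
Hypothesis HC0 : 1 <= C0.
Hypothesis Hrho : 0 < rho < 1.
Hypothesis HK : 0 <= K.
Hypothesis Hg : forall j x, ok j -> 0 <= g j x <= 1.
Hypothesis Hcontr : forall w, List.Forall ok w -> forall x y,
  Rabs (wg w x - wg w y) <= C0 * rho ^ length w * Rabs (x - y).
Hypothesis Hjac : forall j, ok j -> loglip K (jac j).
Hypothesis Hjac_pos : forall j x, ok j -> 0 < jac j x.
Hypothesis Hrf : forall j, ok j -> forall x y, Rabs (rf j x - rf j y) <= K * Rabs (x - y).
Hypothesis Hrf_pos : forall j x, ok j -> 0 <= rf j x.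

(* The geometric series of contraction rates bounds both the distortion of the
   jacobians and the Lipschitz constant of the Birkhoff sums of all words. *)
Definition cdist : R := K * C0 / (1 - rho).

Lemma cdist_nonneg : 0 <= cdist.
Proof.
  unfold cdist, Rdiv. apply Rmult_le_pos; [apply Rmult_le_pos; lra|].
  left; apply Rinv_0_lt_compat; lra.
Qed.

Lemma rho_pow_bounds n : 0 < rho ^ n <= 1.
Proof.
  split; [apply pow_lt; lra|]. rewrite <- (pow1 n). apply pow_incr; lra.
Qed.

Lemma cdist_partial_le n : K * C0 * (1 - rho ^ n) / (1 - rho) <= cdist.
Proof.
  pose proof (rho_pow_bounds n) as H. pose proof cdist_nonneg as H'.
  replace (K * C0 * (1 - rho ^ n) / (1 - rho)) with (cdist * (1 - rho ^ n))
    by (unfold cdist; field; lra).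
  nra.
Qed.

Lemma cdist_partial_succ n :
  K * C0 * (1 - rho ^ Datatypes.S n) / (1 - rho) =
  K * (C0 * rho ^ n) + K * C0 * (1 - rho ^ n) / (1 - rho).
Proof. simpl. field. lra. Qed.

Lemma wjac_loglip w : List.Forall ok w -> loglip cdist (wjac w).
Proof.
  intros Hw.
  (* The induction runs with the partial geometric sum as exponent; the limit value [cdist] would
     not reproduce itself when a letter is added. *)
  apply loglip_weaken with (K * C0 * (1 - rho ^ length w) / (1 - rho));
    [apply cdist_partial_le|].
  induction Hw as [|j w Hj Hw IH].
  - simpl. replace (K * C0 * (1 - 1) / (1 - rho)) with 0 by (field; lra).
    apply loglip_const; lra.
  - simpl length. rewrite cdist_partial_succ. simpl wjac.
    apply (loglip_mult _ _ (fun x => jac j (wg w x))); auto.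
    apply loglip_comp; auto.
Qed.

Lemma wjac_pos w x : List.Forall ok w -> 0 < wjac w x.
Proof.
  intros Hw. induction Hw; simpl; [lra|]. apply Rmult_lt_0_compat; auto.
Qed.

Lemma wrf_lip w : List.Forall ok w ->
  forall x y, Rabs (wrf w x - wrf w y) <= cdist * Rabs (x - y).
Proof.
  intros Hw x y.
  apply Rle_trans with (K * C0 * (1 - rho ^ length w) / (1 - rho) * Rabs (x - y)).
  2: apply Rmult_le_compat_r; [apply Rabs_pos|apply cdist_partial_le].
  induction Hw as [|j w Hj Hw IH].
  - simpl. replace (0 - 0) with 0 by ring. rewrite Rabs_R0.
    replace (K * C0 * (1 - 1) / (1 - rho)) with 0 by (field; lra). lra.
  - simpl length. rewrite cdist_partial_succ. simpl wrf.
    replace (rf j (wg w x) + wrf w x - (rf j (wg w y) + wrf w y))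
      with ((rf j (wg w x) - rf j (wg w y)) + (wrf w x - wrf w y)) by ring.
    eapply Rle_trans; [apply Rabs_triang|].
    rewrite Rmult_plus_distr_r. apply Rplus_le_compat; auto.
    eapply Rle_trans; [apply Hrf; auto|].
    rewrite Rmult_assoc. apply Rmult_le_compat_l; auto.
Qed.

Lemma wrf_pos w x : List.Forall ok w -> 0 <= wrf w x.
Proof.
  intros Hw. induction Hw; simpl; [lra|]. apply Rplus_le_le_0_compat; auto.
Qed.

Lemma wg_bounds w x : List.Forall ok w -> 0 <= x <= 1 -> 0 <= wg w x <= 1.
Proof. intros Hw Hx. destruct Hw; simpl; auto. Qed.

Lemma weight_pos a w x : List.Forall ok w -> 0 < weight a w x.
Proof. intros Hw. apply Rmult_lt_0_compat; [apply exp_pos|apply wjac_pos; auto]. Qed.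

Lemma weight_loglip a w : List.Forall ok w -> loglip (Rabs a * cdist + cdist) (weight a w).
Proof.
  intros Hw. apply (loglip_mult _ _ (fun x => exp (- a * wrf w x))).
  - apply loglip_exp. intros x y.
    replace (- a * wrf w x - - a * wrf w y) with (- a * (wrf w x - wrf w y)) by ring.
    rewrite Rabs_mult, Rabs_Ropp, Rmult_assoc.
    apply Rmult_le_compat_l; [apply Rabs_pos|apply wrf_lip; auto].
  - apply wjac_loglip; auto.
Qed.

Lemma phase_cone t w : List.Forall ok w -> cone (Rabs t * cdist) (fun _ => 1) (phase t w).
Proof.
  intros Hw. apply cone_cis.
  - apply Rmult_le_pos; [apply Rabs_pos|apply cdist_nonneg].
  - intros x y.
    replace (- t * wrf w x - - t * wrf w y) with (- t * (wrf w x - wrf w y)) by ring.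
    rewrite Rabs_mult, Rabs_Ropp, Rmult_assoc.
    apply Rmult_le_compat_l; [apply Rabs_pos|apply wrf_lip; auto].
Qed.

Definition good (l : list nat) : Prop := NoDup l /\ List.Forall ok l.

Lemma good_words l n w : good l -> In w (words l n) -> List.Forall ok w /\ length w = n.
Proof.
  intros [_ Hl] Hw. apply in_words in Hw. destruct Hw as [H1 H2]. split; auto.
  rewrite List.Forall_forall in *. auto.
Qed.

Lemma term_cone s t b u v w :
  0 <= b -> List.Forall ok w -> cone b u v ->
  cone ((Rabs s * cdist + cdist) + (Rabs t * cdist + b * (C0 * rho ^ length w)))
    (fun x => weight s w x * u (wg w x))
    (fun x => (RtoC (weight s w x) * (phase t w x * v (wg w x)))%C).
Proof.
  intros Hb Hw Huv. pose proof cdist_nonneg. pose proof (Rabs_pos s).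
  assert (Hwt : cone (Rabs s * cdist + cdist) (weight s w) (fun x => RtoC (weight s w x))).
  { apply cone_loglip; [nra|apply weight_loglip; auto]. }
  refine (cone_ext _ _ _ _ _ _ _
    (cone_mult _ _ _ _ _ _ Hwt
       (cone_mult _ _ _ _ _ _ (phase_cone t w Hw)
          (cone_comp _ _ _ _ _ Hb (Hcontr w Hw) Huv)))).
  - intros x; simpl; ring.
  - intros x; reflexivity.
Qed.

(** The Lasota-Yorke inequality in cone form: the exponent b of the input is multiplied by C0 rho^n,
    and the rest depends only on the parameters s, t and the distortion. *)
Lemma RL_CL_cone l n s t b u v :
  0 <= b -> good l -> cone b u v ->
  cone ((Rabs s * cdist + cdist) + (Rabs t * cdist + b * (C0 * rho ^ n)))
    (RL l n s u) (CL l n s t v).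
Proof.
  intros Hb Hl Huv. pose proof cdist_nonneg. pose proof (Rabs_pos s). pose proof (Rabs_pos t).
  pose proof (rho_pow_bounds n).
  apply (cone_csum _ (fun w x => weight s w x * u (wg w x))
    (fun w x => (RtoC (weight s w x) * (phase t w x * v (wg w x)))%C)).
  - apply Rplus_le_le_0_compat; [nra|]. apply Rplus_le_le_0_compat; [nra|].
    apply Rmult_le_pos; nra.
  - intros w Hw. destruct (good_words l n w Hl Hw) as [Hw1 <-]. apply term_cone; auto.
Qed.

Lemma RL_loglip l n a b u :
  0 <= b -> good l -> loglip b u ->
  loglip ((Rabs a * cdist + cdist) + b * (C0 * rho ^ n)) (RL l n a u).
Proof.
  intros Hb Hl Hu.
  pose proof (RL_CL_cone l n a 0 b u _ Hb Hl (cone_loglip b u Hb Hu)) as [H _].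
  rewrite Rabs_R0, Rmult_0_l, Rplus_0_l in H. auto.
Qed.

Lemma RL_le l n a u u' x :
  good l -> 0 <= x <= 1 -> (forall y, 0 <= y <= 1 -> u y <= u' y) ->
  RL l n a u x <= RL l n a u' x.
Proof.
  intros Hl Hx H. apply lsum_le; intros w Hw. destruct (good_words l n w Hl Hw) as [Hw' _].
  apply Rmult_le_compat_l; [left; apply weight_pos; auto|apply H, wg_bounds; auto].
Qed.

Lemma RL_nonneg l n a u x :
  good l -> (forall y, 0 <= u y) -> 0 <= RL l n a u x.
Proof.
  intros Hl H. apply lsum_nonneg; intros w Hw. destruct (good_words l n w Hl Hw) as [Hw' _].
  apply Rmult_le_pos; [left; apply weight_pos; auto|auto].
Qed.

(** * Integrals, and suprema bounded by integrals *)

Hypothesis Hint : forall l (f : R -> R),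
  good l -> (forall x : R, 0 <= f x) -> (forall x : R, continuous f x) ->
  RInt (fun x => lsum (fun j => jac j x * f (g j x)) l) 0 1 <= RInt f 0 1.

Lemma RInt_RL_le l n b u :
  0 <= b -> good l -> loglip b u -> RInt (RL l n 0 u) 0 1 <= RInt u 0 1.
Proof.
  intros Hb Hl Hu. revert b u Hb Hu. induction n as [|n IH]; intros b u Hb Hu.
  - right. apply RInt_ext; intros x _. apply RL_0.
  - apply Rle_trans with (RInt (RL l n 0 (RL l 1 0 u)) 0 1).
    + right. apply RInt_ext; intros x _. change (Datatypes.S n) with (1 + n)%nat.
      apply RL_add.
    + eapply Rle_trans.
      * refine (IH _ _ _ (RL_loglip l 1 0 b u Hb Hl Hu)).
        pose proof cdist_nonneg. pose proof (rho_pow_bounds 1). rewrite Rabs_R0.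
        assert (0 <= b * (C0 * rho ^ 1)) by (apply Rmult_le_pos; nra). lra.
      * eapply Rle_trans; [|apply (Hint l u Hl)].
        -- right. apply RInt_ext; intros x _. rewrite RL_1. apply lsum_ext; intros j _.
           rewrite Ropp_0, Rmult_0_l, exp_0. ring.
        -- intros x; apply (Hu x x).
        -- intros x; apply (loglip_continuous b); auto.
Qed.

Lemma ex_RInt_loglip b u x y : 0 <= b -> loglip b u -> ex_RInt u x y.
Proof.
  intros Hb Hu. apply (@ex_RInt_continuous R_CompleteNormedModule).
  intros z _. apply (loglip_continuous b); auto.
Qed.

Lemma loglip_le_RInt b u x :
  0 <= b -> loglip b u -> 0 <= x <= 1 -> u x <= exp b * RInt u 0 1.
Proof.
  intros Hb Hu Hx.
  assert (Hex := ex_RInt_loglip b u 0 1 Hb Hu).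
  replace (u x) with (RInt (fun _ => u x) 0 1).
  2: { rewrite RInt_const. unfold scal; simpl; unfold mult; simpl; ring. }
  assert (E : RInt (fun y => exp b * u y) 0 1 = exp b * RInt u 0 1)
    by apply (RInt_scal (V := R_CompleteNormedModule) u 0 1 (exp b) Hex).
  rewrite <- E.
  apply RInt_le; [lra|apply ex_RInt_const| |].
  - apply (ex_RInt_scal (V := R_CompleteNormedModule) u 0 1 (exp b) Hex).
  - intros y Hy. destruct (Hu y x) as [H0 H1]. eapply Rle_trans; [apply H1|].
    apply Rmult_le_compat_r; auto. apply exp_le. rewrite <- (Rmult_1_r b) at 2.
    apply Rmult_le_compat_l; auto. apply Rabs_le; lra.
Qed.

Lemma RL_le_RInt l n b u x :
  0 <= b -> good l -> loglip b u -> 0 <= x <= 1 ->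
  RL l n 0 u x <= exp (cdist + b * (C0 * rho ^ n)) * RInt u 0 1.
Proof.
  intros Hb Hl Hu Hx. pose proof (rho_pow_bounds n). pose proof cdist_nonneg.
  assert (0 <= b * (C0 * rho ^ n)) by (apply Rmult_le_pos; nra).
  eapply Rle_trans.
  - apply (loglip_le_RInt (cdist + b * (C0 * rho ^ n))); auto; [lra|].
    pose proof (RL_loglip l n 0 b u Hb Hl Hu) as H'.
    rewrite Rabs_R0, Rmult_0_l, Rplus_0_l in H'. auto.
  - apply Rmult_le_compat_l; [left; apply exp_pos|]. apply (RInt_RL_le l n b); auto.
Qed.

Lemma RL_1_le l n x : good l -> 0 <= x <= 1 -> RL l n 0 (fun _ => 1) x <= exp cdist.
Proof.
  intros Hl Hx.
  eapply Rle_trans; [apply (RL_le_RInt l n 0); auto; [lra|apply loglip_const; lra]|].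
  rewrite RInt_const, Rmult_0_l, Rplus_0_r.
  unfold scal; simpl; unfold mult; simpl. lra.
Qed.

(** * Supersolutions for parameters near 0 *)

Variables (e1 M : R).
Hypothesis He1 : 0 < e1.
Hypothesis HM : 0 < M.
Hypothesis Hsum : forall l x, good l -> 0 <= x <= 1 ->
  lsum (fun j => exp (e1 * rf j x) * jac j x) l <= M.

(** The increment is at most |a| r exp (|a| r). One half of e1 pays for the unbounded factor r and
    the other half for the exponential, so the error is linear in |a| with a summable
    coefficient. *)
Lemma exp_perturb a r : 0 <= r -> Rabs a <= e1 / 2 ->
  exp (- a * r) <= 1 + 2 * Rabs a / e1 * exp (e1 * r).
Proof.
  intros Hr Ha. pose proof (Rabs_pos a) as Ha0.
  apply Rle_trans with (exp (Rabs a * r)).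
  { apply exp_le, Rmult_le_compat_r; auto. rewrite <- Rabs_Ropp. apply Rle_abs. }
  set (c := Rabs a) in *.
  assert (H1 : exp (c * r) <= 1 + c * r * exp (c * r)).
  { pose proof (exp_ineq1_le (- (c * r))) as H. rewrite exp_Ropp in H.
    pose proof (exp_pos (c * r)) as Hp.
    apply Rmult_le_compat_r with (r := exp (c * r)) in H; [|lra].
    rewrite Rinv_l in H by lra. lra. }
  eapply Rle_trans; [apply H1|]. apply Rplus_le_compat_l.
  assert (H2 : e1 / 2 * r <= exp (e1 / 2 * r)) by (pose proof (exp_ineq1_le (e1 / 2 * r)); lra).
  assert (H3 : exp (c * r) <= exp (e1 / 2 * r)) by (apply exp_le, Rmult_le_compat_r; auto).
  apply Rle_trans with (2 * c / e1 * ((e1 / 2 * r) * exp (c * r))).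
  { right; field; lra. }
  apply Rmult_le_compat_l.
  { unfold Rdiv. apply Rmult_le_pos; [lra|left; apply Rinv_0_lt_compat; auto]. }
  replace (e1 * r) with (e1 / 2 * r + e1 / 2 * r) by field. rewrite exp_plus.
  apply Rmult_le_compat; auto; [|left; apply exp_pos].
  apply Rmult_le_pos; lra.
Qed.

Lemma pow_gt_large (kappa B : R) : 1 < kappa -> exists N, B <= kappa ^ N.
Proof.
  intros Hk. destruct (Pow_x_infinity kappa) with (b := B) as [N HN].
  - rewrite Rabs_pos_eq; lra.
  - exists N. specialize (HN N (Nat.le_refl N)).
    rewrite Rabs_pos_eq in HN; [lra|]. apply pow_le; lra.
Qed.

Fixpoint subinv (l : list nat) (kappa : R) (N : nat) (x : R) : R :=
  match N with
  | O => 0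
  | Datatypes.S N' => subinv l kappa N' x + / kappa ^ N' * RL l N' 0 (fun _ => 1) x
  end.

Lemma subinv_loglip l kappa N : good l -> 0 < kappa -> loglip cdist (subinv l kappa N).
Proof.
  intros Hl Hk. pose proof cdist_nonneg. induction N as [|N IH]; simpl.
  - apply loglip_const; lra.
  - apply (loglip_plus _ (subinv l kappa N)); auto.
    apply loglip_weaken with (0 + cdist); [lra|].
    apply (loglip_mult 0 cdist (fun _ => / kappa ^ N)).
    + apply loglip_const; [lra|]. left; apply Rinv_0_lt_compat, pow_lt; auto.
    + pose proof (RL_loglip l N 0 0 (fun _ => 1) (Rle_refl 0) Hl) as H'.
      rewrite Rabs_R0, !Rmult_0_l, Rplus_0_l, Rplus_0_r in H'.
      apply H', loglip_const; lra.
Qed.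

Lemma RL_plus l n a u u' x :
  RL l n a (fun y => u y + u' y) x = RL l n a u x + RL l n a u' x.
Proof. unfold RL. rewrite <- lsum_plus. apply lsum_ext; intros w _. ring. Qed.

(** The operator shifts the series by one place: the term 1 of index 0 is lost, and the term of
    index N appears, which is at most 1 for large N since the powers L_0^N 1 are bounded. *)
Lemma RL_subinv l kappa N x :
  0 < kappa ->
  RL l 1 0 (subinv l kappa N) x =
  kappa * (subinv l kappa N x + / kappa ^ N * RL l N 0 (fun _ => 1) x - 1).
Proof.
  intros Hk. assert (Hkn := fun n => pow_lt kappa n Hk).
  induction N as [|N IH].
  - simpl. rewrite RL_0, Rinv_1.
    assert (E := RL_scal l 1 0 0 (fun _ => 0) x). cbv beta in E.
    rewrite Rmult_0_l in E. rewrite E. ring.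
  - simpl subinv at 1. rewrite RL_plus, IH.
    rewrite (RL_scal l 1 0 (/ kappa ^ N) (RL l N 0 (fun _ => 1)) x).
    rewrite <- RL_add, Nat.add_1_r. simpl. pose proof (Hkn N). field. lra.
Qed.

(* The truncated Neumann series subinv plays the role of the invariant density:
   unlike the latter, it is only a supersolution up to the factor kappa > 1, but
   it needs no limit and no spectral theory. *)
Lemma exists_supersolution (kappa : R) : 1 < kappa ->
  exists Phi a0, 1 <= Phi /\ 0 < a0 /\ forall l, good l ->
  exists phi, (forall x, 1 <= phi x) /\ loglip cdist phi /\
    (forall x, 0 <= x <= 1 -> phi x <= Phi) /\
    forall a n x, Rabs a <= a0 -> 0 <= x <= 1 -> RL l n a phi x <= kappa ^ n * phi x.
Proof.
  (* Half of the room between 1 and kappa is spent at the parameter 0; the other half pays for the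
     perturbation of the parameter. *)
  intros Hk. set (k0 := (1 + kappa) / 2).
  assert (Hk0 : 1 < k0 < kappa) by (unfold k0; lra).
  destruct (pow_gt_large k0 (exp cdist) (proj1 Hk0)) as [N0 HN0].
  (* A successor, so that the series contains its term of index 0, the constant 1, which gives phi
     >= 1. *)
  set (N := Datatypes.S N0).
  assert (HN : exp cdist <= k0 ^ N).
  { unfold N. simpl. pose proof (exp_pos cdist). nra. }
  pose proof (exp_ge_1 _ cdist_nonneg) as Hec.
  set (Phi := INR N * exp cdist).
  assert (HPhi : 1 <= Phi).
  { unfold Phi, N. rewrite S_INR. pose proof (pos_INR N0). nra. }
  (* The first bound is the range of [exp_perturb]; the second makes the error 2 |a| Phi M / e1 at
     most (kappa - 1) / 2 = kappa - k0, hence at most (kappa - k0) phi. *)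
  exists Phi, (Rmin (e1 / 2) ((kappa - 1) * e1 / (4 * Phi * M))).
  split; [auto|]. split.
  { apply Rmin_glb_lt; [lra|]. apply Rdiv_lt_0_compat; [nra|].
    apply Rmult_lt_0_compat; lra. }
  intros l Hl. exists (subinv l k0 N).
  assert (H1 : forall x, 1 <= subinv l k0 N x).
  { intros x. unfold N. assert (Hp : 0 < k0) by lra.
    generalize N0; intros n. induction n as [|n IH].
    - simpl. rewrite RL_0, Rinv_1. lra.
    - simpl in *. eapply Rle_trans; [apply IH|].
      assert (0 <= / (k0 * k0 ^ n) * RL l (Datatypes.S n) 0 (fun _ => 1) x); [|lra].
      apply Rmult_le_pos.
      + left; apply Rinv_0_lt_compat. apply Rmult_lt_0_compat; auto. apply pow_lt; auto.
      + apply RL_nonneg; auto. intros; lra. }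
  assert (H2 : forall x, 0 <= x <= 1 -> subinv l k0 N x <= Phi).
  { intros x Hx. unfold Phi. generalize N; intros n. induction n as [|n IH].
    - simpl. lra.
    - rewrite S_INR. simpl. rewrite Rmult_plus_distr_r, Rmult_1_l.
      apply Rplus_le_compat; auto.
      pose proof (RL_1_le l n x Hl Hx).
      assert (0 <= RL l n 0 (fun _ => 1) x) by (apply RL_nonneg; auto; intros; lra).
      assert (0 < / k0 ^ n <= 1).
      { assert (1 <= k0 ^ n) by (apply pow_R1_Rle; lra).
        split; [apply Rinv_0_lt_compat; lra|]. rewrite <- Rinv_1. apply Rinv_le_contravar; lra. }
      nra. }
  split; [auto|]. split; [apply subinv_loglip; auto; lra|]. split; [auto|].
  set (phi := subinv l k0 N) in *.
  assert (H3 : forall x, 0 <= x <= 1 -> RL l 1 0 phi x <= k0 * phi x).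
  { intros x Hx. unfold phi. rewrite RL_subinv by lra. apply Rmult_le_compat_l; [lra|].
    assert (/ k0 ^ N * RL l N 0 (fun _ => 1) x <= 1); [|lra].
    apply Rmult_le_reg_l with (k0 ^ N); [apply pow_lt; lra|].
    rewrite <- Rmult_assoc, Rinv_r, Rmult_1_l, Rmult_1_r by (apply pow_nonzero; lra).
    eapply Rle_trans; [apply RL_1_le; auto|auto]. }
  assert (H4 : forall a x, Rabs a <= Rmin (e1 / 2) ((kappa - 1) * e1 / (4 * Phi * M)) ->
    0 <= x <= 1 -> RL l 1 a phi x <= kappa * phi x).
  { intros a x Ha Hx.
    assert (Ha1 : Rabs a <= e1 / 2) by (eapply Rle_trans; [apply Ha|apply Rmin_l]).
    assert (Ha2 : Rabs a <= (kappa - 1) * e1 / (4 * Phi * M))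
      by (eapply Rle_trans; [apply Ha|apply Rmin_r]).
    pose proof (Rabs_pos a).
    apply Rle_trans with (RL l 1 0 phi x + 2 * Rabs a / e1 * Phi * M).
    - rewrite !RL_1.
      apply Rle_trans with (lsum (fun j => exp (- 0 * rf j x) * jac j x * phi (g j x) +
        2 * Rabs a / e1 * Phi * (exp (e1 * rf j x) * jac j x)) l).
      + apply lsum_le; intros j Hj. destruct Hl as [_ Hl].
        rewrite List.Forall_forall in Hl. specialize (Hl j Hj).
        rewrite Ropp_0, Rmult_0_l, exp_0.
        pose proof (exp_perturb a (rf j x) (Hrf_pos j x Hl) Ha1) as He.
        pose proof (Hjac_pos j x Hl). pose proof (H2 _ (Hg j x Hl)). pose proof (H1 (g j x)).
        pose proof (exp_pos (e1 * rf j x)) as Hp.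
        apply Rle_trans with ((1 + 2 * Rabs a / e1 * exp (e1 * rf j x)) * jac j x * phi (g j x)).
        { apply Rmult_le_compat_r; [lra|]. apply Rmult_le_compat_r; lra. }
        assert (0 <= 2 * Rabs a / e1 * exp (e1 * rf j x) * jac j x).
        { apply Rmult_le_pos; [|lra]. apply Rmult_le_pos; [|lra].
          unfold Rdiv. apply Rmult_le_pos; [lra|left; apply Rinv_0_lt_compat; auto]. }
        nra.
      + rewrite lsum_plus, lsum_scal. apply Rplus_le_compat_l, Rmult_le_compat_l; auto.
        apply Rmult_le_pos; [|lra].
        unfold Rdiv. apply Rmult_le_pos; [lra|left; apply Rinv_0_lt_compat; auto].
    - pose proof (H3 x Hx). pose proof (H1 x).
      assert (2 * Rabs a / e1 * Phi * M <= (kappa - 1) / 2).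
      { apply Rle_trans with (2 * ((kappa - 1) * e1 / (4 * Phi * M)) / e1 * Phi * M).
        - apply Rmult_le_compat_r; [lra|]. apply Rmult_le_compat_r; [lra|].
          apply Rmult_le_compat_r; [left; apply Rinv_0_lt_compat; auto|]. lra.
        - right. field. lra. }
      unfold k0 in *. nra. }
  intros a n x Ha Hx. revert x Hx. induction n as [|n IH]; intros x Hx.
  - rewrite RL_0. simpl; lra.
  - rewrite <- Nat.add_1_r, RL_add, Nat.add_1_r.
    apply Rle_trans with (RL l 1 a (fun y => kappa ^ n * phi y) x).
    + apply RL_le; auto.
    + rewrite RL_scal. simpl. rewrite Rmult_assoc, <- (Rmult_assoc kappa), (Rmult_comm kappa), Rmult_assoc.
      apply Rmult_le_compat_l; [apply pow_le; lra|]. auto.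
Qed.

Lemma depth_exists (q : R) (m : nat) : 0 < q ->
  exists n, (m <= n)%nat /\ (1 <= n)%nat /\ C0 * rho ^ n <= q.
Proof.
  intros Hq. destruct (pow_lt_1_zero rho) with (y := q / C0) as [N HN].
  - rewrite Rabs_pos_eq; lra.
  - apply Rdiv_lt_0_compat; lra.
  - exists (m + N + 1)%nat. repeat split; try lia.
    specialize (HN (m + N + 1)%nat ltac:(lia)). apply Rabs_lt_between in HN.
    apply Rle_trans with (C0 * (q / C0)); [apply Rmult_le_compat_l; lra|].
    right; field; lra.
Qed.

Lemma weight_lower w : List.Forall ok w ->
  exists m, 0 < m /\ forall s x, Rabs s <= 1 -> 0 <= x <= 1 -> m <= weight (2 * s) w x.
Proof.
  (* For |s| <= 1 the exponent -2 s r is at least -2 r, since r >= 0; distortion then transports the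
     value at 0 to every x in I. *)
  intros Hw. exists (exp (- (2 * (wrf w 0 + cdist))) * (exp (- cdist) * wjac w 0)).
  pose proof (wjac_pos w 0 Hw) as Hj. pose proof cdist_nonneg as Hc.
  split.
  - apply Rmult_lt_0_compat; [apply exp_pos|]. apply Rmult_lt_0_compat; auto. apply exp_pos.
  - intros s x Hs Hx. assert (Hx1 : Rabs (x - 0) <= 1) by (apply Rabs_le; lra).
    apply Rmult_le_compat.
    + left; apply exp_pos.
    + apply Rmult_le_pos; [left; apply exp_pos|lra].
    + apply exp_le. pose proof (wrf_pos w x Hw). pose proof (wrf_pos w 0 Hw).
      pose proof (wrf_lip w Hw x 0) as H1. apply Rabs_le_between in H1.
      assert (cdist * Rabs (x - 0) <= cdist * 1) by (apply Rmult_le_compat_l; auto).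
      apply Rabs_le_between in Hs. nra.
    + destruct (wjac_loglip w Hw x 0) as [H0 H1]. rewrite exp_Ropp.
      pose proof (exp_pos cdist).
      apply Rmult_le_reg_l with (exp cdist); auto.
      rewrite <- Rmult_assoc, Rinv_r, Rmult_1_l by lra.
      eapply Rle_trans; [apply H1|]. apply Rmult_le_compat_r; auto. apply exp_le.
      rewrite <- (Rmult_1_r cdist) at 2. apply Rmult_le_compat_l; auto.
Qed.

(** * The Cauchy-Schwarz inequality for the operators *)

Lemma weight_sqr s w x : weight s w x * weight s w x = weight (2 * s) w x * weight 0 w x.
Proof.
  unfold weight.
  replace (- (2 * s) * wrf w x) with (- s * wrf w x + - s * wrf w x) by ring.
  rewrite exp_plus, Ropp_0, Rmult_0_l, exp_0. ring.
Qed.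

Definition density (u phi : R -> R) (x : R) : R := u x * u x * / phi x.

(* The exponents 2 s and 0 separate the perturbation of the parameter, carried by
   phi, from the operator at 0, which does not increase integrals. *)
Lemma RL_cauchy_schwarz l n s phi u x h l' theta :
  good l -> Permutation (words l n) (h :: l') -> (forall y, 0 < phi y) ->
  0 <= theta <= 1 ->
  (RL l n s u x - theta * (weight s h x * u (wg h x))) ^ 2 <=
  (RL l n (2 * s) phi x - theta * (weight (2 * s) h x * phi (wg h x))) *
  RL l n 0 (density u phi) x.
Proof.
  intros Hl HP Hphi Hth.
  assert (Hok : forall w, In w (h :: l') -> List.Forall ok w).
  { intros w Hw. apply (good_words l n); auto.
    apply Permutation_in with (h :: l'); auto. apply Permutation_sym; auto. }
  (* The tag marks the occurrence of h whose coefficient is lowered. As 0 <= chi <= 1 gives chi^2 <=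
     chi, the lowered coefficient can be charged to the first factor alone. *)
  set (chi := fun c : bool => if c then 1 - theta else 1).
  assert (Hchi : forall c, 0 <= chi c <= 1) by (intros [|]; simpl; lra).
  set (L := (true, h) :: map (pair false) l').
  assert (E : forall a f, RL l n a f x - theta * (weight a h x * f (wg h x)) =
    lsum (fun cw => chi (fst cw) * (weight a (snd cw) x * f (wg (snd cw) x))) L).
  { intros a f. unfold RL. rewrite (lsum_perm _ _ _ HP). unfold L; simpl.
    rewrite lsum_map. simpl.
    rewrite (lsum_ext (fun a0 => 1 * _) (fun w => weight a w x * f (wg w x))) by (intros; ring).
    ring. }
  rewrite (E s u), (E (2 * s) phi).
  assert (E0 : RL l n 0 (density u phi) x =
    lsum (fun cw => weight 0 (snd cw) x * density u phi (wg (snd cw) x)) L).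
  { unfold RL. rewrite (lsum_perm _ _ _ HP). unfold L; simpl. rewrite lsum_map. reflexivity. }
  rewrite E0.
  assert (HL : forall cw, In cw L -> List.Forall ok (snd cw)).
  { intros cw [<-|H]; [apply Hok; simpl; auto|].
    apply in_map_iff in H. destruct H as [w [<- Hw]]. apply Hok; simpl; auto. }
  apply lsum_cauchy_schwarz.
  - intros [c w] Hcw. specialize (HL _ Hcw). simpl in *. specialize (Hchi c).
    pose proof (weight_pos (2 * s) w x HL). pose proof (weight_pos 0 w x HL).
    pose proof (Hphi (wg w x)).
    split; apply Rmult_le_pos; try lra.
    + apply Rmult_le_pos; lra.
    + unfold density. apply Rmult_le_pos; [nra|]. left; apply Rinv_0_lt_compat; auto.
  - intros [c w] Hcw. specialize (HL _ Hcw). simpl fst; simpl snd. specialize (Hchi c).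
    pose proof (Hphi (wg w x)) as Hp. unfold density.
    replace (chi c * (weight (2 * s) w x * phi (wg w x)) *
      (weight 0 w x * (u (wg w x) * u (wg w x) * / phi (wg w x))))
      with (chi c * ((weight (2 * s) w x * weight 0 w x) * (u (wg w x) * u (wg w x))))
      by (field; lra).
    rewrite <- weight_sqr.
    pose proof (pow2_ge_0 (weight s w x * u (wg w x))) as Hsq.
    set (X := weight s w x) in *. set (Y := u (wg w x)) in *.
    replace ((chi c * (X * Y)) ^ 2) with (chi c * chi c * (X * Y) ^ 2) by ring.
    replace (chi c * (X * X * (Y * Y))) with (chi c * (X * Y) ^ 2) by ring.
    apply Rmult_le_compat_r; auto. nra.
Qed.

Lemma density_loglip b u phi : loglip b u -> loglip cdist phi -> (forall x, 0 < phi x) ->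
  loglip (2 * b + cdist) (density u phi).
Proof.
  intros Hu Hphi Hp. replace (2 * b) with (b + b) by ring.
  apply (loglip_mult _ _ (fun x => u x * u x)); [apply loglip_mult; auto|apply loglip_inv; auto].
Qed.

Lemma expm1_small y : y <= / 8 -> exp y - 1 <= / 4.
Proof.
  intros H. pose proof (exp_ineq1_le (- y)) as H1. rewrite exp_Ropp in H1.
  pose proof (exp_pos y) as Hp.
  apply Rmult_le_compat_r with (r := exp y) in H1; [|lra]. rewrite Rinv_l in H1 by lra. nra.
Qed.

(** * Cancellation in one block of iterations *)

Variable (D : R).
Hypothesis HD : 0 < D.

(** The cones in use have exponent aperture |t|. One block yields at most 20 (2 cdist + |t| cdist +
    aperture |t| / 40), which for |t| >= 4 is at most aperture |t| as soon as aperture >= 60 cdist.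
    The summand 1 lets |t|-Lipschitz functions bounded by 1 into the cone. *)
Definition aperture : R := 80 * cdist + 1.

Lemma aperture_ge_1 : 1 <= aperture.
Proof. unfold aperture. pose proof cdist_nonneg. lra. Qed.

(** The first bound makes the cone invariant under a block. The second keeps the part of the
    correlation other than the phase within 1/4 on a cell: over a length of at most 4 PI / (D |t|)
    its exponent is 4 aperture (D / (128 PI aperture)) (4 PI / D) = 1/8. *)
Definition contraction_target : R := Rmin (/ 40) (D / (128 * PI * aperture)).

Lemma contraction_target_pos : 0 < contraction_target.
Proof.
  pose proof aperture_ge_1. pose proof PI_RGT_0. apply Rmin_glb_lt; [lra|].
  apply Rdiv_lt_0_compat; auto. apply Rmult_lt_0_compat; lra.
Qed.

(** The constant of [RInt_gap_cell] made independent of t, for cells of length 1/N with D |t| / (4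
    PI) <= N, an interval of length delta proportional to 1/|t|, and a function of exponent 3
    aperture |t|. *)
Definition gap_fraction : R :=
  Rmin (/ (8 * aperture)) (PI / D) * D / (8 * PI) * exp (- (24 * PI * aperture / D)).

Lemma gap_fraction_pos : 0 < gap_fraction.
Proof.
  pose proof aperture_ge_1. pose proof PI_RGT_0. unfold gap_fraction.
  apply Rmult_lt_0_compat; [|apply exp_pos].
  apply Rdiv_lt_0_compat; [|lra]. apply Rmult_lt_0_compat; auto.
  apply Rmin_glb_lt; [apply Rinv_0_lt_compat; lra|]. apply Rdiv_lt_0_compat; lra.
Qed.

Section Block.

Variables (n : nat) (h k : list nat).
Hypothesis Hn : C0 * rho ^ n <= contraction_target.
Hypothesis Hh : List.Forall ok h /\ length h = n.
Hypothesis Hk : List.Forall ok k /\ length k = n.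
Hypothesis Hpsi : forall x y, 0 <= x <= 1 -> 0 <= y <= 1 ->
  D * Rabs (x - y) <= Rabs ((wrf h x - wrf k x) - (wrf h y - wrf k y)).

Variables (s t : R) (u : R -> R) (v : R -> C).
Hypothesis Hs : Rabs s <= 1.
Hypothesis Ht4 : 4 <= Rabs t.
Hypothesis HtD : 2 * PI / D <= Rabs t.
Hypothesis Huv : cone (aperture * Rabs t) u v.
Hypothesis Hu : forall x, 0 < u x.

Definition term_abs (w : list nat) (x : R) : R := weight s w x * u (wg w x).
Definition term_cplx (w : list nat) (x : R) : C :=
  (RtoC (weight s w x) * (phase t w x * v (wg w x)))%C.

Definition block_exponent : R :=
  (Rabs s * cdist + cdist) + (Rabs t * cdist + aperture * Rabs t * (C0 * rho ^ n)).

Lemma block_exponent_bounds : 0 <= block_exponent /\ 20 * block_exponent <= aperture * Rabs t.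
Proof.
  pose proof cdist_nonneg. pose proof aperture_ge_1. pose proof (Rabs_pos s).
  pose proof (rho_pow_bounds n).
  assert (Hq : C0 * rho ^ n <= / 40) by (eapply Rle_trans; [apply Hn|apply Rmin_l]).
  assert (Hq0 : 0 <= C0 * rho ^ n) by nra.
  assert (0 <= aperture * Rabs t) by (apply Rmult_le_pos; lra).
  assert (aperture * Rabs t * (C0 * rho ^ n) <= aperture * Rabs t * / 40)
    by (apply Rmult_le_compat_l; auto).
  assert (0 <= aperture * Rabs t * (C0 * rho ^ n)) by (apply Rmult_le_pos; auto).
  assert (0 <= Rabs s * cdist <= cdist) by (split; nra).
  assert (0 <= Rabs t * cdist) by (apply Rmult_le_pos; lra).
  assert (4 * cdist <= Rabs t * cdist) by (apply Rmult_le_compat_r; auto).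
  unfold block_exponent. split; [lra|].
  assert (Ea : aperture * Rabs t = 80 * (Rabs t * cdist) + Rabs t) by (unfold aperture; ring).
  lra.
Qed.

Lemma block_term_cone w : List.Forall ok w /\ length w = n ->
  cone block_exponent (term_abs w) (term_cplx w).
Proof.
  intros [Hw Hlen]. unfold block_exponent. rewrite <- Hlen. apply (term_cone s t (aperture * Rabs t) u v w); auto.
  apply Rmult_le_pos; [pose proof aperture_ge_1; lra|apply Rabs_pos].
Qed.

Lemma term_abs_pos w x : List.Forall ok w /\ length w = n -> 0 < term_abs w x.
Proof. intros [Hw _]. apply Rmult_lt_0_compat; auto. apply weight_pos; auto. Qed.

Definition bgap : R -> R := gap (term_abs h) (term_abs k) (term_cplx h) (term_cplx k).

Lemma bgap_bounds x : 0 <= bgap x <= 2.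
Proof.
  apply (gap_bounds block_exponent); auto using block_term_cone, term_abs_pos.
  apply block_exponent_bounds.
Qed.

Lemma bgap_lip x y : Rabs (bgap x - bgap y) <= exp (4 * block_exponent * Rabs (x - y)) - 1.
Proof.
  apply (gap_lip block_exponent); auto using block_term_cone, term_abs_pos.
  apply block_exponent_bounds.
Qed.

Lemma bgap_continuous x : continuous bgap x.
Proof.
  pose proof (proj1 block_exponent_bounds) as Hb.
  (* The gap may vanish at some points and so is not log-Lipschitz itself; after adding 1, its
     absolute modulus of continuity is also a relative one. *)
  assert (H : loglip (4 * block_exponent) (fun y => bgap y + 1)).
  { intros y z. pose proof (bgap_bounds y). split; [lra|].
    pose proof (bgap_lip y z) as H1. apply Rabs_le_between in H1.
    assert (1 <= exp (4 * block_exponent * Rabs (y - z))).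
    { apply exp_ge_1. apply Rmult_le_pos; [lra|apply Rabs_pos]. }
    nra. }
  apply (continuous_ext (fun y => plus (bgap y + 1) (-1))).
  - intros y. unfold plus; simpl. ring.
  - apply (continuous_plus (fun y => bgap y + 1) (fun _ => -1)).
    + apply (loglip_continuous (4 * block_exponent)); auto. lra.
    + apply continuous_const.
Qed.

(** The correlation without its phases; the positive weights cancel in it. It sees x only through
    the contracted points h x and k x, so it hardly moves at scale 1/|t|. *)
Definition slow (x : R) : C :=
  ((RtoC (/ u (wg h x)) * v (wg h x)) * Cconj (RtoC (/ u (wg k x)) * v (wg k x)))%C.

Lemma slow_lip x y :
  Cmod (slow x - slow y)%C <=
  exp (4 * (aperture * Rabs t) * (C0 * rho ^ n) * Rabs (x - y)) - 1.
Proof.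
  assert (Hb : 0 <= aperture * Rabs t)
    by (apply Rmult_le_pos; [pose proof aperture_ge_1; lra|apply Rabs_pos]).
  pose proof (quotient_cone _ u v Hb Huv Hu) as HQ.
  destruct Hh as [Hh1 Hh2]. destruct Hk as [Hk1 Hk2].
  assert (P : forall w, List.Forall ok w -> length w = n ->
    cone (2 * (aperture * Rabs t) * (C0 * rho ^ n)) (fun _ => 1)
      (fun x => (RtoC (/ u (wg w x)) * v (wg w x))%C)).
  { intros w Hw1 Hw2.
    refine (cone_comp _ _ _ _ (wg w) _ _ HQ); [lra|]. rewrite <- Hw2. auto. }
  destruct (cone_mult _ _ _ _ _ _ (P h Hh1 Hh2) (cone_conj _ _ _ (P k Hk1 Hk2))) as [_ H].
  destruct (H x y) as [_ H1]. rewrite Rmult_1_l, Rmult_1_r in H1.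
  replace (4 * (aperture * Rabs t) * (C0 * rho ^ n))
    with (2 * (aperture * Rabs t) * (C0 * rho ^ n) + 2 * (aperture * Rabs t) * (C0 * rho ^ n))
    by ring.
  exact H1.
Qed.

Lemma bgap_slow x :
  bgap x = 1 - Re (slow x *
    (cos (- t * (wrf h x - wrf k x)), sin (- t * (wrf h x - wrf k x))))%C.
Proof.
  unfold bgap, gap. do 2 f_equal. unfold corr, slow, term_abs, term_cplx.
  destruct Hh as [Hh1 _]. destruct Hk as [Hk1 _].
  pose proof (weight_pos s h x Hh1) as Hwh. pose proof (weight_pos s k x Hk1) as Hwk.
  pose proof (Hu (wg h x)) as Huh. pose proof (Hu (wg k x)) as Huk.
  replace (- t * (wrf h x - wrf k x)) with (- t * wrf h x + - (- t * wrf k x)) by ring.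
  rewrite cis_plus, cos_neg, sin_neg.
  change (cos (- t * wrf k x), - sin (- t * wrf k x)) with (Cconj (phase t k x)).
  change (cos (- t * wrf h x), sin (- t * wrf h x)) with (phase t h x).
  assert (Ec : forall z : R, Cconj (RtoC z) = RtoC z)
    by (intros z; unfold Cconj, RtoC; simpl; rewrite Ropp_0; reflexivity).
  rewrite !Cmult_conj, !Ec, !Rinv_mult, !RtoC_mult.
  assert (Ew : forall z, 0 < z -> (RtoC (/ z) * RtoC z)%C = RtoC 1)
    by (intros z Hz; rewrite <- RtoC_mult; f_equal; field; lra).
  transitivity ((RtoC (/ weight s h x) * RtoC (weight s h x)) *
    (RtoC (/ weight s k x) * RtoC (weight s k x)) *
    (RtoC (/ u (wg h x)) * v (wg h x) * (RtoC (/ u (wg k x)) * Cconj (v (wg k x))) *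
    (phase t h x * Cconj (phase t k x))))%C; [ring|].
  rewrite !Ew by auto. ring.
Qed.

Lemma wrf_continuous w x : List.Forall ok w -> continuous (wrf w) x.
Proof.
  intros Hw.
  assert (H : loglip cdist (fun y => exp (wrf w y))) by (apply loglip_exp, wrf_lip; auto).
  apply (continuous_ext (fun y => ln (exp (wrf w y)))).
  - intros y. apply ln_exp.
  - apply (continuous_comp (fun y => exp (wrf w y)) ln).
    + apply (loglip_continuous cdist); auto. apply cdist_nonneg.
    + apply continuity_pt_filterlim, derivable_continuous_pt.
      exists (/ exp (wrf w x)). apply derivable_pt_lim_ln, exp_pos.
Qed.

(** On a cell of length 1/N, with N the integer part of D |t| / (2 PI), the phase moves by at least
    |t| D / N >= PI. So each cell has a point where the gap is at least 3/4, and the gap stays above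
    1/2 at distances up to a constant times 1/|t|. *)
Lemma RInt_bgap_ge G : loglip (3 * aperture * Rabs t) G ->
  gap_fraction * RInt G 0 1 <= RInt (fun x => bgap x * G x) 0 1.
Proof.
  intros HG. pose proof aperture_ge_1 as Ha. pose proof PI_RGT_0 as Hpi.
  set (bG := 3 * aperture * Rabs t) in *.
  assert (HbG : 0 <= bG) by (unfold bG; apply Rmult_le_pos; lra).
  assert (HGc : forall x, continuous G x) by (intros; apply (loglip_continuous bG); auto).
  destruct (nfloor_ex (D * Rabs t / (2 * PI))) as [N [HN1 HN2]].
  { unfold Rdiv. apply Rmult_le_pos; [nra|]. left; apply Rinv_0_lt_compat; lra. }
  (* The hypothesis |t| >= 2 PI / D says that I has room for at least one cell. *)
  assert (Ht1 : 1 <= D * Rabs t / (2 * PI)).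
  { apply Rmult_le_reg_r with (2 * PI / D); [apply Rdiv_lt_0_compat; lra|].
    rewrite Rmult_1_l. eapply Rle_trans; [apply HtD|]. right; field; lra. }
  assert (HN : (1 <= N)%nat).
  { destruct N; [simpl in HN2; lra|lia]. }
  assert (HNR : 1 <= INR N) by (apply (le_INR 1); auto).
  (* Rounding down costs at most a factor 2, because N >= 1. *)
  assert (HN3 : D * Rabs t / (4 * PI) <= INR N).
  { replace (D * Rabs t / (4 * PI)) with (D * Rabs t / (2 * PI) / 2) by (field; lra). lra. }
  assert (HtN : Rabs t / INR N <= 4 * PI / D).
  { apply Rmult_le_reg_r with (INR N * D / (4 * PI)).
    - apply Rdiv_lt_0_compat; [|lra]. apply Rmult_lt_0_compat; lra.
    - replace (Rabs t / INR N * (INR N * D / (4 * PI))) with (D * Rabs t / (4 * PI)) by (field; lra).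
      replace (4 * PI / D * (INR N * D / (4 * PI))) with (INR N) by (field; lra). auto. }
  apply (RInt_cells_le (fun x => bgap x * G x) G gap_fraction N); auto.
  { intros x. apply (continuous_mult bgap G); auto using bgap_continuous. }
  intros i Hi. set (al := INR i / INR N). set (be := INR (Datatypes.S i) / INR N).
  assert (Hlen : be - al = / INR N).
  { unfold be, al. rewrite S_INR. field. lra. }
  assert (HiN : 0 < / INR N) by (apply Rinv_0_lt_compat; lra).
  assert (Hal : 0 <= al).
  { unfold al, Rdiv. apply Rmult_le_pos; [apply pos_INR|lra]. }
  assert (Hbe : be <= 1).
  { unfold be. apply Rmult_le_reg_r with (INR N); [lra|].
    unfold Rdiv. rewrite Rmult_assoc, Rinv_l, Rmult_1_r, Rmult_1_l by lra.
    apply le_INR; lia. }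
  destruct (phase_opposes (fun x => - t * (wrf h x - wrf k x)) slow al be) as [x0 [Hx0 Hre]].
  - lra.
  - intros x. apply (continuous_mult (fun _ => - t) (fun x => wrf h x - wrf k x)).
    + apply continuous_const.
    + apply (continuous_minus (wrf h) (wrf k)); apply wrf_continuous; [apply Hh|apply Hk].
  - rewrite <- Rmult_minus_distr_l, Rabs_mult, Rabs_Ropp.
    apply Rle_trans with (Rabs t * (D * Rabs (be - al))).
    + rewrite Hlen, (Rabs_pos_eq (/ INR N)) by lra.
      apply Rmult_le_reg_r with (INR N); [lra|].
      replace (Rabs t * (D * / INR N) * INR N) with (D * Rabs t) by (field; lra).
      apply Rmult_le_compat_r with (r := 2 * PI) in HN1; [|lra].
      replace (D * Rabs t / (2 * PI) * (2 * PI)) with (D * Rabs t) in HN1 by (field; lra).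
      nra.
    + apply Rmult_le_compat_l; [apply Rabs_pos|]. apply Hpsi; lra.
  - intros x Hx. eapply Rle_trans; [apply slow_lip|]. apply expm1_small.
    assert (Hq : C0 * rho ^ n <= D / (128 * PI * aperture))
      by (eapply Rle_trans; [apply Hn|apply Rmin_r]).
    pose proof (rho_pow_bounds n).
    assert (0 <= C0 * rho ^ n) by (apply Rmult_le_pos; lra).
    assert (Hxa : Rabs (x - al) <= / INR N) by (apply Rabs_le; lra).
    apply Rle_trans with (4 * aperture * (C0 * rho ^ n) * (Rabs t * / INR N)).
    { apply Rle_trans with (4 * aperture * (C0 * rho ^ n) * (Rabs t * Rabs (x - al))).
      - right; ring.
      - apply Rmult_le_compat_l; [apply Rmult_le_pos; lra|].
        apply Rmult_le_compat_l; lra. }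
    apply Rle_trans with (4 * aperture * (D / (128 * PI * aperture)) * (4 * PI / D)).
    { apply Rmult_le_compat; [apply Rmult_le_pos; lra|apply Rmult_le_pos; lra| |exact HtN].
      apply Rmult_le_compat_l; lra. }
    right. field. lra.
  (* Within d0 / |t| of x0 the first bound lets the gap fall by at most 1/4, from 3/4 to 1/2; the
     second makes twice this distance fit into a cell. *)
  - set (d0 := Rmin (/ (8 * aperture)) (PI / D)).
    assert (Hd0 : 0 < d0).
    { apply Rmin_glb_lt; [apply Rinv_0_lt_compat; lra|]. apply Rdiv_lt_0_compat; lra. }
    assert (Hx0g : 3 / 4 <= bgap x0) by (rewrite bgap_slow; lra).
    eapply Rle_trans;
      [|apply (RInt_gap_cell bgap G bG (d0 / Rabs t) al be x0); auto using bgap_continuous].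
    + apply Rmult_le_compat_r.
      { apply RInt_ge_0; [lra|apply ex_RInt_cont; auto|]. intros x _; apply (HG x x). }
      rewrite Hlen. unfold gap_fraction. fold d0.
      replace (d0 / Rabs t * exp (- (2 * bG * / INR N)) / (2 * / INR N))
        with (d0 / (2 * Rabs t) * INR N * exp (- (2 * bG * / INR N))) by (field; lra).
      apply Rmult_le_compat.
      * left. apply Rdiv_lt_0_compat; [|lra]. apply Rmult_lt_0_compat; auto.
      * left; apply exp_pos.
      * apply Rle_trans with (d0 / (2 * Rabs t) * (D * Rabs t / (4 * PI))).
        { right; field; lra. }
        apply Rmult_le_compat_l; auto. left. apply Rdiv_lt_0_compat; lra.
      * apply exp_le, Ropp_le_contravar. unfold bG.
        apply Rle_trans with (6 * aperture * (4 * PI / D)); [|right; field; lra].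
        apply Rle_trans with (6 * aperture * (Rabs t / INR N)); [right; field; lra|].
        apply Rmult_le_compat_l; lra.
    + intros x. apply bgap_bounds.
    + apply Rdiv_lt_0_compat; lra.
    + rewrite Hlen. apply Rle_trans with (2 * (PI / D / Rabs t)).
      * apply Rmult_le_compat_l; [lra|]. apply Rmult_le_compat_r; [left; apply Rinv_0_lt_compat; lra|].
        apply Rmin_r.
      * apply Rmult_le_reg_r with (INR N * (D * Rabs t / (2 * PI))).
        { apply Rmult_lt_0_compat; lra. }
        replace (2 * (PI / D / Rabs t) * (INR N * (D * Rabs t / (2 * PI)))) with (INR N)
          by (field; lra).
        replace (/ INR N * (INR N * (D * Rabs t / (2 * PI)))) with (D * Rabs t / (2 * PI))
          by (field; lra). auto.
    + intros x Hx. pose proof (bgap_lip x x0) as H1. apply Rabs_le_between in H1.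
      destruct block_exponent_bounds as [B0 B1].
      assert (exp (4 * block_exponent * Rabs (x - x0)) - 1 <= / 4); [|lra].
      apply expm1_small.
      apply Rle_trans with (4 * block_exponent * (/ (8 * aperture) / Rabs t)).
      * apply Rmult_le_compat_l; [lra|]. eapply Rle_trans; [apply Hx|].
        apply Rmult_le_compat_r; [left; apply Rinv_0_lt_compat; lra|apply Rmin_l].
      * apply Rle_trans with (aperture * Rabs t * (/ (8 * aperture) / Rabs t)).
        -- apply Rmult_le_compat_r; [|lra].
           left. apply Rdiv_lt_0_compat; [apply Rinv_0_lt_compat; lra|lra].
        -- right; field; lra.
Qed.

Lemma exp_opp_cdist_le phi x y : loglip cdist phi -> 0 <= x <= 1 -> 0 <= y <= 1 ->
  exp (- cdist) * phi x <= phi y.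
Proof.
  intros H Hx Hy. destruct (H y x) as [H0 H1]. rewrite exp_Ropp.
  pose proof (exp_pos cdist). pose proof cdist_nonneg.
  apply Rmult_le_reg_l with (exp cdist); auto.
  rewrite <- Rmult_assoc, Rinv_r, Rmult_1_l by lra.
  eapply Rle_trans; [apply H1|]. apply Rmult_le_compat_r; auto. apply exp_le.
  rewrite <- (Rmult_1_r cdist) at 2. apply Rmult_le_compat_l; auto. apply Rabs_le; lra.
Qed.

(** At each x the smaller of the two terms, at the word w say, carries the loss: u' <= F - (tau/2)
    (term at w). Cauchy-Schwarz, with the coefficient of w lowered in the factor containing phi,
    gives u'^2 / phi <= (kappa - m1 tau / 2) G, where G = L_0^n (u^2 / phi). Integration uses the
    lower bound for the integral of tau G and the fact that G has no larger integral than u^2 / phi.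
    The last hypothesis keeps the final factor nonnegative. *)
Lemma block_step l phi kappa m0 :
  good l -> incl h l -> incl k l ->
  (forall x, 1 <= phi x) -> loglip cdist phi ->
  (forall x, 0 <= x <= 1 -> RL l n (2 * s) phi x <= kappa * phi x) ->
  0 < m0 ->
  (forall x, 0 <= x <= 1 -> m0 <= weight (2 * s) h x /\ m0 <= weight (2 * s) k x) ->
  m0 * exp (- cdist) * gap_fraction / 2 <= kappa ->
  exists u', (forall x, 0 < u' x) /\ cone (aperture * Rabs t) u' (CL l n s t v) /\
    RInt (density u' phi) 0 1 <=
    (kappa - m0 * exp (- cdist) * gap_fraction / 2) * RInt (density u phi) 0 1.
Proof.
  intros Hl Hhl Hkl Hphi1 Hphi Hkappa Hm0 Hm Hpos.
  assert (Hphi0 : forall x, 0 < phi x) by (intros x; specialize (Hphi1 x); lra).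
  destruct block_exponent_bounds as [B0 B1].
  pose proof cdist_nonneg as Hc. pose proof aperture_ge_1 as Ha.
  assert (Hb : 0 <= aperture * Rabs t) by (apply Rmult_le_pos; lra).
  (* Equal words would have a vanishing phase difference. Being distinct, they occupy two places in
     the list of words, and both terms can be taken out of the sum. *)
  assert (Hhk : h <> k).
  { intros E. specialize (Hpsi 0 1 ltac:(lra) ltac:(lra)). rewrite E in Hpsi.
    replace (wrf k 0 - wrf k 0 - (wrf k 1 - wrf k 1)) with 0 in Hpsi by ring.
    rewrite Rabs_R0, Rabs_left in Hpsi by lra. lra. }
  assert (Hinh : In h (words l n)) by (apply in_words; split; [apply Hh|auto]).
  assert (Hink : In k (words l n)) by (apply in_words; split; [apply Hk|auto]).
  assert (HP : exists l', Permutation (words l n) (h :: k :: l')).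
  { apply in_split in Hinh. destruct Hinh as [l1 [l2 E]]. rewrite E in Hink |- *.
    assert (Hk' : In k (l1 ++ l2)).
    { apply in_app_or in Hink. apply in_or_app. destruct Hink as [H|[H|H]]; auto. congruence. }
    apply in_split in Hk'. destruct Hk' as [l3 [l4 E']].
    exists (l3 ++ l4). apply Permutation_sym.
    apply Permutation_trans with (h :: (l1 ++ l2)); [|apply Permutation_middle].
    rewrite E'. apply perm_skip, Permutation_middle. }
  destruct HP as [l' HP].
  set (F := RL l n s u). set (V := CL l n s t v).
  set (A := term_abs h). set (B := term_abs k).
  set (hm := harm A B).
  assert (HA : cone block_exponent A (term_cplx h)) by (apply block_term_cone; auto).
  assert (HB : cone block_exponent B (term_cplx k)) by (apply block_term_cone; auto).
  assert (HAp : forall x, 0 < A x) by (intros; apply term_abs_pos; auto).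
  assert (HBp : forall x, 0 < B x) by (intros; apply term_abs_pos; auto).
  assert (Hw' : forall w, In w l' -> List.Forall ok w /\ length w = n).
  { intros w Hw. apply (good_words l n); auto. apply Permutation_in with (h :: k :: l').
    - apply Permutation_sym; auto.
    - simpl; auto. }
  assert (EF : forall x, F x = A x + B x + lsum (fun w => term_abs w x) l').
  { intros x. unfold F, RL. rewrite (lsum_perm _ _ _ HP). simpl. unfold A, B, term_abs. ring. }
  assert (EV : forall x, V x = (term_cplx h x + term_cplx k x + csum (fun w => term_cplx w x) l')%C).
  { intros x. unfold V, CL. rewrite (csum_perm _ _ _ HP). simpl. unfold term_cplx. ring. }
  assert (Hrest : forall x, 0 <= lsum (fun w => term_abs w x) l').
  { intros x. apply lsum_nonneg. intros w Hw. left. apply term_abs_pos; auto. }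
  assert (HAB : forall x, A x + B x <= F x) by (intros x; rewrite EF; specialize (Hrest x); lra).
  assert (HVF : forall x, Cmod (V x) <= F x - hm x * bgap x).
  { intros x. rewrite EV, EF. eapply Rle_trans; [apply Cmod_triangle|].
    pose proof (Cmod_plus_le_gap block_exponent A B _ _ B0 HA HB HAp HBp x) as H1.
    change (gap A B (term_cplx h) (term_cplx k) x) with (bgap x) in H1. fold hm in H1.
    assert (H2 : Cmod (csum (fun w => term_cplx w x) l') <= lsum (fun w => term_abs w x) l').
    { apply Cmod_csum_le. intros w Hw. apply (proj2 (block_term_cone w (Hw' w Hw)) x x). }
    lra. }
  assert (HFV : cone block_exponent F V) by (apply RL_CL_cone; auto).
  set (u' := fun x => F x - hm x * bgap x).
  assert (Hu' : forall x, 0 < u' x).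
  { intros x. pose proof (harm_gap_le_half block_exponent A B _ _ B0 HA HB HAp HBp x) as H.
    fold hm in H. change (gap A B (term_cplx h) (term_cplx k) x) with (bgap x) in H.
    specialize (HAB x). specialize (HAp x). specialize (HBp x). unfold u'. lra. }
  assert (Hcone : cone (aperture * Rabs t) u' V).
  { apply cone_weaken with (20 * block_exponent); auto.
    exact (reduced_cone block_exponent A B _ _ B0 HA HB HAp HBp F V HFV HAB HVF). }
  exists u'. split; [auto|]. split; [exact Hcone|].
  set (G := RL l n 0 (density u phi)).
  assert (HG : loglip (3 * aperture * Rabs t) G).
  { eapply loglip_weaken;
      [|apply (RL_loglip l n 0 (2 * (aperture * Rabs t) + cdist)); auto;
        [lra|apply density_loglip; auto; apply Huv]].
    pose proof (rho_pow_bounds n).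
    assert (Hq : C0 * rho ^ n <= / 40) by (eapply Rle_trans; [apply Hn|apply Rmin_l]).
    assert (cdist <= aperture * Rabs t).
    { apply Rle_trans with (aperture * 1); [unfold aperture; lra|apply Rmult_le_compat_l; lra]. }
    assert ((2 * (aperture * Rabs t) + cdist) * (C0 * rho ^ n) <= (2 * (aperture * Rabs t) + cdist) * / 40)
      by (apply Rmult_le_compat_l; lra).
    rewrite Rabs_R0. lra. }
  assert (HG0 : forall x, 0 <= G x) by (intros x; apply (HG x x)).
  (* phi varies by at most exp cdist on I, so m1 phi(x) is a lower bound for the weighted values of
     phi at h x and at k x. *)
  set (m1 := m0 * exp (- cdist)).
  assert (Hm1 : 0 < m1) by (apply Rmult_lt_0_compat; auto; apply exp_pos).
  assert (Hpt : forall x, 0 <= x <= 1 ->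
    density u' phi x <= kappa * G x - m1 / 2 * (bgap x * G x)).
  { intros x Hx. pose proof (bgap_bounds x) as Ht.
    assert (Hone : forall w W', Permutation (words l n) (w :: W') -> 
      List.Forall ok w -> m0 <= weight (2 * s) w x ->
      term_abs w x * bgap x <= 2 * (hm x * bgap x) ->
      density u' phi x <= kappa * G x - m1 / 2 * (bgap x * G x)).
    { intros w W' HPw Hw Hmw Hloss.
      pose proof (RL_cauchy_schwarz l n s phi u x w W' (bgap x / 2) Hl HPw Hphi0 ltac:(lra)) as HCS.
      fold F G in HCS. fold (term_abs w x) in HCS.
      assert (Hle : u' x <= F x - bgap x / 2 * term_abs w x) by (unfold u'; lra).
      assert (Hsq : u' x * u' x <= (F x - bgap x / 2 * term_abs w x) ^ 2).
      { specialize (Hu' x). simpl. rewrite Rmult_1_r. apply Rmult_le_compat; lra. }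
      assert (Hlow : m1 * phi x <= weight (2 * s) w x * phi (wg w x)).
      { unfold m1. rewrite Rmult_assoc. apply Rmult_le_compat; auto.
        - lra.
        - apply Rmult_le_pos; [left; apply exp_pos|]. specialize (Hphi0 x); lra.
        - apply exp_opp_cdist_le; auto. apply wg_bounds; auto. }
      specialize (Hkappa x Hx). specialize (HG0 x). specialize (Hphi0 x).
      assert (Hfin : u' x * u' x <= (kappa - m1 / 2 * bgap x) * phi x * G x).
      { eapply Rle_trans; [apply Hsq|]. eapply Rle_trans; [apply HCS|].
        apply Rmult_le_compat_r; auto.
        assert (bgap x / 2 * (m1 * phi x) <= bgap x / 2 * (weight (2 * s) w x * phi (wg w x)))
          by (apply Rmult_le_compat_l; lra).
        lra. }
      unfold density. apply Rmult_le_reg_r with (phi x); auto.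
      rewrite Rmult_assoc, Rinv_l, Rmult_1_r by lra. lra. }
    destruct (Hm x Hx) as [Hmh Hmk].
    destruct (Rle_lt_dec (A x) (B x)) as [HABx|HABx].
    - apply (Hone h (k :: l')); auto; [apply Hh|].
      apply (harm_gap_le_l block_exponent A B (term_cplx h) (term_cplx k)); auto.
    - apply (Hone k (h :: l')); auto; [|apply Hk|].
      + eapply Permutation_trans; [apply HP|apply perm_swap].
      + apply (harm_gap_le_r block_exponent A B (term_cplx h) (term_cplx k)); auto. lra. }
  assert (Hbg : 0 <= 3 * aperture * Rabs t) by lra.
  assert (HGc : forall x, continuous G x)
    by (intros; apply (loglip_continuous (3 * aperture * Rabs t)); auto).
  assert (HtGc : forall x, continuous (fun y => bgap y * G y) x)
    by (intros; apply (continuous_mult bgap G); auto using bgap_continuous).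
  assert (Hd : loglip (2 * (aperture * Rabs t) + cdist) (density u' phi))
    by (apply density_loglip; auto; apply Hcone).
  apply Rle_trans with (kappa * RInt G 0 1 - m1 / 2 * RInt (fun x => bgap x * G x) 0 1).
  { rewrite <- (RInt_scal_cont G) by auto.
    rewrite <- (RInt_scal_cont (fun x => bgap x * G x)) by auto.
    assert (E1 : forall x, continuous (fun y => kappa * G y) x).
    { intros x. apply (continuous_mult (fun _ => kappa) G); auto. apply continuous_const. }
    assert (E2 : forall x, continuous (fun y => m1 / 2 * (bgap y * G y)) x).
    { intros x. apply (continuous_mult (fun _ => m1 / 2) (fun y => bgap y * G y)); auto.
      apply continuous_const. }
    assert (E : RInt (fun x => kappa * G x - m1 / 2 * (bgap x * G x)) 0 1 =
      RInt (fun x => kappa * G x) 0 1 - RInt (fun x => m1 / 2 * (bgap x * G x)) 0 1).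
    { apply (RInt_minus (V := R_CompleteNormedModule)); apply ex_RInt_cont; auto. }
    rewrite <- E.
    apply RInt_le; [lra| | |].
    - apply (ex_RInt_loglip (2 * (aperture * Rabs t) + cdist)); auto. lra.
    - apply (ex_RInt_minus (V := R_NormedModule)); apply ex_RInt_cont; auto.
    - intros x Hx. apply Hpt. lra. }
  pose proof (RInt_bgap_ge G HG) as H1.
  assert (H2 : RInt G 0 1 <= RInt (density u phi) 0 1).
  { apply (RInt_RL_le l n (2 * (aperture * Rabs t) + cdist)); auto; [lra|].
    apply density_loglip; auto. apply Huv. }
  fold m1 in Hpos. fold m1.
  assert (m1 / 2 * (gap_fraction * RInt G 0 1) <= m1 / 2 * RInt (fun x => bgap x * G x) 0 1)
    by (apply Rmult_le_compat_l; lra).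
  assert (HG1 : 0 <= RInt G 0 1).
  { apply RInt_ge_0; [lra|apply ex_RInt_cont; auto|]. auto. }
  apply Rle_trans with ((kappa - m1 * gap_fraction / 2) * RInt G 0 1); [lra|].
  apply Rmult_le_compat_l; lra.
Qed.

End Block.

Lemma RL_sqr_le l n s phi u x : good l -> (forall y, 0 < phi y) ->
  RL l n s u x ^ 2 <= RL l n (2 * s) phi x * RL l n 0 (density u phi) x.
Proof.
  intros Hl Hphi. destruct (words l n) as [|w W] eqn:E.
  - unfold RL. rewrite E. simpl. lra.
  - pose proof (RL_cauchy_schwarz l n s phi u x w W 0 Hl) as H.
    rewrite E in H. specialize (H (Permutation_refl _) Hphi ltac:(lra)).
    rewrite !Rmult_0_l, !Rminus_0_r in H. exact H.
Qed.

(** * Decay of the integral over successive blocks *)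

Variable (n0 : nat).
Hypothesis Huni : forall n, (n0 <= n)%nat -> exists h k,
  (List.Forall ok h /\ length h = n) /\ (List.Forall ok k /\ length k = n) /\
  forall x y, 0 <= x <= 1 -> 0 <= y <= 1 ->
    D * Rabs (x - y) <= Rabs ((wrf h x - wrf k x) - (wrf h y - wrf k y)).

(** Two rates are compared: each iteration may multiply phi by exp lambda, while the integral of u^2
    / phi loses exp (- 4 lambda) per iteration. The factor 4 leaves a net decay even when only half
    of the iterations belong to blocks. *)
Lemma energy_decay : exists n lambda a0 Phi l0,
  (1 <= n)%nat /\ 0 < lambda /\ 0 < a0 /\ 1 <= Phi /\ List.Forall ok l0 /\
  forall l, good l -> incl l0 l ->
  exists phi, (forall x, 1 <= phi x) /\ loglip cdist phi /\
    (forall x, 0 <= x <= 1 -> phi x <= Phi) /\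
    (forall a m x, Rabs a <= a0 -> 0 <= x <= 1 -> RL l m a phi x <= exp (INR m * lambda) * phi x) /\
    forall s t v, Rabs s <= 1 -> Rabs (2 * s) <= a0 -> 4 <= Rabs t -> 2 * PI / D <= Rabs t ->
      cone (aperture * Rabs t) (fun _ => 1) v ->
      forall j, exists u, (forall x, 0 < u x) /\
        cone (aperture * Rabs t) u (CL l (j * n) s t v) /\
        RInt (density u phi) 0 1 <= exp (- (4 * INR (j * n) * lambda)).
Proof.
  destruct (depth_exists contraction_target n0 contraction_target_pos) as [n [Hn0 [Hn1 Hn]]].
  destruct (Huni n Hn0) as [h [k [Hh [Hk Hpsi]]]].
  destruct (weight_lower h (proj1 Hh)) as [mh [Hmh Hmh']].
  destruct (weight_lower k (proj1 Hk)) as [mk [Hmk Hmk']].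
  pose proof gap_fraction_pos as Hgf. pose proof cdist_nonneg as Hc.
  assert (HnR : 1 <= INR n) by (apply (le_INR 1); auto).
  set (eta := Rmin mh mk * exp (- cdist) * gap_fraction / 2).
  assert (Heta : 0 < eta).
  { apply Rdiv_lt_0_compat; [|lra]. apply Rmult_lt_0_compat; auto.
    apply Rmult_lt_0_compat; [apply Rmin_glb_lt; auto|apply exp_pos]. }
  (* The lower bound of the weights is reduced so that the gain of a block becomes min (eta, 1/2)
     and cannot exceed the factor kappa of [block_step]. *)
  set (m0 := Rmin mh mk * Rmin 1 (/ (2 * eta))).
  (* Half of the gain, or less. With lambda defined by exp (4 n lambda) = 1 + del, the factor of a
     block is at most (1 + del) - 2 del = 1 - del <= 1 / (1 + del) = exp (- 4 n lambda). *)
  set (del := Rmin (/ 4) (eta / 2)).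
  assert (Hdel : 0 < del) by (apply Rmin_glb_lt; lra).
  assert (Hdel4 : del <= / 4) by apply Rmin_l.
  assert (Hmin : 0 < Rmin 1 (/ (2 * eta))).
  { apply Rmin_glb_lt; [lra|]. apply Rinv_0_lt_compat; lra. }
  assert (Hm0 : 0 < m0).
  { apply Rmult_lt_0_compat; auto. apply Rmin_glb_lt; auto. }
  assert (Hm0le : m0 <= Rmin mh mk).
  { unfold m0. rewrite <- (Rmult_1_r (Rmin mh mk)) at 2. apply Rmult_le_compat_l; [|apply Rmin_l].
    left; apply Rmin_glb_lt; auto. }
  assert (Heta0 : m0 * exp (- cdist) * gap_fraction / 2 = Rmin 1 (/ (2 * eta)) * eta)
    by (unfold m0, eta; field).
  assert (Heta1 : 2 * del <= Rmin 1 (/ (2 * eta)) * eta).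
  { unfold Rmin at 1. destruct (Rle_dec 1 (/ (2 * eta))) as [H|H].
    - pose proof (Rmin_r (/ 4) (eta / 2)) as H'. fold del in H'. lra.
    - replace (/ (2 * eta) * eta) with (/ 2) by (field; lra). lra. }
  assert (Heta2 : Rmin 1 (/ (2 * eta)) * eta <= 1).
  { apply Rle_trans with (/ (2 * eta) * eta); [apply Rmult_le_compat_r; [lra|apply Rmin_r]|].
    replace (/ (2 * eta) * eta) with (/ 2) by (field; lra). lra. }
  set (lambda := ln (1 + del) / (4 * INR n)).
  assert (Hln : 0 < ln (1 + del)) by (rewrite <- ln_1; apply ln_increasing; lra).
  assert (Hlam : 0 < lambda) by (apply Rdiv_lt_0_compat; lra).
  assert (Hexp : exp (4 * INR n * lambda) = 1 + del).
  { unfold lambda. replace (4 * INR n * (ln (1 + del) / (4 * INR n))) with (ln (1 + del)) by (field; lra).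
    apply exp_ln; lra. }
  destruct (exists_supersolution (exp lambda)) as [Phi [a0 [HPhi [Ha0 Hsup]]]].
  { rewrite <- exp_0. apply exp_increasing; auto. }
  exists n, lambda, a0, Phi, (h ++ k).
  do 4 (split; [auto|]). split; [apply Forall_app; split; [apply Hh|apply Hk]|].
  intros l Hl Hinc.
  destruct (Hsup l Hl) as [phi [H1 [H2 [H3 H4]]]].
  assert (H4' : forall a m x, Rabs a <= a0 -> 0 <= x <= 1 ->
    RL l m a phi x <= exp (INR m * lambda) * phi x).
  { intros a m x Ha Hx. rewrite (Rmult_comm (INR m)), exp_pow_INR. apply H4; auto. }
  exists phi. do 4 (split; [auto|]).
  intros s t v Hs Ha Ht4 HtD Hv j. induction j as [|j IH].
  - exists (fun _ => 1). split; [intros; lra|]. split.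
    + apply (cone_ext _ (fun _ => 1) _ v); auto. intros x; symmetry; apply CL_0.
    + simpl. rewrite Rmult_0_r, Rmult_0_l, Ropp_0, exp_0.
      assert (Hd : loglip (2 * 0 + cdist) (density (fun _ => 1) phi)).
      { apply density_loglip; auto; [apply loglip_const; lra|]. intros x; specialize (H1 x); lra. }
      apply Rle_trans with ((1 - 0) * 1); [rewrite <- RInt_const_R | lra].
      apply RInt_le; [lra|apply (ex_RInt_loglip (2 * 0 + cdist)); auto; lra|apply ex_RInt_const|].
      intros x _. unfold density. specialize (H1 x).
      rewrite Rmult_1_l, Rmult_1_l, <- Rinv_1. apply Rinv_le_contravar; lra.
  - destruct IH as [u [Hu [Hcu HE]]].
    destruct (block_step n h k Hn Hh Hk Hpsi s t u _ Hs Ht4 HtD Hcu Hu l phi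
      (exp (INR n * lambda)) m0) as [u' [Hu' [Hcu' HE']]]; auto.
    + intros a Ha'. apply Hinc, in_or_app; auto.
    + intros a Ha'. apply Hinc, in_or_app; auto.
    + intros x Hx. split; eapply Rle_trans; try apply Hm0le.
      * eapply Rle_trans; [apply Rmin_l|]. apply Hmh'; auto.
      * eapply Rle_trans; [apply Rmin_r|]. apply Hmk'; auto.
    + rewrite Heta0. eapply Rle_trans; [apply Heta2|]. apply exp_ge_1.
      apply Rmult_le_pos; lra.
    + exists u'. split; auto. split.
      * apply (cone_ext _ u' _ (CL l n s t (CL l (j * n) s t v))); auto.
        intros x. simpl. rewrite Nat.add_comm. symmetry. apply CL_add.
      * eapply Rle_trans; [apply HE'|].
        assert (Hk1 : exp (INR n * lambda) <= 1 + del).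
        { rewrite <- Hexp. apply exp_le. apply Rmult_le_compat_r; lra. }
        assert (Hf : exp (INR n * lambda) - m0 * exp (- cdist) * gap_fraction / 2 <=
          exp (- (4 * INR n * lambda))).
        { rewrite Heta0, exp_Ropp, Hexp.
          apply Rmult_le_reg_l with (1 + del); [lra|]. rewrite Rinv_r by lra.
          apply Rle_trans with ((1 + del) * (1 - del)); [apply Rmult_le_compat_l; lra|nra]. }
        assert (HE0 : 0 <= RInt (density u phi) 0 1).
        { apply RInt_ge_0; [lra| |].
          - assert (0 <= aperture * Rabs t) by (pose proof aperture_ge_1; nra).
            apply (ex_RInt_loglip (2 * (aperture * Rabs t) + cdist)); [lra|].
            apply density_loglip; auto; [apply Hcu|]. intros x; specialize (H1 x); lra.
          - intros x _. unfold density. specialize (H1 x). apply Rmult_le_pos; [nra|].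
            left; apply Rinv_0_lt_compat; lra. }
        replace (INR (Datatypes.S j * n)) with (INR n + INR (j * n)) by (simpl; rewrite plus_INR; ring).
        replace (- (4 * (INR n + INR (j * n)) * lambda))
          with (- (4 * INR n * lambda) + - (4 * INR (j * n) * lambda)) by ring.
        rewrite exp_plus.
        eapply Rle_trans; [apply Rmult_le_compat_r; [auto|apply Hf]|].
        apply Rmult_le_compat_l; auto. left; apply exp_pos.
Qed.

(** * From the decay of integrals to uniform bounds *)

Definition out_exponent : R := 2 * cdist + aperture * C0.

(** The m iterations are split: about half of them form blocks and make the integral of u^2 / phi
    small; the m' others satisfy C0 rho^m' |t| <= C0, so that suprema are controlled by this
    integral. The bound X is fixed before the list l and the function v, as the passage to the limit
    demands. *)
Lemma truncated_estimate : exists Amin gamma eps l0,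
  0 < gamma < 1 /\ 0 < eps /\ List.Forall ok l0 /\
  forall s t, Rabs s < eps -> 4 <= Rabs t -> 2 * PI / D <= Rabs t ->
  forall m, Amin * ln (Rabs t) <= INR m ->
  exists X, 0 <= X /\ (1 + out_exponent) * X <= gamma ^ m /\
  forall l v, good l -> incl l0 l -> (forall x, Cmod (v x) <= 1) ->
    (forall x y, Cmod (v x - v y)%C <= Rabs t * Rabs (x - y)) ->
    forall x y, 0 <= x <= 1 -> Cmod (CL l m s t v x) <= X /\
      Cmod (CL l m s t v x - CL l m s t v y)%C <=
      (exp (out_exponent * Rabs t * Rabs (x - y)) - 1) * X.
Proof.
  destruct energy_decay as [n [lam [a0 [Phi [l0 [Hn1 [Hlam [Ha0 [HPhi [Hl0 Hdecay]]]]]]]]]].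
  pose proof cdist_nonneg as Hc. pose proof aperture_ge_1 as Hap.
  assert (HnR : 1 <= INR n) by (apply (le_INR 1); auto).
  set (om := - ln rho).
  assert (Hom : 0 < om) by (unfold om; pose proof (ln_increasing rho 1 ltac:(lra) ltac:(lra)) as H; rewrite ln_1 in H; lra).
  (* A bound for the exponent of L_0^m' (u^2 / phi) once C0 rho^m' |t| <= C0; X0 collects the
     factors that do not depend on m. *)
  set (c7 := cdist + (2 * aperture + cdist) * C0).
  set (X0 := exp (2 * lam * INR n) * exp (c7 / 2) * Phi).
  assert (HX0 : 0 < X0).
  { apply Rmult_lt_0_compat; [|lra]. apply Rmult_lt_0_compat; apply exp_pos. }
  set (bb := out_exponent).
  assert (Hbb : 0 <= bb) by (unfold bb, out_exponent; nra).
  set (c9 := (1 + bb) * X0).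
  assert (Hc9 : 0 < c9) by (apply Rmult_lt_0_compat; lra).
  (* The first summand gives rho^m' <= 1/|t| for m' >= m/2. The second, with ln |t| >= 1, gives c9
     <= lam m / 4, so half of the decay exp (- lam m / 2) absorbs the constant c9. *)
  exists (2 / om + 4 * c9 / lam), (exp (- (lam / 4))), (Rmin 1 (a0 / 2)), l0.
  split; [split; [apply exp_pos|rewrite <- exp_0; apply exp_increasing; lra]|].
  split; [apply Rmin_glb_lt; lra|]. split; [exact Hl0|].
  intros s t Hs Ht4 HtD m Hm.
  assert (Hs1 : Rabs s <= 1) by (left; eapply Rlt_le_trans; [apply Hs|apply Rmin_l]).
  assert (Hs2 : Rabs (2 * s) <= a0).
  { rewrite Rabs_mult, (Rabs_pos_eq 2) by lra.
    assert (Rabs s < a0 / 2) by (eapply Rlt_le_trans; [apply Hs|apply Rmin_r]). lra. }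
  assert (Hlnt : 1 <= ln (Rabs t)).
  { rewrite <- (ln_exp 1). apply ln_le; [apply exp_pos|]. pose proof exp_le_3. lra. }
  assert (Hm1 : 2 / om * ln (Rabs t) <= INR m).
  { eapply Rle_trans; [|apply Hm]. apply Rmult_le_compat_r; [lra|].
    assert (0 < 4 * c9 / lam) by (apply Rdiv_lt_0_compat; lra). lra. }
  assert (Hm2 : 4 * c9 / lam <= INR m).
  { eapply Rle_trans; [|apply Hm].
    assert (0 < 4 * c9 / lam) by (apply Rdiv_lt_0_compat; lra).
    assert (0 < 2 / om) by (apply Rdiv_lt_0_compat; lra). nra. }
  exists (X0 * exp (- (lam / 2 * INR m))).
  split; [apply Rmult_le_pos; [lra|left; apply exp_pos]|]. split.
  { rewrite <- exp_pow_INR. rewrite <- Rmult_assoc. fold c9.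
    replace (- (lam / 4) * INR m) with (lam / 4 * INR m + - (lam / 2 * INR m)) by field.
    rewrite exp_plus. apply Rmult_le_compat_r; [left; apply exp_pos|].
    apply Rle_trans with (exp c9); [pose proof (exp_ineq1_le c9); lra|].
    apply exp_le. apply Rmult_le_reg_l with (4 / lam); [apply Rdiv_lt_0_compat; lra|].
    replace (4 / lam * (lam / 4 * INR m)) with (INR m) by (field; lra).
    eapply Rle_trans; [|apply Hm2]. right; field; lra. }
  intros l v Hl Hinc Hv1 Hv2.
  destruct (Hdecay l Hl Hinc) as [phi [H1 [H2 [H3 [H4 H5]]]]].
  assert (Hv : cone (aperture * Rabs t) (fun _ => 1) v).
  { split; [apply loglip_const; nra|]. intros x y. split; auto.
    rewrite Rmult_1_r. eapply Rle_trans; [apply Hv2|].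
    pose proof (exp_ineq1_le (aperture * Rabs t * Rabs (x - y))).
    pose proof (Rabs_pos (x - y)).
    assert (Rabs t * Rabs (x - y) <= aperture * Rabs t * Rabs (x - y)); [|lra].
    apply Rmult_le_compat_r; auto. nra. }
  (* Rounding down leaves m' >= m/2, and at most n iterations are missing from the half spent in
     blocks; they cause the factor exp (2 lam n) in X0. *)
  set (j := (m / (2 * n))%nat). set (m' := (m - j * n)%nat).
  assert (Hj : (2 * n * j <= m /\ m < 2 * n * j + 2 * n)%nat).
  { pose proof (Nat.div_mod m (2 * n) ltac:(lia)) as E.
    pose proof (Nat.mod_upper_bound m (2 * n) ltac:(lia)). unfold j.
    set (d := (m / (2 * n))%nat) in *. set (r := (m mod (2 * n))%nat) in *.
    split; nia. }
  assert (Em : m = (j * n + m')%nat) by (unfold m'; nia).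
  assert (Hm' : (m <= 2 * m')%nat) by nia.
  assert (Hjn : (m <= 2 * (j * n) + 2 * n)%nat) by nia.
  destruct (H5 s t v Hs1 Hs2 Ht4 HtD Hv j) as [u [Hu [Hcu HE]]].
  set (V := CL l (j * n) s t v) in *.
  set (q := C0 * rho ^ m').
  assert (Hq : q * Rabs t <= C0).
  { unfold q. rewrite Rmult_assoc. rewrite <- (Rmult_1_r C0) at 2. apply Rmult_le_compat_l; [lra|].
    replace (rho ^ m') with (exp (- (om * INR m'))).
    - replace (Rabs t) with (exp (ln (Rabs t))) by (apply exp_ln; lra).
      rewrite <- exp_plus, <- exp_0. apply exp_le.
      assert (ln (Rabs t) <= om * INR m'); [|lra].
      apply le_INR in Hm'. rewrite mult_INR in Hm'. simpl in Hm'.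
      apply Rmult_le_reg_l with (2 / om); [apply Rdiv_lt_0_compat; lra|].
      replace (2 / om * (om * INR m')) with (2 * INR m') by (field; lra). lra.
    - unfold om. replace (- (- ln rho * INR m')) with (ln rho * INR m') by ring.
      rewrite exp_pow_INR, exp_ln; lra. }
  assert (Hq0 : 0 <= q) by (pose proof (rho_pow_bounds m'); unfold q; nra).
  assert (Hphi0 : forall x, 0 < phi x) by (intros x; specialize (H1 x); lra).
  assert (Hat : 0 <= aperture * Rabs t) by (apply Rmult_le_pos; lra).
  (* As |t| >= 4 and |s| <= 1, the terms without t are absorbed by |t| cdist; the contribution of
     the input is at most aperture C0, by the choice of m'. *)
  assert (Hcone : cone (bb * Rabs t) (RL l m' s u) (CL l m' s t V)).
  { eapply cone_weaken; [|apply RL_CL_cone; [apply Hat|auto|apply Hcu]].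
    fold q. unfold bb, out_exponent.
    assert (Rabs s * cdist <= cdist) by nra.
    assert (2 * cdist <= Rabs t * cdist) by nra.
    assert (aperture * Rabs t * q <= aperture * C0 * Rabs t).
    { apply Rle_trans with (aperture * (q * Rabs t)); [right; ring|].
      apply Rle_trans with (aperture * C0); [apply Rmult_le_compat_l; lra|].
      assert (0 <= aperture * C0) by nra. nra. }
    nra. }
  assert (Hsup : forall x, 0 <= x <= 1 -> RL l m' s u x <= X0 * exp (- (lam / 2 * INR m))).
  { intros x Hx. apply Rsqr_incr_0_var.
    2: { apply Rmult_le_pos; [lra|left; apply exp_pos]. }
    pose proof (RL_sqr_le l m' s phi u x Hl Hphi0) as HS. unfold Rsqr.
    replace (RL l m' s u x ^ 2) with (RL l m' s u x * RL l m' s u x) in HS by ring.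
    eapply Rle_trans; [apply HS|].
    assert (S1 : RL l m' (2 * s) phi x <= exp (INR m * lam) * Phi).
    { eapply Rle_trans; [apply H4; auto|]. apply Rmult_le_compat; auto.
      - left; apply exp_pos.
      - specialize (H1 x); lra.
      - apply exp_le. apply Rmult_le_compat_r; [lra|]. apply le_INR. lia. }
    assert (S2 : RL l m' 0 (density u phi) x <= exp c7 * exp (- (4 * INR (j * n) * lam))).
    { eapply Rle_trans.
      - apply (RL_le_RInt l m' (2 * (aperture * Rabs t) + cdist)); auto; [lra|].
        apply density_loglip; auto. apply Hcu.
      - apply Rmult_le_compat.
        + left; apply exp_pos.
        + apply RInt_ge_0; [lra| |].
          * apply (ex_RInt_loglip (2 * (aperture * Rabs t) + cdist)); [lra|].
            apply density_loglip; auto. apply Hcu.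
          * intros y _. unfold density. specialize (Hu y). apply Rmult_le_pos; [nra|].
            left; apply Rinv_0_lt_compat; auto.
        + fold q. apply exp_le. unfold c7. apply Rplus_le_compat_l.
          replace ((2 * (aperture * Rabs t) + cdist) * q)
            with (2 * aperture * (q * Rabs t) + cdist * q) by ring.
          assert (q <= q * Rabs t) by nra.
          assert (2 * aperture * (q * Rabs t) <= 2 * aperture * C0) by (apply Rmult_le_compat_l; lra).
          assert (cdist * q <= cdist * C0) by (apply Rmult_le_compat_l; lra).
          lra.
        + exact HE. }
    apply Rle_trans with (exp (INR m * lam) * Phi * (exp c7 * exp (- (4 * INR (j * n) * lam)))).
    { apply Rmult_le_compat; auto.
      - apply RL_nonneg; auto. intros y; specialize (Hphi0 y); lra.
      - apply RL_nonneg; auto. intros y. unfold density. specialize (Hu y).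
        apply Rmult_le_pos; [nra|]. left; apply Rinv_0_lt_compat; auto. }
    unfold X0.
    replace (exp (2 * lam * INR n) * exp (c7 / 2) * Phi * exp (- (lam / 2 * INR m)) *
      (exp (2 * lam * INR n) * exp (c7 / 2) * Phi * exp (- (lam / 2 * INR m))))
      with ((exp (2 * lam * INR n) * exp (2 * lam * INR n)) *
            (exp (- (lam / 2 * INR m)) * exp (- (lam / 2 * INR m))) *
            (exp (c7 / 2) * exp (c7 / 2)) * (Phi * Phi)) by ring.
    rewrite <- !exp_plus.
    replace (exp (INR m * lam) * Phi * exp (c7 + - (4 * INR (j * n) * lam)))
      with (exp (INR m * lam) * exp (c7 + - (4 * INR (j * n) * lam)) * (Phi * 1)) by ring.
    rewrite <- exp_plus.
    apply Rmult_le_compat; try nra.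
    + left; apply exp_pos.
    + apply exp_le. apply le_INR in Hjn. rewrite plus_INR, !mult_INR in Hjn. simpl in Hjn.
      rewrite mult_INR. nra. }
  assert (HV : forall x, CL l m s t v x = CL l m' s t V x)
    by (intros x; rewrite Em; apply CL_add).
  intros x y Hx. rewrite !HV. destruct Hcone as [Hco1 Hco2]. destruct (Hco2 x y) as [D1 D2].
  specialize (Hsup x Hx). split; [lra|].
  eapply Rle_trans; [apply D2|]. apply Rmult_le_compat_l; auto.
  assert (1 <= exp (bb * Rabs t * Rabs (x - y))); [|lra].
  apply exp_ge_1. apply Rmult_le_pos; [apply Rmult_le_pos; lra|apply Rabs_pos].
Qed.

End Words.

(** * Functions on the unit interval *)

(** A 1-Lipschitz retraction onto I. Composing with it extends functions on I to the line, where the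
    cone conditions are stated. *)
Definition clamp (x : R) : R := Rmax 0 (Rmin x 1).

Lemma clamp_bounds x : 0 <= clamp x <= 1.
Proof.
  unfold clamp. split; [apply Rmax_l|]. apply Rmax_lub; [lra|apply Rmin_r].
Qed.

Lemma clamp_id x : 0 <= x <= 1 -> clamp x = x.
Proof. intros H. unfold clamp. rewrite Rmin_left, Rmax_right; lra. Qed.

Lemma clamp_lip x y : Rabs (clamp x - clamp y) <= Rabs (x - y).
Proof.
  unfold clamp, Rmax, Rmin.
  repeat destruct Rle_dec; unfold Rabs; repeat destruct Rcase_abs; lra.
Qed.

Lemma clamp_continuous x : continuous clamp x.
Proof.
  apply continuity_pt_filterlim. intros e He. exists e. split; auto.
  intros y [_ Hy]. simpl in *. unfold R_dist in *.
  eapply Rle_lt_trans; [apply clamp_lip|auto].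
Qed.

Lemma continuous_on_clamp {V : UniformSpace} (f : R -> V) x :
  continuous_on I f -> continuous (fun y => f (clamp y)) x.
Proof.
  intros H. unfold continuous.
  apply filterlim_comp with (G := within I (locally (clamp x))); [|apply H, clamp_bounds].
  intros P HP. unfold within, filtermap in *.
  apply (filter_imp (fun y => I (clamp y) -> P (clamp y))).
  - intros y Hy. apply Hy, clamp_bounds.
  - apply (clamp_continuous x (fun z => I z -> P z)), HP.
Qed.

Lemma locally_Iopen x : Iopen x -> locally x Iopen.
Proof.
  intros H. apply (locally_interval _ x 0 1); simpl; try apply H.
  intros y H0 H1. split; auto.
Qed.

Lemma Iopen_I x : Iopen x -> I x.
Proof. unfold Iopen, I. lra. Qed.

Lemma is_derive_I_Iopen {V : NormedModule R_AbsRing} (f : R -> V) x l :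
  Iopen x -> is_derive_I f x l -> is_derive f x l.
Proof.
  intros Hx [Hl H]. split; auto.
  intros y Hy. apply (is_filter_lim_locally_unique (V := AbsRing_NormedModule R_AbsRing)) in Hy. subst y.
  assert (Hle : filter_le (locally x) (within I (locally x))).
  { intros P HP. unfold within in HP.
    apply (filter_imp (fun y => (I y -> P y) /\ Iopen y)).
    - intros y [H1 H2]. apply H1, Iopen_I; auto.
    - apply filter_and; [exact HP|apply locally_Iopen; auto]. }
  specialize (H x).
  assert (Hlim : is_filter_lim (within I (locally x)) x).
  { intros P HP. unfold within. revert HP. apply filter_imp. auto. }
  intros e. apply Hle, (H Hlim e).
Qed.

Lemma C1_I_continuous_on {V : NormedModule R_AbsRing} (f : R -> V) :
  C1_I f -> continuous_on I f.
Proof.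
  intros [df [_ Hf]] x Hx.
  apply (filterdiff_continuous_aux (K := R_AbsRing) (U := AbsRing_NormedModule R_AbsRing)
    (F := within I (locally x)) f).
  - eexists. apply Hf; auto.
  - intros P HP. unfold within. revert HP. apply filter_imp. auto.
Qed.

(* The clamped function may have corners at 0 and 1, where df is irrelevant. *)
Lemma MVT_clamp (f df : R -> R) x y :
  (forall z, continuous f z) -> (forall z, Iopen z -> is_derive f z (df z)) ->
  0 <= x <= 1 -> 0 <= y <= 1 -> x <> y ->
  exists z, Iopen z /\ f y - f x = df z * (y - x).
Proof.
  assert (Hlt : forall x y, (forall z, continuous f z) ->
    (forall z, Iopen z -> is_derive f z (df z)) -> 0 <= x -> y <= 1 -> x < y ->
    exists z, Iopen z /\ f y - f x = df z * (y - x)).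
  { clear. intros x y Hc Hd Hx Hy Hxy.
    assert (pr : forall z, x < z < y -> derivable_pt f z).
    { intros z Hz. exists (df z). apply is_derive_Reals, Hd. unfold Iopen; lra. }
    destruct (MVT f id x y pr (fun z _ => derivable_pt_id z) Hxy) as [z [Hz E]].
    - intros z _. apply continuity_pt_filterlim, Hc.
    - intros z _. apply derivable_continuous_pt, derivable_pt_id.
    - assert (Hz' : Iopen z) by (unfold Iopen; lra).
      exists z. split; auto. rewrite derive_pt_id in E. unfold id in E.
      assert (Ed : derive_pt f z (pr z Hz) = df z).
      { apply derive_pt_eq_0. apply is_derive_Reals, Hd; auto. }
      rewrite Ed in E. lra. }
  intros Hc Hd Hx Hy Hxy. destruct (Rlt_or_le x y) as [H|H].
  - apply Hlt; auto; lra.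
  - destruct (Hlt y x Hc Hd) as [z [Hz E]]; try lra.
    exists z. split; auto. lra.
Qed.

Lemma lip_of_derive_bound (f df : R -> R) B :
  (forall z, continuous f z) -> (forall z, Iopen z -> is_derive f z (df z)) ->
  (forall z, Iopen z -> Rabs (df z) <= B) ->
  forall x y, 0 <= x <= 1 -> 0 <= y <= 1 -> Rabs (f x - f y) <= B * Rabs (x - y).
Proof.
  intros Hc Hd HB x y Hx Hy. destruct (Req_dec x y) as [<-|Hxy].
  - rewrite !Rminus_diag, Rabs_R0. lra.
  - destruct (MVT_clamp f df y x Hc Hd Hy Hx) as [z [Hz E]]; auto.
    rewrite E, Rabs_mult. apply Rmult_le_compat_r; [apply Rabs_pos|auto].
Qed.

(** If the value m were attained at an interior point, the value min (f 0, f 1) > m would be taken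
    on both sides of it, against injectivity. *)
Lemma injective_gt_min (f : R -> R) m :
  (forall z, continuous f z) ->
  (forall x y, 0 <= x <= 1 -> 0 <= y <= 1 -> f x = f y -> x = y) ->
  (forall x, 0 <= x <= 1 -> m <= f x) ->
  forall x, 0 < x < 1 -> m < f x.
Proof.
  intros Hc Hinj Hm x Hx. destruct (Hm x ltac:(lra)) as [H|H]; auto. exfalso.
  assert (Hcont : continuity f) by (intros z; apply continuity_pt_filterlim, Hc).
  assert (H0 : m < f 0).
  { destruct (Hm 0 ltac:(lra)) as [H0|H0]; auto.
    assert (x = 0) by (apply Hinj; lra). lra. }
  assert (H1 : m < f 1).
  { destruct (Hm 1 ltac:(lra)) as [H1|H1]; auto.
    assert (x = 1) by (apply Hinj; lra). lra. }
  set (c := Rmin (f 0) (f 1)).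
  assert (Hcm : m < c) by (apply Rmin_glb_lt; auto).
  destruct (IVT_gen f 0 x c Hcont) as [y [Hy Ey]].
  { rewrite Rmin_right, Rmax_left by lra. split; [lra|apply Rmin_l]. }
  destruct (IVT_gen f x 1 c Hcont) as [z [Hz Ez]].
  { rewrite Rmin_left, Rmax_right by lra. split; [lra|apply Rmin_r]. }
  rewrite Rmin_left, Rmax_right in Hy, Hz by lra.
  assert (y = z) by (apply Hinj; lra). assert (E : y = x) by lra. rewrite E in Ey. lra.
Qed.

(** * Dominated series *)

Lemma Series_head_tail (a : nat -> R) N :
  ex_series a ->
  Series a = lsum a (seq 0 N) + Series (fun k => a (N + k)%nat).
Proof.
  intros H. induction N as [|N IH].
  - simpl. rewrite Rplus_0_l. reflexivity.
  - rewrite seq_S, lsum_app, IH. simpl. rewrite Rplus_0_r, Rplus_assoc. f_equal.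
    rewrite Series_incr_1.
    + rewrite Nat.add_0_r. f_equal. apply Series_ext. intros k. f_equal. lia.
    + apply (ex_series_incr_n a N); auto.
Qed.

Lemma Series_tail_le (a m : nat -> R) N :
  (forall j, Rabs (a j) <= m j) -> ex_series m ->
  Rabs (Series a - lsum a (seq 0 N)) <= Series m - lsum m (seq 0 N).
Proof.
  intros Ha Hm.
  assert (Hab : ex_series (fun j => Rabs (a j))).
  { apply (ex_series_le (K := R_AbsRing) (V := R_CompleteNormedModule)) with m; auto.
    intros j. change (norm (Rabs (a j))) with (Rabs (Rabs (a j))). rewrite Rabs_Rabsolu. auto. }
  rewrite (Series_head_tail a N), (Series_head_tail m N); auto using ex_series_Rabs.
  replace (lsum a (seq 0 N) + _ - _) with (Series (fun k => a (N + k)%nat)) by ring.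
  replace (lsum m (seq 0 N) + _ - _) with (Series (fun k => m (N + k)%nat)) by ring.
  eapply Rle_trans.
  - apply Series_Rabs. apply (ex_series_incr_n (fun j => Rabs (a j)) N); auto.
  - apply Series_le.
    + intros k. split; [apply Rabs_pos|auto].
    + apply (ex_series_incr_n m N); auto.
Qed.

Lemma ex_series_dominated (a m : nat -> R) :
  (forall j, Rabs (a j) <= m j) -> ex_series m -> ex_series a.
Proof. intros Ha Hm. apply (ex_series_le a m); auto. Qed.

Lemma ex_series_scal_R c (a : nat -> R) : ex_series a -> ex_series (fun j => c * a j).
Proof. apply (ex_series_scal_l (K := R_AbsRing) c a). Qed.

Lemma lsum_seq_le_Series (m : nat -> R) N :
  (forall j, 0 <= m j) -> ex_series m -> lsum m (seq 0 N) <= Series m.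
Proof.
  intros H0 Hm. assert (Ha : forall j, Rabs (m j) <= m j) by (intros; rewrite Rabs_pos_eq; auto; lra).
  pose proof (Series_tail_le m m N Ha Hm) as H. pose proof (Rabs_pos (Series m - lsum m (seq 0 N))). lra.
Qed.

Lemma Series_tail_small (m : nat -> R) e :
  (forall j, 0 <= m j) -> ex_series m -> 0 < e ->
  exists N0, forall N, (N0 <= N)%nat -> Series m - lsum m (seq 0 N) <= e.
Proof.
  intros H0 Hm He. assert (H : is_lim_seq (sum_n m) (Series m)) by exact (Series_correct m Hm).
  apply is_lim_seq_spec in H. specialize (H (mkposreal e He)). destruct H as [N0 H].
  (* [sum_n m N] has N + 1 terms, hence the shift. *)
  exists (Datatypes.S N0). intros N HN. destruct N as [|N]; [lia|].
  specialize (H N ltac:(lia)). simpl in H. apply Rabs_lt_between in H.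
  assert (E : sum_n m N = lsum m (seq 0 (Datatypes.S N))).
  { clear. induction N as [|N IH].
    - rewrite sum_O. simpl. ring.
    - rewrite sum_Sn, IH, (seq_S (Datatypes.S N)), lsum_app. unfold plus; simpl. ring. }
  rewrite E in H. lra.
Qed.

Lemma lsum_le_of_incl (m : nat -> R) l L :
  (forall j, 0 <= m j) -> NoDup l -> incl l L -> lsum m l <= lsum m L.
Proof.
  intros H0 Hl. revert L. induction Hl as [|j l Hj Hl IH]; intros L HL.
  - apply lsum_nonneg; auto.
  - assert (Hin : In j L) by (apply HL; simpl; auto).
    apply in_split in Hin. destruct Hin as [L1 [L2 ->]].
    rewrite (lsum_perm m (L1 ++ j :: L2) (j :: L1 ++ L2))
      by (apply Permutation_sym, Permutation_middle).
    simpl. apply Rplus_le_compat_l, IH. intros i Hi.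
    assert (H : In i (L1 ++ j :: L2)) by (apply HL; simpl; auto).
    apply in_app_or in H. apply in_or_app. destruct H as [H|[H|H]]; auto. congruence.
Qed.

Lemma lsum_le_Series (m : nat -> R) l :
  (forall j, 0 <= m j) -> ex_series m -> NoDup l -> lsum m l <= Series m.
Proof.
  intros H0 Hm Hl.
  apply Rle_trans with (lsum m (seq 0 (Datatypes.S (list_max l)))).
  - apply lsum_le_of_incl; auto. intros j Hj. apply in_seq. split; [lia|].
    pose proof (proj1 (list_max_le l (list_max l)) (Nat.le_refl _)) as H.
    rewrite List.Forall_forall in H. specialize (H j Hj). lia.
  - apply lsum_seq_le_Series; auto.
Qed.

Lemma is_derive_lsum {X} (u : X -> R -> R) (du : X -> R) x l :
  (forall j, In j l -> is_derive (u j) x (du j)) ->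
  is_derive (fun y => lsum (fun j => u j y) l) x (lsum du l).
Proof.
  induction l as [|j l IH]; intros H; simpl.
  - apply (is_derive_const (V := R_NormedModule) 0 x).
  - apply (is_derive_plus (V := R_NormedModule) (u j)); [apply H; simpl; auto|].
    apply IH. intros i Hi; apply H; simpl; auto.
Qed.

(** The bounds m_j control both the difference quotients at x and, in the limit, the derivatives at
    x. So the tail of the difference quotient minus its limit is at most twice a tail of m, and the
    finite head is differentiated term by term. *)
Lemma ex_derive_Series (u : nat -> R -> R) (m : nat -> R) x :
  ex_series m -> (forall j, 0 <= m j) ->
  (forall j, ex_derive (u j) x) ->
  locally x (fun y => ex_series (fun j => u j y) /\
    forall j, Rabs (u j y - u j x) <= m j * Rabs (y - x)) ->
  ex_derive (fun y => Series (fun j => u j y)) x.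
Proof.
  intros Hm Hm0 Hd Hloc.
  set (du := fun j => Derive (u j) x).
  assert (Hdu : forall j, is_derive (u j) x (du j)) by (intros; apply Derive_correct; auto).
  assert (Hx : ex_series (fun j => u j x)) by (apply locally_singleton in Hloc; apply Hloc).
  assert (Hdm : forall j, Rabs (du j) <= m j).
  { intros j. apply le_epsilon. intros e He.
    destruct (Hdu j) as [_ H]. specialize (H x (fun P HP => HP) (mkposreal e He)).
    destruct Hloc as [d1 H1]. destruct H as [d2 H2].
    set (d := Rmin d1 d2 / 2). pose proof (cond_pos d1); pose proof (cond_pos d2).
    assert (Hdd : 0 < d) by (unfold d; assert (0 < Rmin d1 d2) by (apply Rmin_glb_lt; auto); lra).
    assert (Hd1 : d < d1) by (unfold d; pose proof (Rmin_l d1 d2); lra).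
    assert (Hd2 : d < d2) by (unfold d; pose proof (Rmin_r d1 d2); lra).
    assert (B1 : ball x d1 (x + d)).
    { change (Rabs (x + d - x) < d1). rewrite Rabs_pos_eq; lra. }
    assert (B2 : ball x d2 (x + d)).
    { change (Rabs (x + d - x) < d2). rewrite Rabs_pos_eq; lra. }
    specialize (H2 _ B2). destruct (H1 _ B1) as [_ H1'].
    specialize (H1' j).
    change (Rabs (u j (x + d) - u j x - (x + d - x) * du j) <= e * Rabs (x + d - x)) in H2.
    replace (x + d - x) with d in * by ring. rewrite (Rabs_pos_eq d) in H2, H1' by lra.
    apply Rmult_le_reg_r with d; auto.
    rewrite <- (Rabs_pos_eq d) at 1 by lra. rewrite <- Rabs_mult.
    replace (du j * d) with ((u j (x + d) - u j x) + - (u j (x + d) - u j x - d * du j)) by ring.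
    eapply Rle_trans; [apply Rabs_triang|]. rewrite Rabs_Ropp. lra. }
  assert (Hds : ex_series du) by (apply (ex_series_dominated du m); auto).
  exists (Series du). split; [apply is_linear_scal_l|].
  intros z Hz. apply (is_filter_lim_locally_unique (V := AbsRing_NormedModule R_AbsRing)) in Hz. subst z. intros e.
  destruct (Series_tail_small m (e / 4) Hm0 Hm) as [N HN].
  { pose proof (cond_pos e). lra. }
  specialize (HN N (Nat.le_refl N)).
  destruct (is_derive_lsum u du x (seq 0 N) (fun j _ => Hdu j)) as [_ Hfin].
  specialize (Hfin x (fun P HP => HP) (mkposreal (e / 2) ltac:(pose proof (cond_pos e); lra))).
  generalize (filter_and _ _ Hloc Hfin). apply filter_imp. intros y [[Hy1 Hy2] Hy3].
  change (Rabs (lsum (fun j => u j y) (seq 0 N) - lsum (fun j => u j x) (seq 0 N) -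
    (y - x) * lsum du (seq 0 N)) <= e / 2 * Rabs (y - x)) in Hy3.
  change (Rabs (Series (fun j => u j y) - Series (fun j => u j x) - (y - x) * Series du)
    <= e * Rabs (y - x)).
  set (a := fun j => u j y - u j x - (y - x) * du j).
  assert (Ea : forall l, lsum (fun j => u j y) l - lsum (fun j => u j x) l -
    (y - x) * lsum du l = lsum a l).
  { intros l. unfold a. induction l as [|j l IH]; simpl; [ring|]. lra. }
  rewrite Ea in Hy3.
  rewrite <- Series_minus, <- Series_scal_l, <- Series_minus; auto.
  2: apply (ex_series_minus (fun j => u j y) (fun j => u j x)); auto.
  2: apply ex_series_scal_R; auto.
  assert (Hab : forall j, Rabs (a j) <= 2 * Rabs (y - x) * m j).
  { intros j. unfold a. eapply Rle_trans; [apply Rabs_triang|]. rewrite Rabs_Ropp, Rabs_mult.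
    specialize (Hy2 j). specialize (Hdm j). pose proof (Rabs_pos (y - x)).
    assert (Rabs (y - x) * Rabs (du j) <= Rabs (y - x) * m j) by (apply Rmult_le_compat_l; auto).
    lra. }
  assert (Hms : ex_series (fun j => 2 * Rabs (y - x) * m j))
    by (apply ex_series_scal_R; auto).
  pose proof (Series_tail_le a _ N Hab Hms) as HT.
  rewrite Series_scal_l, lsum_scal in HT.
  change (Rabs (Series a) <= e * Rabs (y - x)).
  replace (Series a) with ((Series a - lsum a (seq 0 N)) + lsum a (seq 0 N)) by ring.
  eapply Rle_trans; [apply Rabs_triang|].
  pose proof (Rabs_pos (y - x)).
  assert (2 * Rabs (y - x) * (Series m - lsum m (seq 0 N)) <= 2 * Rabs (y - x) * (e / 4))
    by (apply Rmult_le_compat_l; lra).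
  lra.
Qed.

(** * Integrals over disjoint intervals *)

(** The strict inequalities give disjoint supports even to adjacent intervals, so at each point at
    most one summand is nonzero. *)
Definition cut (a b : R) (f : R -> R) (x : R) : R :=
  if Rlt_dec a x then if Rlt_dec x b then f x else 0 else 0.

Lemma is_RInt_zero a b : is_RInt (fun _ : R => 0) a b 0.
Proof.
  pose proof (is_RInt_const (V := R_NormedModule) a b 0) as H.
  unfold scal in H; simpl in H; unfold mult in H; simpl in H.
  rewrite Rmult_0_r in H. exact H.
Qed.

Lemma is_RInt_cut (f : R -> R) a b : (forall x : R, continuous f x) -> 0 <= a -> a <= b -> b <= 1 ->
  is_RInt (cut a b f) 0 1 (RInt f a b).
Proof.
  intros Hf Ha Hab Hb.
  replace (RInt f a b) with (plus (plus (0 : R) (RInt f a b)) (0 : R))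
    by (unfold plus; simpl; ring).
  apply (is_RInt_Chasles (V := R_NormedModule)) with b.
  - apply (is_RInt_Chasles (V := R_NormedModule)) with a.
    + apply (is_RInt_ext (fun _ => 0)).
      * rewrite Rmin_left, Rmax_right by lra. intros x Hx. unfold cut.
        destruct (Rlt_dec a x); [lra|reflexivity].
      * apply is_RInt_zero.
    + apply (is_RInt_ext f).
      * rewrite Rmin_left, Rmax_right by lra. intros x Hx. unfold cut.
        destruct (Rlt_dec a x); [|lra]. destruct (Rlt_dec x b); [reflexivity|lra].
      * apply (RInt_correct (V := R_CompleteNormedModule)), ex_RInt_cont; auto.
  - apply (is_RInt_ext (fun _ => 0)).
    + rewrite Rmin_left, Rmax_right by lra. intros x Hx. unfold cut.
      destruct (Rlt_dec a x); [|reflexivity]. destruct (Rlt_dec x b); [lra|reflexivity].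
    + apply is_RInt_zero.
Qed.

Lemma is_RInt_lsum {X} (F : X -> R -> R) (v : X -> R) a b l :
  (forall j, In j l -> is_RInt (F j) a b (v j)) ->
  is_RInt (fun x => lsum (fun j => F j x) l) a b (lsum v l).
Proof.
  induction l as [|j l IH]; intros H; simpl.
  - apply is_RInt_zero.
  - apply (is_RInt_plus (V := R_NormedModule) (F j)); [apply H; simpl; auto|].
    apply IH. intros i Hi; apply H; simpl; auto.
Qed.

Lemma lsum_RInt_disjoint_le (a b : nat -> R) (f : R -> R) l :
  NoDup l -> (forall j, In j l -> 0 <= a j < b j /\ b j <= 1) ->
  (forall i j, In i l -> In j l -> i <> j -> forall x, ~ (a i < x < b i /\ a j < x < b j)) ->
  (forall x : R, continuous f x) -> (forall x : R, 0 <= f x) ->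
  lsum (fun j => RInt f (a j) (b j)) l <= RInt f 0 1.
Proof.
  intros Hl Hab Hdis Hf Hf0.
  assert (H : is_RInt (fun x => lsum (fun j => cut (a j) (b j) f x) l) 0 1
    (lsum (fun j => RInt f (a j) (b j)) l)).
  { apply is_RInt_lsum. intros j Hj. destruct (Hab j Hj). apply is_RInt_cut; auto; lra. }
  rewrite <- (is_RInt_unique _ _ _ _ H).
  apply RInt_le; [lra|eexists; apply H|apply ex_RInt_cont; auto|].
  intros x _. clear H Hab.
  assert (Hcut0 : forall l', (forall j, In j l' -> ~ (a j < x < b j)) ->
    lsum (fun j => cut (a j) (b j) f x) l' = 0).
  { induction l' as [|j l' IH]; intros H; simpl; auto.
    rewrite IH by (intros i Hi; apply H; simpl; auto).
    specialize (H j (or_introl eq_refl)). unfold cut.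
    destruct (Rlt_dec (a j) x); [destruct (Rlt_dec x (b j)); [tauto|]|]; ring. }
  induction Hl as [|j l Hj Hl IH]; simpl; auto.
  unfold cut at 1.
  destruct (Rlt_dec (a j) x) as [H1|H1]; [destruct (Rlt_dec x (b j)) as [H2|H2]|].
  - rewrite Hcut0; [lra|]. intros i Hi Hx. apply (Hdis i j) with x; simpl; auto. congruence.
  - rewrite Rplus_0_l. apply IH. intros i i' Hi Hi'. apply Hdis; simpl; auto.
  - rewrite Rplus_0_l. apply IH. intros i i' Hi Hi'. apply Hdis; simpl; auto.
Qed.

(** * Complex-valued functions and norms *)

Lemma Cmod_le_abs (z : C) : Cmod z <= Rabs (fst z) + Rabs (snd z).
Proof.
  pose proof (Rabs_pos (fst z)). pose proof (Rabs_pos (snd z)).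
  apply Cmod_le_of_sqr; [lra|]. rewrite <- (pow2_abs (fst z)), <- (pow2_abs (snd z)). nra.
Qed.

Lemma abs_fst_le_Cmod (z : C) : Rabs (fst z) <= Cmod z.
Proof. eapply Rle_trans; [apply Rmax_l|apply Rmax_Cmod]. Qed.

Lemma abs_snd_le_Cmod (z : C) : Rabs (snd z) <= Cmod z.
Proof. eapply Rle_trans; [apply Rmax_r|apply Rmax_Cmod]. Qed.

Lemma fst_csum {X} (u : X -> C) l : fst (csum u l) = lsum (fun j => fst (u j)) l.
Proof. induction l as [|j l IH]; simpl; [auto|rewrite IH; auto]. Qed.

Lemma snd_csum {X} (u : X -> C) l : snd (csum u l) = lsum (fun j => snd (u j)) l.
Proof. induction l as [|j l IH]; simpl; [auto|rewrite IH; auto]. Qed.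

(** The factor 2 comes from treating real and imaginary parts separately. It is harmless: these
    bounds serve convergence and regularity, while the sharp estimates come from the truncated
    sums. *)
Lemma CSeries_tail_le (u : nat -> C) (m : nat -> R) N :
  (forall j, Cmod (u j) <= m j) -> ex_series m ->
  Cmod (CSeries u - csum u (seq 0 N))%C <= 2 * (Series m - lsum m (seq 0 N)).
Proof.
  intros Hu Hm. eapply Rle_trans; [apply Cmod_le_abs|].
  assert (H1 : Rabs (Series (fun j => fst (u j)) - lsum (fun j => fst (u j)) (seq 0 N)) <=
    Series m - lsum m (seq 0 N)).
  { apply Series_tail_le; auto. intros j. eapply Rle_trans; [apply abs_fst_le_Cmod|auto]. }
  assert (H2 : Rabs (Series (fun j => snd (u j)) - lsum (fun j => snd (u j)) (seq 0 N)) <=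
    Series m - lsum m (seq 0 N)).
  { apply Series_tail_le; auto. intros j. eapply Rle_trans; [apply abs_snd_le_Cmod|auto]. }
  rewrite <- fst_csum in H1. rewrite <- snd_csum in H2. unfold CSeries. simpl.
  unfold Rminus in H1, H2. unfold Re, Im. lra.
Qed.

Lemma CSeries_le (u : nat -> C) (m : nat -> R) :
  (forall j, Cmod (u j) <= m j) -> ex_series m -> Cmod (CSeries u) <= 2 * Series m.
Proof.
  intros Hu Hm. pose proof (CSeries_tail_le u m 0 Hu Hm) as H. simpl in H.
  rewrite Rminus_0_r in H. replace (CSeries u - RtoC 0)%C with (CSeries u) in H by ring. auto.
Qed.

Lemma CSeries_minus (u w : nat -> C) (m m' : nat -> R) :
  (forall j, Cmod (u j) <= m j) -> ex_series m ->
  (forall j, Cmod (w j) <= m' j) -> ex_series m' ->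
  (CSeries u - CSeries w)%C = CSeries (fun j => (u j - w j)%C).
Proof.
  intros Hu Hm Hw Hm'. unfold CSeries, Cminus, Cplus, Copp, Re, Im. simpl.
  f_equal; symmetry; apply Series_minus.
  - apply (ex_series_dominated _ m); auto. intros j; eapply Rle_trans; [apply abs_fst_le_Cmod|auto].
  - apply (ex_series_dominated _ m'); auto. intros j; eapply Rle_trans; [apply abs_fst_le_Cmod|auto].
  - apply (ex_series_dominated _ m); auto. intros j; eapply Rle_trans; [apply abs_snd_le_Cmod|auto].
  - apply (ex_series_dominated _ m'); auto. intros j; eapply Rle_trans; [apply abs_snd_le_Cmod|auto].
Qed.

Lemma is_derive_fst (f : R -> C_R_NormedModule) x (l : C) :
  is_derive f x l -> is_derive (fun y => fst (f y)) x (fst l).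
Proof.
  intros H.
  refine (filterdiff_comp' (V := C_R_NormedModule) (W := R_NormedModule) f
    (fun z : C_R_NormedModule => fst z) x _ (fun z : C_R_NormedModule => fst z) H _).
  apply filterdiff_linear, is_linear_fst.
Qed.

Lemma is_derive_snd (f : R -> C_R_NormedModule) x (l : C) :
  is_derive f x l -> is_derive (fun y => snd (f y)) x (snd l).
Proof.
  intros H.
  refine (filterdiff_comp' (V := C_R_NormedModule) (W := R_NormedModule) f
    (fun z : C_R_NormedModule => snd z) x _ (fun z : C_R_NormedModule => snd z) H _).
  apply filterdiff_linear, is_linear_snd.
Qed.

Lemma ex_derive_pair (f : R -> C_R_NormedModule) x :
  ex_derive (fun y => fst (f y)) x -> ex_derive (fun y => snd (f y)) x -> ex_derive f x.
Proof.
  intros [l1 H1] [l2 H2].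
  pose proof (is_derive_scal_l (V := C_R_NormedModule) _ _ _ ((1, 0) : C) H1) as D1.
  pose proof (is_derive_scal_l (V := C_R_NormedModule) _ _ _ ((0, 1) : C) H2) as D2.
  pose proof (is_derive_plus (V := C_R_NormedModule) _ _ _ _ _ D1 D2) as D.
  eexists. refine (is_derive_ext _ _ _ _ _ D).
  intros y. apply injective_projections; unfold scal, plus; simpl;
    unfold scal, plus, mult; simpl; unfold mult; simpl; ring.
Qed.

(** The mean value theorem fails for complex values, so it is applied to the real function Re (f
    conj z) with z = f x - f y, whose increment is exactly |z|^2. *)
Lemma lip_of_derive_bound_C (f : R -> C_R_NormedModule) B :
  0 <= B -> (forall z, continuous f z) ->
  (forall z, Iopen z -> exists l : C, is_derive f z l /\ Cmod l <= B) ->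
  forall x y, 0 <= x <= 1 -> 0 <= y <= 1 ->
  Cmod (f x - f y)%C <= B * Rabs (x - y).
Proof.
  intros HB Hc Hd x y Hx Hy. set (z := (f x - f y)%C).
  set (phi := fun w => fst z * fst (f w) + snd z * snd (f w)).
  assert (HB' : Rabs (phi x - phi y) <= Cmod z * B * Rabs (x - y)).
  { apply (lip_of_derive_bound phi (Derive phi)); auto.
    - intros w. apply (continuous_plus (fun w => fst z * fst (f w)) (fun w => snd z * snd (f w))).
      + apply (continuous_mult (fun _ => fst z) (fun w => fst (f w))); [apply continuous_const|].
        apply (continuous_comp f (fun c : R * R => fst c)); auto. apply continuous_fst.
      + apply (continuous_mult (fun _ => snd z) (fun w => snd (f w))); [apply continuous_const|].
        apply (continuous_comp f (fun c : R * R => snd c)); auto. apply continuous_snd.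
    - intros w Hw. apply Derive_correct. destruct (Hd w Hw) as [l [Hl _]].
      apply (ex_derive_plus (V := R_NormedModule)); apply ex_derive_scal; eexists;
        [apply is_derive_fst|apply is_derive_snd]; apply Hl.
    - intros w Hw. destruct (Hd w Hw) as [l [Hl HlB]].
      assert (E : Derive phi w = fst z * fst l + snd z * snd l).
      { apply is_derive_unique.
        apply (is_derive_plus (V := R_NormedModule) (fun w => fst z * fst (f w)));
          apply is_derive_scal; [apply is_derive_fst|apply is_derive_snd]; apply Hl. }
      rewrite E. apply Rle_trans with (Cmod z * Cmod l).
      + assert (El : fst z * fst l + snd z * snd l = fst (z * Cconj l)%C) by (simpl; ring).
        rewrite El. eapply Rle_trans; [apply abs_fst_le_Cmod|]. rewrite Cmod_mult, Cmod_conj. lra.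
      + apply Rmult_le_compat_l; auto. apply Cmod_ge_0. }
  assert (E : phi x - phi y = Cmod z ^ 2).
  { rewrite Cmod2_alt. unfold phi, Re, Im, z. simpl. ring. }
  rewrite E in HB'. pose proof (Cmod_ge_0 z) as [Hz|Hz].
  - rewrite Rabs_pos_eq in HB' by (apply pow_le; lra).
    apply Rmult_le_reg_l with (Cmod z); auto. lra.
  - rewrite <- Hz. apply Rmult_le_pos; auto. apply Rabs_pos.
Qed.

Lemma exp_le_linear c d : 0 <= c -> 0 <= d <= 1 -> exp (c * d) - 1 <= c * exp c * d.
Proof.
  intros Hc Hd. pose proof (exp_ineq1_le (- (c * d))) as H. rewrite exp_Ropp in H.
  pose proof (exp_pos (c * d)) as Hp.
  apply Rmult_le_compat_r with (r := exp (c * d)) in H; [|lra]. rewrite Rinv_l in H by lra.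
  assert (exp (c * d) <= exp c) by (apply exp_le; nra).
  assert (0 <= c * d) by nra.
  assert (c * d * exp (c * d) <= c * d * exp c) by (apply Rmult_le_compat_l; auto).
  lra.
Qed.

(** At distance d the bound is c X d up to a term of order d^2. Half of e is reserved for that term
    and half for the error in the definition of the derivative. *)
Lemma derive_bound_of_cone (F : R -> C_R_NormedModule) x (l : C) c X :
  0 <= c -> 0 <= X -> Iopen x -> is_derive F x l ->
  (forall y, Iopen y -> Cmod (F x - F y)%C <= (exp (c * Rabs (x - y)) - 1) * X) ->
  Cmod l <= c * X.
Proof.
  intros Hc HX Hx [_ Hl] HF. apply le_epsilon. intros e He.
  assert (He2 : 0 < e / 2) by lra.
  specialize (Hl x (fun P HP => HP) (mkposreal (e / 2) He2)).
  destruct (filter_and _ _ Hl (locally_Iopen x Hx)) as [d1 Hd1].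
  set (a := c * c * exp c * exp c * X + 1).
  assert (Ha : 1 <= a).
  { unfold a. pose proof (exp_pos c).
    assert (0 <= c * c * exp c * exp c * X); [|lra].
    repeat apply Rmult_le_pos; lra. }
  set (d := Rmin (d1 / 2) (Rmin 1 (e / (2 * a)))).
  pose proof (cond_pos d1) as Hd1p.
  assert (Hea : 0 < e / (2 * a)) by (apply Rdiv_lt_0_compat; lra).
  assert (Hd : 0 < d) by (unfold d; repeat apply Rmin_glb_lt; lra).
  assert (Hdd1 : d < d1) by (unfold d; pose proof (Rmin_l (d1 / 2) (Rmin 1 (e / (2 * a)))); lra).
  assert (Hdr : d <= Rmin 1 (e / (2 * a))) by apply Rmin_r.
  assert (Hdl : d <= 1) by (pose proof (Rmin_l 1 (e / (2 * a))); lra).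
  assert (Hde : d <= e / (2 * a)) by (pose proof (Rmin_r 1 (e / (2 * a))); lra).
  destruct (Hd1 (x + d)) as [H1 H2].
  { change (Rabs (x + d - x) < d1). rewrite Rabs_pos_eq; lra. }
  assert (H1' : Cmod ((F (x + d)%R - F x) - RtoC d * l)%C <= e / 2 * d).
  { assert (E : (RtoC d * l)%C = scal (minus (x + d)%R x) (l : C_R_NormedModule)).
    { apply injective_projections; unfold scal, minus, plus, opp; simpl;
        unfold scal, mult; simpl; unfold mult; simpl; ring. }
    rewrite E. replace (e / 2 * d) with (e / 2 * Rabs (x + d - x))
      by (rewrite Rabs_pos_eq; [ring|lra]).
    rewrite Cmod_norm. exact H1. }
  specialize (HF (x + d)%R H2).
  replace (x - (x + d)) with (- d) in HF by ring. rewrite Rabs_Ropp, (Rabs_pos_eq d) in HF by lra.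
  apply Rmult_le_reg_l with d; auto.
  replace (d * Cmod l) with (Cmod (RtoC d * l)%C)
    by (rewrite Cmod_mult, Cmod_R, Rabs_pos_eq; lra).
  replace (RtoC d * l)%C with (- ((F (x + d)%R - F x) - RtoC d * l) + - (F x - F (x + d)%R))%C by ring.
  eapply Rle_trans; [apply Cmod_triangle|]. rewrite !Cmod_opp.
  assert (HE : (exp (c * d) - 1) <= c * d + c * c * exp c * exp c * d * d).
  { pose proof (exp_le_linear c d Hc ltac:(lra)) as L1.
    pose proof (exp_ineq1_le (- (c * d))) as H. rewrite exp_Ropp in H.
    pose proof (exp_pos (c * d)) as Hp.
    apply Rmult_le_compat_r with (r := exp (c * d)) in H; [|lra]. rewrite Rinv_l in H by lra.
    pose proof (exp_ge_1 c Hc). assert (0 <= c * d) by nra.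
    assert (c * d * (exp (c * d) - 1) <= c * d * (c * exp c * d)) by (apply Rmult_le_compat_l; lra).
    assert (0 <= c * c * exp c * d * d) by (repeat apply Rmult_le_pos; lra).
    assert (c * c * exp c * d * d * 1 <= c * c * exp c * d * d * exp c)
      by (apply Rmult_le_compat_l; lra).
    lra. }
  assert (HE' : (exp (c * d) - 1) * X <= (c * d + c * c * exp c * exp c * d * d) * X)
    by (apply Rmult_le_compat_r; auto).
  assert (Hda : (a - 1) * d * d <= e / 2 * d).
  { apply Rmult_le_compat_r; [lra|]. apply Rle_trans with (a * d); [nra|].
    apply Rle_trans with (a * (e / (2 * a))); [apply Rmult_le_compat_l; lra|].
    right; field; lra. }
  unfold a in Hda. lra.
Qed.

Lemma Rbar_lub_le (E : Rbar -> Prop) b : (forall v, E v -> Rbar_le v b) -> Rbar_le (Rbar_lub E) b.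
Proof. intros H. unfold Rbar_lub. destruct (Rbar_ex_lub E) as [l [Hub Hl]]. apply Hl. exact H. Qed.

Lemma Rbar_lub_ge (E : Rbar -> Prop) v : E v -> Rbar_le v (Rbar_lub E).
Proof. intros H. unfold Rbar_lub. destruct (Rbar_ex_lub E) as [l [Hub Hl]]. apply Hub. exact H. Qed.

Lemma Rbar_div_finite_pos (b : Rbar) t : 0 < t ->
  Rbar_div b (Finite t) = match b with Finite y => Finite (y / t) | x => x end.
Proof.
  intros Ht. assert (Hi : 0 < / t) by (apply Rinv_0_lt_compat; auto).
  unfold Rbar_div, Rbar_inv. destruct b as [y| |]; auto; unfold Rbar_mult, Rbar_mult'.
  - destruct (Rle_dec 0 (/ t)) as [H|H]; [|lra].
    destruct (Rle_lt_or_eq_dec 0 (/ t) H); [auto|lra].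
  - destruct (Rle_dec 0 (/ t)) as [H|H]; [|lra].
    destruct (Rle_lt_or_eq_dec 0 (/ t) H); [auto|lra].
Qed.

Lemma norm1_le t (F : R -> C_R_NormedModule) X c :
  0 < Rabs t -> (forall x, I x -> Cmod (F x) <= X) ->
  (forall x, Iopen x -> ex_derive F x) ->
  (forall x l, Iopen x -> is_derive F x l -> Cmod l <= c * Rabs t * X) ->
  Rbar_le (norm1 t F) (Finite ((1 + c) * X)).
Proof.
  intros Ht H1 H2 H3. unfold norm1.
  replace (Finite ((1 + c) * X)) with (Rbar_plus (Finite X) (Finite (c * X)))
    by (simpl; f_equal; ring).
  apply Rbar_plus_le_compat.
  - apply Rbar_lub_le. intros v [x [Hx ->]]. simpl. auto.
  - rewrite Rbar_div_finite_pos by auto.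
    assert (H : Rbar_le (sup_mod_derive F) (Finite (c * Rabs t * X))).
    { apply Rbar_lub_le. intros v [x [Hx [[l [Hl ->]]|[Hn _]]]].
      - simpl. apply (H3 x l); auto.
      - destruct Hn. auto. }
    destruct (sup_mod_derive F) as [y| |]; simpl in *; auto.
    apply Rmult_le_reg_r with (Rabs t); auto. unfold Rdiv. rewrite Rmult_assoc, Rinv_l; lra.
Qed.

Lemma norm1_le_1 t (f : R -> C_R_NormedModule) :
  0 < Rabs t -> (forall x, Iopen x -> ex_derive f x) -> Rbar_le (norm1 t f) (Finite 1) ->
  (forall x, I x -> Cmod (f x) <= 1) /\
  (forall x l, Iopen x -> is_derive f x l -> Cmod l <= Rabs t).
Proof.
  intros Ht Hd H. unfold norm1 in H. rewrite Rbar_div_finite_pos in H by auto.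
  (* A sample point shows that neither supremum is minus infinity; the bound by 1 then excludes plus
     infinity as well. *)
  assert (Hh : Iopen (/ 2)) by (unfold Iopen; lra).
  assert (A1 : forall x, I x -> Rbar_le (Finite (Cmod (f x))) (sup_mod f)).
  { intros x Hx. apply Rbar_lub_ge. exists x; auto. }
  assert (A2 : forall x l, Iopen x -> is_derive f x l -> Rbar_le (Finite (Cmod l)) (sup_mod_derive f)).
  { intros x l Hx Hl. apply Rbar_lub_ge. exists x. split; auto. left. exists l; auto. }
  destruct (Hd _ Hh) as [l0 Hl0].
  pose proof (A1 _ (Iopen_I _ Hh)) as P1. pose proof (A2 _ _ Hh Hl0) as P2.
  destruct (sup_mod f) as [a| |]; destruct (sup_mod_derive f) as [b| |];
    simpl in H, P1, P2; try contradiction.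
  pose proof (Cmod_ge_0 (f (/ 2))). pose proof (Cmod_ge_0 l0).
  assert (Ha : 0 <= a) by lra. assert (Hb : 0 <= b) by lra.
  assert (Hbt : 0 <= b / Rabs t).
  { unfold Rdiv. apply Rmult_le_pos; auto. left; apply Rinv_0_lt_compat; auto. }
  split.
  - intros x Hx. specialize (A1 x Hx). simpl in A1. lra.
  - intros x l Hx Hl. specialize (A2 x l Hx Hl). simpl in A2.
    replace b with (b / Rabs t * Rabs t) in A2 by (field; lra).
    assert (b / Rabs t * Rabs t <= 1 * Rabs t) by (apply Rmult_le_compat_r; lra). lra.
Qed.

(** * Branches of the system *)

Section System.

Variables (S : system) (C0 rho K sigma0 : R).
Hypothesis Hpart : is_partition S.
Hypothesis Hbranch : piecewise_C2_full_branches S.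
Hypothesis Hexp : expanding S C0 rho.
Hypothesis Hren : renyi S K.
Hypothesis Hroof : roof_assumptions S K sigma0.

Definition active (j : nat) : Prop := idx S j = true.
Definition gS (j : nat) (x : R) : R := br S j (clamp x).
Definition dS (j : nat) (x : R) : R := dbr S j (clamp x).
Definition jacS (j : nat) (x : R) : R := Rabs (dS j x).
Definition rS (j : nat) (x : R) : R := rbr S j (clamp x).

Lemma br_range j y : active j -> I y -> lft S j <= br S j y <= rgt S j.
Proof.
  intros Hj. destruct (proj2 Hbranch j Hj) as [_ [[F [_ [_ [_ [_ [H _]]]]]] _]]. auto.
Qed.

Lemma interval_range j : active j -> 0 <= lft S j < rgt S j /\ rgt S j <= 1.
Proof. apply Hpart. Qed.

Lemma br_I j y : active j -> I y -> I (br S j y).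
Proof.
  intros Hj Hy. pose proof (br_range j y Hj Hy). pose proof (interval_range j Hj).
  unfold I. lra.
Qed.

Lemma br_injective j x y : active j -> I x -> I y -> br S j x = br S j y -> x = y.
Proof.
  intros Hj Hx Hy E.
  destruct (proj2 Hbranch j Hj) as [_ [[F [_ [_ [_ [_ [_ [_ H]]]]]]] _]].
  rewrite <- (H x Hx), <- (H y Hy), E. reflexivity.
Qed.

Lemma gS_continuous j x : active j -> continuous (gS j) x.
Proof.
  intros Hj. destruct (proj2 Hbranch j Hj) as [_ [[F [_ [_ [H _]]]] _]].
  apply (continuous_on_clamp (br S j)); auto.
Qed.

(** Needed because T and the roof function are tied to the branches on the open intervals only. An
    injective continuous function takes no extreme value at an interior point. *)
Lemma br_interior j x : active j -> Iopen x -> lft S j < br S j x < rgt S j.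
Proof.
  intros Hj Hx.
  assert (E : gS j x = br S j x) by (unfold gS; rewrite clamp_id; auto; apply Iopen_I; auto).
  assert (Hinj : forall y z, 0 <= y <= 1 -> 0 <= z <= 1 -> gS j y = gS j z -> y = z).
  { intros y z Hy Hz. unfold gS. rewrite !clamp_id by auto. apply br_injective; auto. }
  rewrite <- E. split.
  - apply injective_gt_min; auto.
    + intros; apply gS_continuous; auto.
    + intros y _. apply br_range; auto. apply clamp_bounds.
  - assert (H : - rgt S j < - gS j x); [|lra].
    apply (injective_gt_min (fun y => - gS j y)); auto.
    + intros z. apply (continuous_opp (gS j)), gS_continuous; auto.
    + intros y z Hy Hz H. apply Hinj; auto. lra.
    + intros y _. apply Ropp_le_contravar, br_range; auto. apply clamp_bounds.
Qed.

Lemma br_Iopen j x : active j -> Iopen x -> Iopen (br S j x).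
Proof.
  intros Hj Hx. pose proof (br_interior j x Hj Hx). pose proof (interval_range j Hj).
  unfold Iopen. lra.
Qed.

Lemma T_br j x : active j -> Iopen x -> T S (br S j x) = x.
Proof.
  intros Hj Hx.
  destruct (proj2 Hbranch j Hj) as [_ [[F [H1 [_ [_ [_ [_ [_ H]]]]]]] _]].
  rewrite <- H1; [apply H, Iopen_I; auto|apply br_interior; auto].
Qed.

Lemma is_derive_br j x : active j -> Iopen x -> is_derive (br S j) x (dbr S j x).
Proof.
  intros Hj Hx. apply is_derive_I_Iopen; auto.
  destruct (proj2 Hbranch j Hj) as [_ [_ [_ H]]]. apply H, Iopen_I; auto.
Qed.

Lemma dS_continuous j x : active j -> continuous (dS j) x.
Proof.
  intros Hj. destruct (proj2 Hbranch j Hj) as [_ [_ [H _]]].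
  apply (continuous_on_clamp (dbr S j)); auto.
Qed.

Lemma T_C2 j x : active j -> Iopen x ->
  ex_derive (T S) (br S j x) /\ ex_derive (Derive (T S)) (br S j x).
Proof.
  intros Hj Hx. destruct (proj2 Hbranch j Hj) as [H _].
  destruct (H (br S j x) (br_interior j x Hj Hx)) as [H1 [H2 _]].
  split; auto.
Qed.

Lemma dbr_inverse j x : active j -> Iopen x -> Derive (T S) (br S j x) * dbr S j x = 1.
Proof.
  intros Hj Hx. destruct (T_C2 j x Hj Hx) as [H1 _].
  assert (H : is_derive (fun y => T S (br S j y)) x (dbr S j x * Derive (T S) (br S j x))).
  { apply (is_derive_comp (T S) (br S j)); [apply Derive_correct; auto|apply is_derive_br; auto]. }
  assert (H' : is_derive (fun y => T S (br S j y)) x 1).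
  { apply (is_derive_ext_loc (fun y => y)); [|apply (is_derive_id (K := R_AbsRing))].
    apply (filter_imp Iopen); [|apply locally_Iopen; auto].
    intros y Hy. symmetry. apply T_br; auto. }
  apply is_derive_unique in H, H'. rewrite <- H', H. ring.
Qed.

Lemma dbr_neq_0 j x : active j -> Iopen x -> dbr S j x <> 0.
Proof. intros Hj Hx E. pose proof (dbr_inverse j x Hj Hx) as H. rewrite E in H. lra. Qed.

(** The second derivative of h comes from h' = 1 / (T' o h), T being of class C^2 inside the
    interval. *)
Lemma ex_derive_dbr j x : active j -> Iopen x -> ex_derive (dbr S j) x.
Proof.
  intros Hj Hx.
  apply (ex_derive_ext_loc (fun y => / Derive (T S) (br S j y))).
  - apply (filter_imp Iopen); [|apply locally_Iopen; auto].
    intros y Hy. pose proof (dbr_inverse j y Hj Hy) as H.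
    assert (Derive (T S) (br S j y) <> 0) by (intros E; rewrite E in H; lra).
    apply Rmult_eq_reg_l with (Derive (T S) (br S j y)); auto. rewrite H. field. auto.
  - apply (ex_derive_inv (fun y => Derive (T S) (br S j y))).
    + apply (ex_derive_comp (Derive (T S)) (br S j)).
      * apply T_C2; auto.
      * eexists. apply is_derive_br; auto.
    + pose proof (dbr_inverse j x Hj Hx) as H. intros E. rewrite E in H. lra.
Qed.

Lemma Derive_dbr_bound j x : active j -> Iopen x ->
  Rabs (Derive (dbr S j) x) <= K * Rabs (dbr S j x).
Proof.
  intros Hj Hx. replace (Derive (dbr S j) x) with (Derive_n (br S j) 2 x).
  - apply Hren; auto.
  - simpl. apply Derive_ext_loc. apply (filter_imp Iopen); [|apply locally_Iopen; auto].
    intros y Hy. change (Derive (br S j) y = dbr S j y). apply is_derive_unique, is_derive_br; auto.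
Qed.

Lemma clamp_locally_id (f : R -> R) x :
  Iopen x -> locally x (fun y => f y = f (clamp y)).
Proof.
  intros Hx. apply (filter_imp Iopen); [|apply locally_Iopen; auto].
  intros y Hy. rewrite clamp_id; auto. apply Iopen_I; auto.
Qed.

Lemma is_derive_clamp (f : R -> R) x l :
  Iopen x -> is_derive f x l -> is_derive (fun y => f (clamp y)) x l.
Proof.
  intros Hx H. apply (is_derive_ext_loc f); auto. apply clamp_locally_id; auto.
Qed.

Lemma sign_abs_le y : sign y * y = Rabs y /\ Rabs (sign y) <= 1.
Proof.
  destruct (total_order_T y 0) as [[H|H]|H].
  - rewrite sign_eq_m1 by auto. split; rewrite Rabs_left; lra.
  - subst y. rewrite sign_0, !Rabs_R0. lra.
  - rewrite sign_eq_1 by auto. split; rewrite Rabs_pos_eq; lra.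
Qed.

(* By Renyi's condition exp (-K x) |h'| is nonincreasing and exp (K x) |h'| is
   nondecreasing. *)
Lemma jacS_loglip_I j x y : active j -> 0 <= x <= 1 -> 0 <= y <= 1 ->
  jacS j y <= exp (K * Rabs (x - y)) * jacS j x.
Proof.
  intros Hj Hx Hy.
  destruct (Req_dec x y) as [<-|Hxy].
  { rewrite Rminus_diag, Rabs_R0, Rmult_0_r, exp_0. lra. }
  assert (Hc : forall c z, continuous (fun z => exp (c * z) * jacS j z) z).
  { intros c z. apply (continuous_mult (fun z => exp (c * z)) (jacS j)).
    - apply continuity_pt_filterlim, derivable_continuous_pt. reg.
    - apply (continuous_comp (dS j) Rabs); [apply dS_continuous; auto|apply continuous_Rabs]. }
  assert (Hd : forall c z, Iopen z -> is_derive (fun z => exp (c * z) * jacS j z) z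
    (exp (c * z) * (c * Rabs (dbr S j z) + sign (dbr S j z) * Derive (dbr S j) z))).
  { intros c z Hz.
    assert (D1 : is_derive (fun z => exp (c * z)) z (c * exp (c * z))).
    { auto_derive; auto. ring. }
    assert (D2 := is_derive_Rabs (dbr S j) z (Derive (dbr S j) z)
      (Derive_correct _ _ (ex_derive_dbr j z Hj Hz)) (dbr_neq_0 j z Hj Hz)).
    pose proof (is_derive_mult _ _ _ _ _ D1 D2 Rmult_comm) as D3.
    apply (is_derive_ext_loc (fun z => mult (exp (c * z)) (Rabs (dbr S j z)))).
    - apply (filter_imp Iopen); [|apply locally_Iopen; auto].
      intros w Hw. unfold jacS, dS. rewrite clamp_id; auto. apply Iopen_I; auto.
    - replace (exp (c * z) * (c * Rabs (dbr S j z) + sign (dbr S j z) * Derive (dbr S j) z))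
        with (plus (mult (c * exp (c * z)) (Rabs (dbr S j z)))
          (mult (exp (c * z)) (sign (dbr S j z) * Derive (dbr S j) z))); [exact D3|].
      unfold plus, mult; simpl. ring. }
  assert (Hb : forall z, Iopen z -> Rabs (sign (dbr S j z) * Derive (dbr S j) z) <= K * Rabs (dbr S j z)).
  { intros z Hz. rewrite Rabs_mult. destruct (sign_abs_le (dbr S j z)) as [_ H].
    pose proof (Derive_dbr_bound j z Hj Hz). pose proof (Rabs_pos (Derive (dbr S j) z)).
    pose proof (Rabs_pos (sign (dbr S j z))). nra. }
  destruct (Rlt_or_le x y) as [Hlt|Hle].
  - destruct (MVT_clamp _ _ x y (Hc (- K)) (Hd (- K)) Hx Hy Hxy) as [z [Hz E]].
    specialize (Hb z Hz). apply Rabs_le_between in Hb. pose proof (exp_pos (- K * z)) as Hp.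
    assert (H : exp (- K * y) * jacS j y <= exp (- K * x) * jacS j x).
    { assert (exp (- K * z) * (- K * Rabs (dbr S j z) + sign (dbr S j z) * Derive (dbr S j) z) <= 0)
        by (rewrite <- (Rmult_0_r (exp (- K * z))); apply Rmult_le_compat_l; lra).
      nra. }
    rewrite Rabs_left by lra.
    apply Rmult_le_reg_l with (exp (- K * y)); [apply exp_pos|].
    rewrite <- Rmult_assoc, <- exp_plus.
    replace (- K * y + K * - (x - y)) with (- K * x) by ring. auto.
  - destruct (MVT_clamp _ _ y x (Hc K) (Hd K) Hy Hx ltac:(auto)) as [z [Hz E]].
    specialize (Hb z Hz). apply Rabs_le_between in Hb. pose proof (exp_pos (K * z)) as Hp.
    assert (H : exp (K * y) * jacS j y <= exp (K * x) * jacS j x).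
    { assert (0 <= exp (K * z) * (K * Rabs (dbr S j z) + sign (dbr S j z) * Derive (dbr S j) z))
        by (apply Rmult_le_pos; lra).
      assert (y < x) by lra. nra. }
    rewrite Rabs_pos_eq by lra.
    apply Rmult_le_reg_l with (exp (K * y)); [apply exp_pos|].
    rewrite <- Rmult_assoc, <- exp_plus.
    replace (K * y + K * (x - y)) with (K * x) by ring. auto.
Qed.

Lemma K_pos : 0 < K.
Proof. apply Hren. Qed.

Lemma jacS_loglip j : active j -> loglip K (jacS j).
Proof.
  intros Hj x y. split; [apply Rabs_pos|].
  pose proof (jacS_loglip_I j (clamp x) (clamp y) Hj (clamp_bounds x) (clamp_bounds y)) as H.
  assert (E : forall z, jacS j (clamp z) = jacS j z).
  { intros z. unfold jacS, dS. rewrite (clamp_id (clamp z)); auto. apply clamp_bounds. }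
  rewrite !E in H. eapply Rle_trans; [apply H|].
  apply Rmult_le_compat_r; [apply Rabs_pos|]. apply exp_le, Rmult_le_compat_l; [left; apply K_pos|].
  apply clamp_lip.
Qed.

Lemma jacS_pos j x : active j -> 0 < jacS j x.
Proof.
  intros Hj. destruct (jacS_loglip j Hj x (/ 2)) as [[H|H] H1]; auto.
  assert (Hh : Iopen (/ 2)) by (unfold Iopen; lra).
  assert (0 < jacS j (/ 2)).
  { unfold jacS, dS. rewrite clamp_id by lra. apply Rabs_pos_lt, dbr_neq_0; auto. }
  rewrite <- H in H1. lra.
Qed.

Lemma rbr_Iopen j x : active j -> Iopen x -> rbr S j x = roof S (br S j x).
Proof. intros Hj. destruct Hroof as [_ [_ [H _]]]. apply H; auto. Qed.

Lemma is_derive_rbr j x : active j -> Iopen x ->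
  is_derive (rbr S j) x (dbr S j x * Derive (roof S) (br S j x)).
Proof.
  intros Hj Hx. apply (is_derive_ext_loc (fun y => roof S (br S j y))).
  - apply (filter_imp Iopen); [|apply locally_Iopen; auto].
    intros y Hy. symmetry; apply rbr_Iopen; auto.
  - apply (is_derive_comp (roof S) (br S j)); [|apply is_derive_br; auto].
    apply Derive_correct. apply (proj1 Hroof j Hj). apply br_interior; auto.
Qed.

Lemma rS_lip j x y : active j -> Rabs (rS j x - rS j y) <= K * Rabs (x - y).
Proof.
  intros Hj.
  assert (Hc : forall z, continuous (rS j) z).
  { intros z. apply (continuous_on_clamp (rbr S j)).
    destruct Hroof as [_ [_ [H _]]]. apply (C1_I_continuous_on (rbr S j)), H; auto. }
  pose proof (lip_of_derive_bound (rS j) (fun z => dbr S j z * Derive (roof S) (br S j z)) K Hc)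
    as H.
  apply Rle_trans with (K * Rabs (clamp x - clamp y)).
  - assert (E : forall z, rS j (clamp z) = rS j z).
    { intros z. unfold rS. rewrite (clamp_id (clamp z)); auto. apply clamp_bounds. }
    rewrite <- (E x), <- (E y). apply H; try apply clamp_bounds.
    + intros z Hz. apply is_derive_clamp; auto. apply is_derive_rbr; auto.
    + intros z Hz. rewrite Rmult_comm, Rabs_mult.
      destruct Hroof as [_ [_ [_ [_ [_ H1]]]]]. apply H1; auto.
  - apply Rmult_le_compat_l; [left; apply K_pos|apply clamp_lip].
Qed.

Lemma rbr_pos_Iopen : exists r0, 0 < r0 /\ forall j x, active j -> Iopen x -> r0 <= rbr S j x.
Proof.
  destruct Hroof as [_ [[r0 [Hr0 H]] _]]. exists r0. split; auto.
  intros j x Hj Hx. rewrite rbr_Iopen by auto. apply H, br_I, Iopen_I; auto.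
Qed.

(** The lower bound r0 is known on (0,1). Moving from an end point towards 1/2 by the fraction lam =
    r0 / (r0 + K) changes the value by at most K lam <= r0. *)
Lemma rS_pos j x : active j -> 0 <= rS j x.
Proof.
  intros Hj. destruct rbr_pos_Iopen as [r0 [Hr0 Hr]]. pose proof K_pos as HK.
  set (c := clamp x). pose proof (clamp_bounds x) as Hc. fold c in Hc.
  set (lam := r0 / (r0 + K)).
  assert (Hlam : 0 < lam < 1).
  { unfold lam. split; [apply Rdiv_lt_0_compat; lra|].
    apply Rmult_lt_reg_r with (r0 + K); [lra|]. unfold Rdiv. rewrite Rmult_assoc, Rinv_l; lra. }
  assert (HKl : K * lam <= r0).
  { unfold lam. apply Rmult_le_reg_r with (r0 + K); [lra|].
    replace (K * (r0 / (r0 + K)) * (r0 + K)) with (K * r0) by (field; lra). nra. }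
  set (y := c + lam * (/ 2 - c)).
  assert (Hy : Iopen y) by (unfold y, Iopen; split; nra).
  pose proof (rS_lip j c y Hj) as H. specialize (Hr j y Hj Hy).
  assert (E1 : rS j y = rbr S j y) by (unfold rS; rewrite clamp_id; auto; apply Iopen_I; auto).
  assert (E2 : rS j c = rS j x) by (unfold rS; rewrite (clamp_id c); auto).
  rewrite <- E2. rewrite E1 in H. apply Rabs_le_between in H.
  assert (Hd : Rabs (c - y) <= lam).
  { unfold y. replace (c - (c + lam * (/ 2 - c))) with (lam * (c - / 2)) by ring.
    rewrite Rabs_mult, (Rabs_pos_eq lam) by lra.
    assert (Rabs (c - / 2) <= 1) by (apply Rabs_le; lra). pose proof (Rabs_pos (c - / 2)). nra. }
  assert (K * Rabs (c - y) <= K * lam) by (apply Rmult_le_compat_l; lra).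
  lra.
Qed.

Lemma gS_range j x : active j -> 0 <= gS j x <= 1.
Proof. intros Hj. apply br_I; auto. apply clamp_bounds. Qed.

Lemma brw_I w x : List.Forall active w -> I x -> I (brw S w x).
Proof. intros Hw Hx. induction Hw; simpl; auto. apply br_I; auto. Qed.

Lemma brw_Iopen w x : List.Forall active w -> Iopen x -> Iopen (brw S w x).
Proof. intros Hw Hx. induction Hw; simpl; auto. apply br_Iopen; auto. Qed.

Lemma clamp_wg w x : List.Forall active w -> clamp (wg gS w x) = brw S w (clamp x).
Proof.
  intros Hw. induction Hw as [|j w Hj Hw IH]; simpl; auto.
  unfold gS at 1. rewrite IH. apply clamp_id, br_I; auto.
  apply brw_I; auto. apply clamp_bounds.
Qed.

Lemma gS_wg_brw j w x : List.Forall active w -> gS j (wg gS w x) = br S j (brw S w (clamp x)).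
Proof. intros Hw. unfold gS at 1. rewrite clamp_wg; auto. Qed.

Lemma C0_ge_1 : 1 <= C0.
Proof. apply Hexp. Qed.

Lemma wg_contraction w x y : List.Forall active w ->
  Rabs (wg gS w x - wg gS w y) <= C0 * rho ^ length w * Rabs (x - y).
Proof.
  intros Hw. pose proof C0_ge_1. destruct w as [|j w].
  - simpl. pose proof (Rabs_pos (x - y)). nra.
  - inversion Hw as [|j' w' Hj Hw' E1]; subst. simpl wg.
    rewrite !gS_wg_brw by auto. change (br S j (brw S w (clamp x))) with (brw S (j :: w) (clamp x)).
    change (br S j (brw S w (clamp y))) with (brw S (j :: w) (clamp y)).
    destruct Hexp as [_ [_ H1]].
    assert (Hlen : (1 <= length (j :: w))%nat) by (simpl; lia).
    assert (Hword : is_word S (length (j :: w)) (j :: w)) by (split; auto).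
    specialize (H1 _ _ Hlen Hword).
    (* No sign of rho is given; the inequality at the points 0 and 1 shows that C0 * rho ^ n is
       nonnegative, so that the clamped distance can be enlarged. *)
    pose proof (H1 0 1 ltac:(unfold I; lra) ltac:(unfold I; lra)) as Hpos.
    rewrite (Rabs_left (0 - 1)) in Hpos by lra.
    pose proof (Rabs_pos (brw S (j :: w) 0 - brw S (j :: w) 1)).
    eapply Rle_trans; [apply H1; apply clamp_bounds|].
    apply Rmult_le_compat_l; [lra|apply clamp_lip].
Qed.

(** An injective branch separates 0 and 1, so its contraction bound C0 rho is positive. *)
Lemma rho_bounds j : active j -> 0 < rho < 1.
Proof.
  intros Hj. destruct Hexp as [H1 [H2 H3]]. split; auto.
  assert (Hw : is_word S 1 (j :: nil)) by (split; auto).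
  specialize (H3 1%nat _ (Nat.le_refl 1) Hw 0 1 ltac:(unfold I; lra) ltac:(unfold I; lra)).
  rewrite (Rabs_left (0 - 1)) in H3 by lra. simpl in H3.
  assert (Hne : br S j 0 <> br S j 1).
  { intros E. apply br_injective in E; unfold I; auto; lra. }
  assert (0 < Rabs (br S j 0 - br S j 1)) by (apply Rabs_pos_lt; lra).
  nra.
Qed.

Lemma dS_neq_0 j x : active j -> dS j x <> 0.
Proof.
  intros Hj E. pose proof (jacS_pos j x Hj) as H. unfold jacS in H. rewrite E, Rabs_R0 in H. lra.
Qed.

Lemma dS_sign j : active j -> (forall x, jacS j x = dS j x) \/ (forall x, jacS j x = - dS j x).
Proof.
  intros Hj. assert (Hc : continuity (dS j))
    by (intros x; apply continuity_pt_filterlim, dS_continuous; auto).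
  assert (P : forall x y, 0 < dS j x -> dS j y < 0 -> False).
  { intros x y Hx Hy. destruct (IVT_gen (dS j) x y 0 Hc) as [z [_ Hz]].
    - rewrite Rmin_right, Rmax_left by lra. lra.
    - apply (dS_neq_0 j z Hj Hz). }
  unfold jacS. pose proof (dS_neq_0 j 0 Hj) as H0.
  destruct (Rlt_or_le 0 (dS j 0)) as [H|H]; [left|right]; intros x; pose proof (dS_neq_0 j x Hj).
  - apply Rabs_pos_eq. destruct (Rle_lt_dec 0 (dS j x)); auto. destruct (P 0 x); auto.
  - apply Rabs_left. destruct (Rle_lt_dec 0 (dS j x)); auto.
    destruct (P x 0); lra.
Qed.

(* The primitive of dS is a C^1 extension of h to the real line, which makes the
   change of variables formula available on the closed interval. *)
Lemma RInt_branch_le j (f : R -> R) : active j ->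
  (forall x : R, continuous f x) -> (forall x : R, 0 <= f x) ->
  RInt (fun x => jacS j x * f (gS j x)) 0 1 <= RInt f (lft S j) (rgt S j).
Proof.
  intros Hj Hf Hf0. pose proof (interval_range j Hj) as Hlr.
  set (h := fun x => br S j 0 + RInt (dS j) 0 x).
  assert (Hh : forall x, is_derive h x (dS j x)).
  { intros x. unfold h. replace (dS j x) with (plus 0 (dS j x)) by (unfold plus; simpl; ring).
    apply (is_derive_plus (V := R_NormedModule) (fun _ => br S j 0));
      [apply (is_derive_const (V := R_NormedModule))|].
    apply (is_derive_RInt (V := R_CompleteNormedModule) (dS j) _ 0).
    - apply filter_forall. intros y. apply (RInt_correct (V := R_CompleteNormedModule)).
      apply ex_RInt_cont. intros; apply dS_continuous; auto.
    - apply dS_continuous; auto. }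
  assert (Eh : forall x, 0 <= x <= 1 -> h x = gS j x).
  { assert (H0 : h 0 = gS j 0).
    { unfold h, gS. rewrite RInt_point, clamp_id by lra. unfold zero; simpl; ring. }
    intros x Hx.
    pose proof (lip_of_derive_bound (fun y => h y - gS j y) (fun _ => 0) 0) as HL.
    assert (HL' : Rabs (h x - gS j x - (h 0 - gS j 0)) <= 0 * Rabs (x - 0)).
    { apply HL; try lra.
      - intros z. apply (continuous_minus h (gS j)); [|apply gS_continuous; auto].
        apply (ex_derive_continuous (V := R_NormedModule) h). eexists; apply Hh.
      - intros z Hz. replace 0 with (minus (dS j z) (dS j z)) by (unfold minus, plus, opp; simpl; ring).
        apply (is_derive_minus (V := R_NormedModule) h (gS j)); auto.
        unfold dS. rewrite clamp_id by (apply Iopen_I; auto).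
        apply is_derive_clamp; auto. apply is_derive_br; auto.
      - intros z _. rewrite Rabs_R0. lra. }
    rewrite Rmult_0_l in HL'. apply Rabs_le_between in HL'. lra. }
  assert (Hcov : RInt (fun y => dS j y * f (h y)) 0 1 = RInt f (gS j 0) (gS j 1)).
  { rewrite <- !Eh by lra.
    apply (RInt_comp (V := R_CompleteNormedModule) f h (dS j)).
    - intros; auto.
    - intros; split; auto. apply dS_continuous; auto. }
  assert (Hsub : forall a b, lft S j <= a <= rgt S j -> lft S j <= b <= rgt S j ->
    RInt f a b <= RInt f (lft S j) (rgt S j)).
  { assert (P : forall a b, a <= b -> 0 <= RInt f a b).
    { intros a b Hab. apply RInt_ge_0; auto. apply ex_RInt_cont; auto. }
    intros a b Ha Hb. destruct (Rle_lt_dec a b) as [Hab|Hab].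
    - rewrite <- (RInt_Chasles_cont f (lft S j) a (rgt S j)), <- (RInt_Chasles_cont f a b (rgt S j)) by auto.
      pose proof (P (lft S j) a ltac:(lra)). pose proof (P b (rgt S j) ltac:(lra)). lra.
    - rewrite <- (opp_RInt_swap (V := R_CompleteNormedModule)) by (apply ex_RInt_cont; auto).
      change (opp (RInt f b a)) with (- RInt f b a).
      pose proof (P b a ltac:(lra)). pose proof (P (lft S j) (rgt S j) ltac:(lra)). lra. }
  assert (Hr : forall x, lft S j <= gS j x <= rgt S j) by (intros; apply br_range; auto; apply clamp_bounds).
  destruct (dS_sign j Hj) as [Es|Es].
  - rewrite (RInt_ext _ (fun y => dS j y * f (h y))).
    + rewrite Hcov. apply Hsub; auto.
    + rewrite Rmin_left, Rmax_right by lra. intros x Hx. rewrite Es, Eh by lra. reflexivity.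
  - rewrite (RInt_ext _ (fun y => opp (dS j y * f (h y)))).
    + assert (Hhc : forall x, continuous (fun y => dS j y * f (h y)) x).
      { intros x. apply (continuous_mult (dS j) (fun y => f (h y))); [apply dS_continuous; auto|].
        apply (continuous_comp h f); auto.
        apply (ex_derive_continuous (V := R_NormedModule) h). eexists; apply Hh. }
      rewrite (RInt_opp (V := R_CompleteNormedModule)) by (apply ex_RInt_cont; auto).
      rewrite Hcov, (opp_RInt_swap (V := R_CompleteNormedModule)) by (apply ex_RInt_cont; auto).
      apply Hsub; auto.
    + rewrite Rmin_left, Rmax_right by lra. intros x Hx. rewrite Es, Eh by lra.
      unfold opp; simpl. ring.
Qed.

(** Each summand becomes an integral of f over an interval of the partition; these intervals are
    disjoint and need not cover I, whence an inequality. *)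
Lemma RInt_transfer_le l (f : R -> R) : good active l ->
  (forall x : R, 0 <= f x) -> (forall x : R, continuous f x) ->
  RInt (fun x => lsum (fun j => jacS j x * f (gS j x)) l) 0 1 <= RInt f 0 1.
Proof.
  intros [Hl Hok] Hf0 Hf. rewrite List.Forall_forall in Hok.
  assert (Hc : forall j x, In j l -> continuous (fun y => jacS j y * f (gS j y)) x).
  { intros j x Hj. apply (continuous_mult (jacS j) (fun y => f (gS j y))).
    - apply (continuous_comp (dS j) Rabs); [apply dS_continuous; auto|apply continuous_Rabs].
    - apply (continuous_comp (gS j) f); auto. apply gS_continuous; auto. }
  rewrite (is_RInt_unique _ 0 1 (lsum (fun j => RInt (fun x => jacS j x * f (gS j x)) 0 1) l)).
  - eapply Rle_trans; [apply lsum_le; intros j Hj; apply RInt_branch_le; auto|].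
    apply lsum_RInt_disjoint_le; auto.
    + intros j Hj. apply interval_range; auto.
    + intros i j Hi Hj Hij x Hx. destruct Hpart as [_ [H _]].
      apply (H i j (Hok i Hi) (Hok j Hj) Hij x Hx).
  - apply is_RInt_lsum. intros j Hj. apply (RInt_correct (V := R_CompleteNormedModule)).
    apply ex_RInt_cont. intros x. apply Hc; auto.
Qed.

(** Since sigma0 < 0, the series converges at sigma0 / 2, which leaves room e1S on the negative side
    of 0; the weights there dominate those for all |sigma| <= e1S because r >= 0. *)
Definition e1S : R := - sigma0 / 2.

Lemma e1S_pos : 0 < e1S.
Proof. unfold e1S. destruct Hroof as [_ [_ [_ [H _]]]]. lra. Qed.

Definition MS (j : nat) : R :=
  if idx S j then
    real (Lub_Rbar (fun v => exists x, I x /\ v = exp (- (sigma0 / 2) * rbr S j x) * Rabs (dbr S j x)))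
  else 0.

Lemma MS_summable : ex_series MS.
Proof.
  destruct Hroof as [_ [_ [_ [Hs [H _]]]]]. apply (H (sigma0 / 2)). lra.
Qed.

Lemma MS_ge j x : active j -> exp (e1S * rS j x) * jacS j x <= MS j.
Proof.
  intros Hj. unfold MS. rewrite Hj.
  set (E := fun v => exists x, I x /\ v = exp (- (sigma0 / 2) * rbr S j x) * Rabs (dbr S j x)).
  destruct (Lub_Rbar_correct E) as [Hub Hleast].
  assert (Hin : E (exp (e1S * rS j x) * jacS j x)).
  { exists (clamp x). split; [apply clamp_bounds|]. unfold e1S, jacS, dS, rS.
    do 2 f_equal. field. }
  specialize (Hub _ Hin).
  (* [real] sends an infinite bound to 0, so the supremum must first be shown finite; comparison
     with the value at 0 does this. *)
  assert (Hlog : loglip (e1S * K + K) (fun y => exp (e1S * rS j y) * jacS j y)).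
  { apply (loglip_mult _ _ (fun y => exp (e1S * rS j y))); [|apply jacS_loglip; auto].
    apply loglip_exp. intros y z. rewrite <- Rmult_minus_distr_l, Rabs_mult.
    pose proof e1S_pos. rewrite (Rabs_pos_eq e1S) by lra. rewrite Rmult_assoc.
    apply Rmult_le_compat_l; [lra|apply rS_lip; auto]. }
  assert (Hbd : Rbar_le (Lub_Rbar E) (exp (e1S * K + K) * (exp (e1S * rS j 0) * jacS j 0))).
  { apply Hleast. intros v [y [Hy ->]]. simpl.
    destruct (Hlog 0 y) as [_ H].
    replace (exp (- (sigma0 / 2) * rbr S j y) * Rabs (dbr S j y))
      with (exp (e1S * rS j y) * jacS j y).
    - eapply Rle_trans; [apply H|]. apply Rmult_le_compat_r; [apply (Hlog 0 0)|].
      apply exp_le. rewrite <- (Rmult_1_r (e1S * K + K)) at 2.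
      pose proof e1S_pos. pose proof K_pos. unfold I in Hy.
      apply Rmult_le_compat_l; [nra|]. apply Rabs_le; lra.
    - unfold jacS, dS, rS. rewrite clamp_id by auto. unfold e1S. do 2 f_equal. field. }
  destruct (Lub_Rbar E); simpl in *; auto; contradiction.
Qed.

Lemma MS_nonneg j : 0 <= MS j.
Proof.
  destruct (idx S j) eqn:E.
  - eapply Rle_trans; [|apply (MS_ge j 0 E)].
    apply Rmult_le_pos; [left; apply exp_pos|left; apply jacS_pos; auto].
  - unfold MS. rewrite E. lra.
Qed.

Definition Mtot : R := Series MS + 1.

Lemma Series_MS_nonneg : 0 <= Series MS.
Proof. apply (lsum_seq_le_Series MS 0); [apply MS_nonneg|apply MS_summable]. Qed.

Lemma Mtot_pos : 0 < Mtot.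
Proof. unfold Mtot. pose proof Series_MS_nonneg. lra. Qed.

Lemma lsum_e1S_le l x : good active l ->
  lsum (fun j => exp (e1S * rS j x) * jacS j x) l <= Mtot.
Proof.
  intros [Hl Hok]. rewrite List.Forall_forall in Hok.
  apply Rle_trans with (lsum MS l).
  - apply lsum_le. intros j Hj. apply MS_ge, Hok; auto.
  - unfold Mtot. pose proof (lsum_le_Series MS l MS_nonneg MS_summable Hl). lra.
Qed.

(** * The UNI condition *)

(** [birkhoff] adds the last point of the orbit, while the outermost letter of a word corresponds to
    the first one. *)
Lemma birkhoff_left n x : birkhoff S (Datatypes.S n) x = roof S x + birkhoff S n (T S x).
Proof.
  induction n as [|n IH]; [simpl; ring|].
  change (birkhoff S (Datatypes.S (Datatypes.S n)) x)
    with (birkhoff S (Datatypes.S n) x + roof S (Nat.iter (Datatypes.S n) (T S) x)).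
  rewrite IH, Nat.iter_succ_r. simpl. ring.
Qed.

Lemma birkhoff_brw w x : List.Forall active w -> Iopen x ->
  birkhoff S (length w) (brw S w x) = wrf gS rS w x.
Proof.
  intros Hw Hx. induction Hw as [|j w Hj Hw IH]; [reflexivity|].
  simpl length. rewrite birkhoff_left. simpl brw. simpl wrf.
  pose proof (brw_Iopen w x Hw Hx) as Hb.
  rewrite T_br, IH, <- rbr_Iopen by auto. f_equal.
  unfold rS. rewrite clamp_wg, (clamp_id x); auto. apply Iopen_I; auto.
Qed.

Lemma ex_derive_brw w x : List.Forall active w -> Iopen x -> ex_derive (brw S w) x.
Proof.
  intros Hw Hx. induction Hw as [|j w Hj Hw IH]; simpl; [apply ex_derive_id|].
  apply (ex_derive_comp (br S j) (brw S w)); auto.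
  eexists. apply is_derive_br; auto. apply brw_Iopen; auto.
Qed.

Lemma ex_derive_wrf w x : List.Forall active w -> Iopen x -> ex_derive (wrf gS rS w) x.
Proof.
  intros Hw Hx. induction Hw as [|j w Hj Hw IH]; simpl; [apply ex_derive_const|].
  apply (ex_derive_plus (V := R_NormedModule) (fun y => rS j (wg gS w y))); auto.
  apply (ex_derive_ext_loc (fun y => rbr S j (brw S w y))).
  - apply (filter_imp Iopen); [|apply locally_Iopen; auto].
    intros y Hy. unfold rS. rewrite clamp_wg, (clamp_id y); auto. apply Iopen_I; auto.
  - apply (ex_derive_comp (rbr S j) (brw S w)); [|apply ex_derive_brw; auto].
    eexists. apply is_derive_rbr; auto. apply brw_Iopen; auto.
Qed.

Variables (D : R) (n0 : nat).
Hypothesis Huni : UNI S D n0.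

Lemma rho_range : 0 < rho < 1.
Proof.
  destruct Huni as [_ [Hn0 H]]. destruct (H n0 (Nat.le_refl n0)) as [h [_ [[Hh1 Hh2] _]]].
  destruct h as [|j h]; [simpl in Hh1; lia|]. inversion Hh2; subst.
  apply (rho_bounds j); auto.
Qed.

Lemma wrf_rS_continuous w x : List.Forall active w -> continuous (wrf gS rS w) x.
Proof.
  apply (wrf_continuous gS rS active C0 rho K C0_ge_1 rho_range (Rlt_le _ _ K_pos)).
  - intros; apply wg_contraction; auto.
  - intros; apply rS_lip; auto.
Qed.

(** UNI in a form free of derivatives and valid up to the end points, by the mean value theorem;
    inside (0,1) the Birkhoff sums of the words are those of T. *)
Lemma UNI_two_points n : (n0 <= n)%nat -> exists h k,
  (List.Forall active h /\ length h = n) /\ (List.Forall active k /\ length k = n) /\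
  forall x y, 0 <= x <= 1 -> 0 <= y <= 1 ->
    D * Rabs (x - y) <=
    Rabs ((wrf gS rS h x - wrf gS rS k x) - (wrf gS rS h y - wrf gS rS k y)).
Proof.
  intros Hn. destruct Huni as [HD [_ H]]. destruct (H n Hn) as [h [k [[Hh1 Hh2] [[Hk1 Hk2] Hd]]]].
  exists h, k. split; [auto|]. split; [auto|]. intros x y Hx Hy.
  set (f := fun z => wrf gS rS h z - wrf gS rS k z).
  change (D * Rabs (x - y) <= Rabs (f x - f y)).
  destruct (Req_dec x y) as [<-|Hxy]; [rewrite !Rminus_diag, Rabs_R0; lra|].
  destruct (MVT_clamp f (Derive f) y x) as [z [Hz E]]; auto.
  - intros z. apply (continuous_minus (wrf gS rS h)); apply wrf_rS_continuous; auto.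
  - intros z Hz. apply Derive_correct.
    apply (ex_derive_minus (V := R_NormedModule)); apply ex_derive_wrf; auto.
  - rewrite E, Rabs_mult. apply Rmult_le_compat_r; [apply Rabs_pos|].
    replace (Derive f z) with (Derive (psi S n h k) z); [apply Hd; auto|].
    apply Derive_ext_loc. apply (filter_imp Iopen); [|apply locally_Iopen; auto].
    intros w Hw. unfold psi, f. rewrite <- Hh1 at 1. rewrite <- Hk1 at 1.
    rewrite !birkhoff_brw; auto.
Qed.

Lemma system_truncated_estimate : exists Amin gamma eps bb l0,
  0 < gamma < 1 /\ 0 < eps /\ 0 <= bb /\ List.Forall active l0 /\
  forall s t, Rabs s < eps -> 4 <= Rabs t -> 2 * PI / D <= Rabs t ->
  forall m, Amin * ln (Rabs t) <= INR m ->
  exists X, 0 <= X /\ (1 + bb) * X <= gamma ^ m /\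
  forall l v, good active l -> incl l0 l -> (forall x, Cmod (v x) <= 1) ->
    (forall x y, Cmod (v x - v y)%C <= Rabs t * Rabs (x - y)) ->
    forall x y, 0 <= x <= 1 ->
      Cmod (CL gS jacS rS l m s t v x) <= X /\
      Cmod (CL gS jacS rS l m s t v x - CL gS jacS rS l m s t v y)%C <=
      (exp (bb * Rabs t * Rabs (x - y)) - 1) * X.
Proof.
  pose proof (cdist_nonneg C0 rho K C0_ge_1 rho_range (Rlt_le _ _ K_pos)) as Hc.
  pose proof C0_ge_1.
  destruct (truncated_estimate gS jacS rS active C0 rho K C0_ge_1 rho_range (Rlt_le _ _ K_pos))
    with (e1 := e1S) (M := Mtot) (D := D) (n0 := n0)
    as [Amin [gamma [eps [l0 [H1 [H2 [H3 H4]]]]]]].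
  - intros; apply gS_range; auto.
  - intros; apply wg_contraction; auto.
  - apply jacS_loglip.
  - intros; apply jacS_pos; auto.
  - intros; apply rS_lip; auto.
  - intros; apply rS_pos; auto.
  - apply RInt_transfer_le.
  - apply e1S_pos.
  - apply Mtot_pos.
  - intros; apply lsum_e1S_le; auto.
  - apply Huni.
  - apply UNI_two_points.
  - exists Amin, gamma, eps, (out_exponent C0 rho K), l0.
    split; [auto|]. split; [auto|]. split; [|auto].
    unfold out_exponent, aperture. nra.
Qed.

(** * Passage to the limit *)

Definition trunc (N : nat) : list nat := filter (idx S) (seq 0 N).

Lemma trunc_good N : good active (trunc N).
Proof.
  split; [apply NoDup_filter, seq_NoDup|].
  apply List.Forall_forall. intros j Hj. apply filter_In in Hj. apply Hj.
Qed.

Lemma trunc_incl l0 : List.Forall active l0 -> exists N0, forall N, (N0 <= N)%nat -> incl l0 (trunc N).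
Proof.
  intros H. exists (Datatypes.S (list_max l0)). intros N HN j Hj.
  rewrite List.Forall_forall in H. apply filter_In. split; [|apply H; auto].
  apply in_seq. pose proof (proj1 (list_max_le l0 (list_max l0)) (Nat.le_refl _)) as Hm.
  rewrite List.Forall_forall in Hm. specialize (Hm j Hj). lia.
Qed.

Lemma csum_filter (F : nat -> C) l :
  csum F (filter (idx S) l) = csum (fun j => if idx S j then F j else RtoC 0) l.
Proof.
  induction l as [|j l IH]; simpl; auto.
  destruct (idx S j); simpl; rewrite IH; [auto|ring].
Qed.

Section Limit.

Variables (s t : R).
Hypothesis Hs : Rabs s <= e1S.

Definition tterm (f : R -> C) (j : nat) (x : R) : C :=
  if idx S j then
    (Cexp (- (s, t) * RtoC (rbr S j x)) * RtoC (Rabs (dbr S j x)) * f (br S j x))%C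
  else RtoC 0.

Lemma tterm_active f j x : active j ->
  tterm f j (clamp x) =
  (RtoC (weight gS jacS rS s (j :: nil) x) *
    (phase gS rS t (j :: nil) x * f (clamp (wg gS (j :: nil) x))))%C.
Proof.
  intros Hj. unfold tterm. rewrite Hj. unfold weight, phase. simpl wg. simpl wrf. simpl wjac.
  rewrite (clamp_id (gS j x)) by (apply gS_range; auto).
  fold (gS j x). change (rbr S j (clamp x)) with (rS j x).
  change (Rabs (dbr S j (clamp x))) with (jacS j x).
  rewrite Rplus_0_r, Rmult_1_r. unfold Cexp.
  replace (Re (- (s, t) * RtoC (rS j x))%C) with (- s * rS j x)
    by (unfold Re; simpl; ring).
  replace (Im (- (s, t) * RtoC (rS j x))%C) with (- t * rS j x)
    by (unfold Im; simpl; ring).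
  apply injective_projections; simpl; ring.
Qed.

Lemma weight_le_MS j x : active j -> weight gS jacS rS s (j :: nil) x <= MS j.
Proof.
  intros Hj. unfold weight. simpl. rewrite Rplus_0_r, Rmult_1_r.
  eapply Rle_trans; [|apply (MS_ge j x Hj)].
  apply Rmult_le_compat_r; [left; apply jacS_pos; auto|].
  apply exp_le, Rmult_le_compat_r; [apply rS_pos; auto|].
  apply Rabs_le_between in Hs. lra.
Qed.

(** The qualitative regularity preserved by L_s. Its constants may grow with each iteration; they
    serve only to justify convergence and termwise differentiation. *)
Definition tcone (f : R -> C) (b B : R) : Prop :=
  0 <= b /\ 0 <= B /\ cone b (fun _ => B) (fun x => f (clamp x)).

Definition bterm (b : R) : R :=
  Rabs s * cdist C0 rho K + cdist C0 rho K + (Rabs t * cdist C0 rho K + b * (C0 * rho ^ 1)).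

Lemma bterm_nonneg b : 0 <= b -> 0 <= bterm b.
Proof.
  intros Hb. unfold bterm.
  pose proof (cdist_nonneg C0 rho K C0_ge_1 rho_range (Rlt_le _ _ K_pos)).
  pose proof (Rabs_pos s). pose proof (Rabs_pos t). pose proof C0_ge_1. pose proof rho_range.
  assert (0 <= b * (C0 * rho ^ 1)) by (simpl; apply Rmult_le_pos; nra). nra.
Qed.

Lemma tterm_bounds f b B : tcone f b B -> forall j x y,
  Cmod (tterm f j (clamp x)) <= MS j * B /\
  Cmod (tterm f j (clamp x) - tterm f j (clamp y))%C <=
    (exp (bterm b * Rabs (x - y)) - 1) * (MS j * B).
Proof.
  intros [Hb [HB Hf]] j x y. pose proof (MS_nonneg j) as HM.
  assert (He : 0 <= exp (bterm b * Rabs (x - y)) - 1).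
  { assert (1 <= exp (bterm b * Rabs (x - y))); [|lra].
    apply exp_ge_1, Rmult_le_pos; [apply bterm_nonneg; auto|apply Rabs_pos]. }
  assert (HMB : 0 <= MS j * B) by (apply Rmult_le_pos; auto).
  destruct (idx S j) eqn:Hj.
  - rewrite !tterm_active by auto.
    assert (Hw : List.Forall active (j :: nil)) by auto.
    destruct (term_cone gS jacS rS active C0 rho K C0_ge_1 rho_range (Rlt_le _ _ K_pos))
      with (s := s) (t := t) (b := b) (u := fun _ : R => B) (v := fun x => f (clamp x))
        (w := j :: nil) as [_ Hc]; auto.
    + intros; apply wg_contraction; auto.
    + apply jacS_loglip.
    + intros; apply rS_lip; auto.
    + destruct (Hc x y) as [H1 H2]. fold (bterm b) in H2.
      change (length (j :: nil)) with 1%nat in H2. fold (bterm b) in H2.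
      assert (Hle : weight gS jacS rS s (j :: nil) x * B <= MS j * B)
        by (apply Rmult_le_compat_r; auto; apply weight_le_MS; auto).
      split; [eapply Rle_trans; [apply H1|apply Hle]|].
      eapply Rle_trans; [apply H2|]. apply Rmult_le_compat_l; auto.
  - unfold tterm. rewrite Hj. replace (RtoC 0 - RtoC 0)%C with (RtoC 0) by ring.
    rewrite Cmod_0. split; auto. apply Rmult_le_pos; auto.
Qed.

Lemma MS_scal_summable B : ex_series (fun j => MS j * B).
Proof. apply (ex_series_scal_r B MS), MS_summable. Qed.

Lemma transfer_eq f x : transfer S (s, t) f x = CSeries (fun j => tterm f j x).
Proof. reflexivity. Qed.

Lemma transfer_tcone f b B : tcone f b B ->
  tcone (transfer S (s, t) f) (bterm b) (2 * (Series MS * B)).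
Proof.
  intros Hf. pose proof Hf as [Hb [HB _]]. pose proof Series_MS_nonneg.
  assert (HMB : 0 <= Series MS * B) by (apply Rmult_le_pos; auto).
  split; [apply bterm_nonneg; auto|]. split; [lra|].
  split; [apply loglip_const; [apply bterm_nonneg; auto|lra]|].
  intros x y. rewrite !transfer_eq. rewrite <- (Series_scal_r B MS). split.
  - apply CSeries_le; [|apply MS_scal_summable].
    intros j. apply (tterm_bounds f b B Hf j x x).
  - rewrite (CSeries_minus _ _ (fun j => MS j * B) (fun j => MS j * B));
      try apply MS_scal_summable.
    + apply Rle_trans with
        (2 * Series (fun j => (exp (bterm b * Rabs (x - y)) - 1) * (MS j * B))).
      * apply CSeries_le.
        -- intros j. apply (tterm_bounds f b B Hf j x y).
        -- apply ex_series_scal_R, MS_scal_summable.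
      * rewrite Series_scal_l. right; ring.
    + intros j. apply (tterm_bounds f b B Hf j x x).
    + intros j. apply (tterm_bounds f b B Hf j y y).
Qed.

(** Differentiability of the iterates has to be carried along, since [sup_mod_derive] is infinite as
    soon as it fails at one point of (0,1). *)
Definition parts_derivable (f : R -> C) : Prop := forall x, Iopen x ->
  ex_derive (fun y => fst (f y)) x /\ ex_derive (fun y => snd (f y)) x.

Lemma tterm_parts_derivable f j : parts_derivable f -> parts_derivable (tterm f j).
Proof.
  intros Hf x Hx. unfold tterm. destruct (idx S j) eqn:Hj.
  2: split; apply ex_derive_const.
  assert (Hr : ex_derive (rbr S j) x) by (eexists; apply is_derive_rbr; auto).
  assert (Hd : ex_derive (fun y => Rabs (dbr S j y)) x).
  { eexists. apply is_derive_Rabs; [|apply dbr_neq_0; auto].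
    apply Derive_correct, ex_derive_dbr; auto. }
  assert (Hb : ex_derive (br S j) x) by (eexists; apply is_derive_br; auto).
  destruct (Hf (br S j x) (br_Iopen j x Hj Hx)) as [H1 H2].
  pose proof (ex_derive_comp _ _ _ H1 Hb) as F1. pose proof (ex_derive_comp _ _ _ H2 Hb) as F2.
  set (r := rbr S j) in *. set (J := fun y => Rabs (dbr S j y)) in *.
  set (f1 := fun y => fst (f (br S j y))) in *. set (f2 := fun y => snd (f (br S j y))) in *.
  split.
  - apply (ex_derive_ext (fun y => exp (- s * r y) * J y * (cos (- t * r y) * f1 y - sin (- t * r y) * f2 y))).
    + intros y. unfold Cexp, Re, Im, J, f1, f2, r. simpl.
      replace (- s * rbr S j y - - t * 0) with (- s * rbr S j y) by ring.
      replace (- s * 0 + - t * rbr S j y) with (- t * rbr S j y) by ring. ring.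
    + auto_derive. repeat split; auto.
  - apply (ex_derive_ext (fun y => exp (- s * r y) * J y * (cos (- t * r y) * f2 y + sin (- t * r y) * f1 y))).
    + intros y. unfold Cexp, Re, Im, J, f1, f2, r. simpl.
      replace (- s * rbr S j y - - t * 0) with (- s * rbr S j y) by ring.
      replace (- s * 0 + - t * rbr S j y) with (- t * rbr S j y) by ring. ring.
    + auto_derive. repeat split; auto.
Qed.

Lemma transfer_parts_derivable f b B : tcone f b B -> parts_derivable f ->
  parts_derivable (transfer S (s, t) f).
Proof.
  intros Hf Hd x Hx. pose proof Hf as [Hb [HB _]].
  set (c := bterm b * exp (bterm b)).
  pose proof (bterm_nonneg b Hb) as Hbt.
  assert (Hc : 0 <= c) by (apply Rmult_le_pos; [auto|left; apply exp_pos]).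
  set (m := fun j => c * (MS j * B)).
  assert (Hm : ex_series m) by (apply ex_series_scal_R, MS_scal_summable).
  assert (HMB : forall j, 0 <= MS j * B) by (intros; apply Rmult_le_pos; auto; apply MS_nonneg).
  assert (Hm0 : forall j, 0 <= m j) by (intros; apply Rmult_le_pos; auto).
  assert (Hloc : forall j y, Iopen y ->
    Cmod (tterm f j y) <= MS j * B /\ Cmod (tterm f j y - tterm f j x)%C <= m j * Rabs (y - x)).
  { intros j y Hy. pose proof (tterm_bounds f b B Hf j y x) as [P1 P2].
    rewrite (clamp_id y) in P1, P2 by (apply Iopen_I; auto).
    rewrite (clamp_id x) in P2 by (apply Iopen_I; auto).
    split; auto. eapply Rle_trans; [apply P2|]. unfold m.
    assert (Hyx : Rabs (y - x) <= 1) by (unfold Iopen in *; apply Rabs_le; lra).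
    pose proof (exp_le_linear (bterm b) (Rabs (y - x)) Hbt (conj (Rabs_pos _) Hyx)) as HE.
    replace (c * (MS j * B) * Rabs (y - x)) with (c * Rabs (y - x) * (MS j * B)) by ring.
    apply Rmult_le_compat_r; auto. }
  assert (P : forall p : C -> R, (forall z, Rabs (p z) <= Cmod z) ->
    (forall z z', p (z - z')%C = p z - p z') ->
    (forall j, ex_derive (fun y => p (tterm f j y)) x) ->
    ex_derive (fun y => Series (fun j => p (tterm f j y))) x).
  { intros p Hp Hpm Hpd. apply (ex_derive_Series (fun j y => p (tterm f j y)) m); auto.
    apply (filter_imp Iopen); [|apply locally_Iopen; auto]. intros y Hy. split.
    - apply (ex_series_dominated _ (fun j => MS j * B)); [|apply MS_scal_summable].
      intros j. eapply Rle_trans; [apply Hp|]. apply Hloc; auto.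
    - intros j. rewrite <- Hpm. eapply Rle_trans; [apply Hp|]. apply Hloc; auto. }
  split.
  - apply (P (fun z => fst z)).
    + intros; apply abs_fst_le_Cmod.
    + reflexivity.
    + intros j. exact (proj1 (tterm_parts_derivable f j Hd x Hx)).
  - apply (P (fun z => snd z)).
    + intros; apply abs_snd_le_Cmod.
    + reflexivity.
    + intros j. exact (proj2 (tterm_parts_derivable f j Hd x Hx)).
Qed.

Lemma iter_transfer_regular f b B n : tcone f b B -> parts_derivable f ->
  (exists b' B', tcone (Nat.iter n (transfer S (s, t)) f) b' B') /\
  parts_derivable (Nat.iter n (transfer S (s, t)) f).
Proof.
  intros Hf Hd. induction n as [|n [[b' [B' IH]] IH']]; simpl.
  - split; eauto.
  - split; [eexists; eexists; apply transfer_tcone; eauto|].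
    apply (transfer_parts_derivable _ b' B'); auto.
Qed.

Lemma CL_1_trunc f N x : 0 <= x <= 1 ->
  CL gS jacS rS (trunc N) 1 s t (fun y => f (clamp y)) x = csum (fun j => tterm f j x) (seq 0 N).
Proof.
  intros Hx. rewrite CL_1. unfold trunc. rewrite csum_filter. apply csum_ext. intros j _.
  destruct (idx S j) eqn:Hj.
  - transitivity (tterm f j (clamp x)); [|rewrite clamp_id by auto; reflexivity].
    rewrite tterm_active by auto.
    unfold weight, phase. simpl. rewrite Rplus_0_r, Rmult_1_r. reflexivity.
  - unfold tterm. rewrite Hj. reflexivity.
Qed.

Lemma CL_1_trunc_diff N w w' d x :
  (forall y, 0 <= y <= 1 -> Cmod (w y - w' y)%C <= d) -> 0 <= x <= 1 ->
  Cmod (CL gS jacS rS (trunc N) 1 s t w x - CL gS jacS rS (trunc N) 1 s t w' x)%C <= Mtot * d.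
Proof.
  intros Hw Hx. rewrite !CL_1.
  assert (Hd : 0 <= d) by (eapply Rle_trans; [apply Cmod_ge_0|apply (Hw 0); lra]).
  replace (_ - _)%C with (csum (fun j => (RtoC (exp (- s * rS j x) * jacS j x) *
    ((cos (- t * rS j x), sin (- t * rS j x)) * (w (gS j x) - w' (gS j x))))%C) (trunc N)).
  - pose proof (trunc_good N) as HN. pose proof HN as [_ Hok].
    rewrite List.Forall_forall in Hok.
    apply Rle_trans with (lsum (fun j => d * (exp (e1S * rS j x) * jacS j x)) (trunc N)).
    + apply Cmod_csum_le. intros j Hj. specialize (Hok j Hj).
      rewrite !Cmod_mult, Cmod_cis, Rmult_1_l, Cmod_R.
      pose proof (jacS_pos j x Hok) as Hjp. pose proof (rS_pos j x Hok) as Hrp.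
      pose proof (exp_pos (- s * rS j x)) as Hep.
      rewrite Rabs_pos_eq by (apply Rmult_le_pos; lra).
      rewrite (Rmult_comm d). apply Rmult_le_compat; auto using Cmod_ge_0.
      * apply Rmult_le_pos; lra.
      * apply Rmult_le_compat_r; [lra|]. apply exp_le, Rmult_le_compat_r; auto.
        apply Rabs_le_between in Hs. lra.
      * apply Hw, gS_range; auto.
    + rewrite lsum_scal, Rmult_comm. apply Rmult_le_compat_r; auto. apply lsum_e1S_le; auto.
  - induction (trunc N) as [|j l IH]; simpl; [ring|]. rewrite IH. ring.
Qed.

(** With L' the truncated operator, L'^(n+1) f - L^(n+1) f = L' (L'^n f - L^n f) + (L' - L) (L^n f).
    The first term is at most [Mtot] times the previous error, uniformly in the truncation, and the
    second is a tail of a series dominated by [MS]. *)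
Lemma CL_trunc_converges f b B n e : tcone f b B -> parts_derivable f -> 0 < e ->
  exists N0, forall N, (N0 <= N)%nat -> forall x, 0 <= x <= 1 ->
    Cmod (CL gS jacS rS (trunc N) n s t (fun y => f (clamp y)) x -
      Nat.iter n (transfer S (s, t)) f x)%C <= e.
Proof.
  intros Hf Hd. revert e. induction n as [|n IH]; intros e He.
  - exists 0%nat. intros N _ x Hx. rewrite CL_0, clamp_id by auto. simpl.
    replace (f x - f x)%C with (RtoC 0) by ring. rewrite Cmod_0. lra.
  - destruct (iter_transfer_regular f b B n Hf Hd) as [[b' [B' Hn]] _].
    set (fn := Nat.iter n (transfer S (s, t)) f) in *.
    pose proof Mtot_pos as HMt. pose proof Hn as [_ [HB' _]].
    destruct (IH (e / (2 * Mtot))) as [N1 HN1]; [apply Rdiv_lt_0_compat; lra|].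
    destruct (Series_tail_small MS (e / (4 * (B' + 1))) MS_nonneg MS_summable) as [N2 HN2].
    { apply Rdiv_lt_0_compat; lra. }
    exists (N1 + N2)%nat. intros N HN x Hx.
    specialize (HN1 N ltac:(lia)). specialize (HN2 N ltac:(lia)).
    change (Nat.iter (Datatypes.S n) (transfer S (s, t)) f x) with (transfer S (s, t) fn x).
    rewrite <- Nat.add_1_r, CL_add.
    set (w := CL gS jacS rS (trunc N) n s t (fun y => f (clamp y))) in *.
    pose proof (CL_1_trunc_diff N w (fun y => fn (clamp y)) (e / (2 * Mtot)) x) as D1.
    assert (D1' : Cmod (CL gS jacS rS (trunc N) 1 s t w x -
      CL gS jacS rS (trunc N) 1 s t (fun y => fn (clamp y)) x)%C <= Mtot * (e / (2 * Mtot))).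
    { apply D1; auto. intros y Hy. rewrite clamp_id by auto. apply HN1; auto. }
    rewrite CL_1_trunc in D1' by auto.
    assert (D2 : Cmod (CSeries (fun j => tterm fn j x) - csum (fun j => tterm fn j x) (seq 0 N))%C
      <= 2 * (Series (fun j => MS j * B') - lsum (fun j => MS j * B') (seq 0 N))).
    { apply CSeries_tail_le; [|apply MS_scal_summable].
      intros j. rewrite <- (clamp_id x Hx). apply (tterm_bounds fn b' B' Hn j x x). }
    rewrite Series_scal_r in D2.
    rewrite (lsum_ext (fun j => MS j * B') (fun j => B' * MS j)), lsum_scal in D2
      by (intros; ring).
    rewrite transfer_eq.
    replace (_ - _)%C with
      ((CL gS jacS rS (trunc N) 1 s t w x - csum (fun j => tterm fn j x) (seq 0 N)) +
       - (CSeries (fun j => tterm fn j x) - csum (fun j => tterm fn j x) (seq 0 N)))%C by ring.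
    eapply Rle_trans; [apply Cmod_triangle|]. rewrite Cmod_opp.
    replace (Mtot * (e / (2 * Mtot))) with (e / 2) in D1' by (field; lra).
    assert (D3 : 2 * (Series MS * B' - B' * lsum MS (seq 0 N)) <= e / 2).
    { replace (2 * (Series MS * B' - B' * lsum MS (seq 0 N)))
        with (2 * B' * (Series MS - lsum MS (seq 0 N))) by ring.
      apply Rle_trans with (2 * B' * (e / (4 * (B' + 1)))); [apply Rmult_le_compat_l; lra|].
      apply Rmult_le_reg_r with (4 * (B' + 1)); [lra|].
      replace (2 * B' * (e / (4 * (B' + 1))) * (4 * (B' + 1))) with (2 * B' * e) by (field; lra).
      nra. }
    lra.
Qed.

Lemma transfer_limit_bounds f n X c l0 : tcone f (Rabs t) 1 -> parts_derivable f ->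
  0 <= c -> 0 <= X -> List.Forall active l0 ->
  (forall l, good active l -> incl l0 l -> forall x y, 0 <= x <= 1 ->
    Cmod (CL gS jacS rS l n s t (fun z => f (clamp z)) x) <= X /\
    Cmod (CL gS jacS rS l n s t (fun z => f (clamp z)) x -
      CL gS jacS rS l n s t (fun z => f (clamp z)) y)%C <= (exp (c * Rabs (x - y)) - 1) * X) ->
  forall x y, 0 <= x <= 1 -> 0 <= y <= 1 ->
    Cmod (Nat.iter n (transfer S (s, t)) f x) <= X /\
    Cmod (Nat.iter n (transfer S (s, t)) f x - Nat.iter n (transfer S (s, t)) f y)%C <=
      (exp (c * Rabs (x - y)) - 1) * X.
Proof.
  intros Hf Hd Hc HX Hl0 H x y Hx Hy.
  set (F := Nat.iter n (transfer S (s, t)) f).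
  assert (Hap : forall e, 0 < e -> exists l, good active l /\ incl l0 l /\
    forall z, 0 <= z <= 1 ->
      Cmod (F z - CL gS jacS rS l n s t (fun y => f (clamp y)) z)%C <= e).
  { intros e He. destruct (trunc_incl l0 Hl0) as [N1 HN1].
    destruct (CL_trunc_converges f (Rabs t) 1 n e Hf Hd He) as [N2 HN2].
    exists (trunc (N1 + N2)). split; [apply trunc_good|]. split; [apply HN1; lia|].
    intros z Hz. specialize (HN2 (N1 + N2)%nat ltac:(lia) z Hz). fold F in HN2.
    rewrite <- Cmod_opp. replace (- _)%C with
      (CL gS jacS rS (trunc (N1 + N2)) n s t (fun y => f (clamp y)) z - F z)%C by ring. auto. }
  split; apply le_epsilon; intros e He; (destruct (Hap (e / 2)) as [l [Hl [Hinc HF]]]; [lra|]);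
    destruct (H l Hl Hinc x y Hx) as [H1 H2];
    set (V := CL gS jacS rS l n s t (fun z => f (clamp z))) in *.
  - replace (F x) with ((F x - V x) + V x)%C by ring.
    eapply Rle_trans; [apply Cmod_triangle|]. specialize (HF x Hx). lra.
  - replace (F x - F y)%C with (((F x - V x) + (V x - V y)) + - (F y - V y))%C by ring.
    eapply Rle_trans; [apply Cmod_triangle|]. rewrite Cmod_opp.
    pose proof (Cmod_triangle (F x - V x) (V x - V y)).
    pose proof (HF x Hx). pose proof (HF y Hy). lra.
Qed.

End Limit.

End System.

Theorem theorem1p1 :
  forall (S : system) (C0 rho K sigma0 D : R) (n0 : nat),
    is_partition S ->
    piecewise_C2_full_branches S ->
    expanding S C0 rho ->
    renyi S K ->
    roof_assumptions S K sigma0 ->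
    UNI S D n0 ->
    exists A gamma eps : R,
      INR n0 <= A /\ 0 < gamma < 1 /\ 0 < eps /\
      forall sigma t : R,
        Rabs sigma < eps ->
        Rmax (2 * PI / D) 4 <= Rabs t ->
        forall n : nat,
          A * ln (Rabs t) <= INR n ->
          Rbar_le (opnorm1 t (Nat.iter n (transfer S (sigma, t))))
                  (Finite (gamma ^ n)).
Proof.
  intros S C0 rho K sigma0 D n0 Hpart Hbranch Hexp Hren Hroof Huni.
  destruct (system_truncated_estimate S C0 rho K sigma0 Hpart Hbranch Hexp Hren Hroof D n0 Huni)
    as [Amin [gamma [eps [bb [l0 [Hgam [Heps [Hbb [Hl0 Hest]]]]]]]]].
  pose proof (e1S_pos S K sigma0 Hroof) as He1.
  (* Enlarging A only restricts n, as ln |t| >= 0. The bound [e1S] on |sigma| makes [MS] dominate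
     the series of L_s. *)
  exists (Rmax (INR n0) Amin), gamma, (Rmin eps (e1S sigma0)).
  split; [apply Rmax_l|]. split; [auto|]. split; [apply Rmin_glb_lt; auto|].
  intros s t Hs Ht n Hn.
  assert (Ht4 : 4 <= Rabs t) by (eapply Rle_trans; [apply Rmax_r|apply Ht]).
  assert (HtD : 2 * PI / D <= Rabs t) by (eapply Rle_trans; [apply Rmax_l|apply Ht]).
  assert (Hs1 : Rabs s < eps) by (eapply Rlt_le_trans; [apply Hs|apply Rmin_l]).
  assert (Hs2 : Rabs s <= e1S sigma0) by (left; eapply Rlt_le_trans; [apply Hs|apply Rmin_r]).
  assert (Hln : 0 <= ln (Rabs t)) by (rewrite <- ln_1; apply ln_le; lra).
  assert (Hn' : Amin * ln (Rabs t) <= INR n).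
  { eapply Rle_trans; [|apply Hn]. apply Rmult_le_compat_r; auto. apply Rmax_r. }
  destruct (Hest s t Hs1 Ht4 HtD n Hn') as [X [HX [HXg HCL]]].
  apply Rbar_lub_le. intros v [f [Hf [Hf1 ->]]].
  destruct Hf as [df Hdf]. pose proof Hdf as [_ Hdf'].
  assert (Hfc : continuous_on I f) by (apply C1_I_continuous_on; exists df; auto).
  assert (Hfd : forall x, Iopen x -> is_derive f x (df x)).
  { intros x Hx. apply is_derive_I_Iopen; auto. apply Hdf', Iopen_I; auto. }
  destruct (norm1_le_1 t f) as [Hsup Hder]; auto; [lra|intros x Hx; eexists; apply Hfd; auto|].
  (* On the unit ball of [norm1] one has |f'| <= |t|, so the clamped f is |t|-Lipschitz, as the
     truncated estimate requires of its input. *)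
  assert (Hlip : forall x y, Cmod (f (clamp x) - f (clamp y))%C <= Rabs t * Rabs (x - y)).
  { intros x y. apply Rle_trans with (Rabs t * Rabs (clamp x - clamp y)).
    2: { apply Rmult_le_compat_l; [apply Rabs_pos|apply clamp_lip]. }
    rewrite <- (clamp_id (clamp x)) at 1 by apply clamp_bounds.
    rewrite <- (clamp_id (clamp y)) at 1 by apply clamp_bounds.
    apply (lip_of_derive_bound_C (fun z => f (clamp z)) (Rabs t)); try apply clamp_bounds.
    - apply Rabs_pos.
    - intros z. apply (continuous_on_clamp f); auto.
    - intros z Hz. exists (df z). split; [|apply (Hder z); auto].
      apply (is_derive_ext_loc f); auto.
      apply (filter_imp Iopen); [|apply locally_Iopen; auto].
      intros w Hw. rewrite clamp_id; auto. apply Iopen_I; auto. }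
  assert (Hfcone : tcone f (Rabs t) 1).
  { split; [apply Rabs_pos|]. split; [lra|]. split; [apply loglip_const; [apply Rabs_pos|lra]|].
    intros x y. split; [apply Hsup, clamp_bounds|].
    pose proof (exp_ineq1_le (Rabs t * Rabs (x - y))). specialize (Hlip x y). lra. }
  assert (Hparts : parts_derivable f).
  { intros x Hx. split; eexists; [apply is_derive_fst|apply is_derive_snd]; apply Hfd; auto. }
  assert (Hbt : 0 <= bb * Rabs t) by (apply Rmult_le_pos; lra).
  pose proof (transfer_limit_bounds S C0 rho K sigma0 Hpart Hbranch Hexp Hren Hroof D n0 Huni
    s t Hs2 f n X (bb * Rabs t) l0 Hfcone Hparts Hbt HX Hl0) as Hlim.
  assert (Hlim' : forall x y, 0 <= x <= 1 -> 0 <= y <= 1 ->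
    Cmod (Nat.iter n (transfer S (s, t)) f x) <= X /\
    Cmod (Nat.iter n (transfer S (s, t)) f x - Nat.iter n (transfer S (s, t)) f y)%C <=
      (exp (bb * Rabs t * Rabs (x - y)) - 1) * X).
  { apply Hlim. intros l Hl Hinc. apply HCL; auto. intros x. apply Hsup, clamp_bounds. }
  clear Hlim.
  destruct (iter_transfer_regular S C0 rho K sigma0 Hpart Hbranch Hexp Hren Hroof D n0 Huni
    s t Hs2 f (Rabs t) 1 n Hfcone Hparts) as [_ Hreg].
  (* The derivative is at most bb |t| X; division by |t| in [norm1] leaves (1 + bb) X, which X was
     chosen to keep below gamma^n. *)
  eapply Rbar_le_trans; [apply (norm1_le t _ X bb)|simpl; auto].
  - lra.
  - intros x Hx. apply (Hlim' x x); auto.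
  - intros x Hx. destruct (Hreg x Hx). apply ex_derive_pair; auto.
  - intros x l Hx Hl.
    apply (derive_bound_of_cone (Nat.iter n (transfer S (s, t)) f) x l (bb * Rabs t) X); auto.
    intros y Hy. apply Hlim'; apply Iopen_I; auto.
Qed.
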